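(* There exist $\varepsilon_1\in(0,\varepsilon_0]$, a constant $c>0$, and a function $r:(0,\varepsilon_1)\to\mathbb R$ with $r(\varepsilon)=\mathcal O(\varepsilon^{-1})$ as $\varepsilon\downarrow0$, such that $$\sigma_0(\mathcal L_\varepsilon)\cap\{z\in\mathbb C:\operatorname{Re}(z)\ge -c\,\varepsilon^{-2}+r(\varepsilon)\}=\{0\}\qquad\text{for all }\varepsilon\in(0,\varepsilon_1).$$
   Context: Fix $\alpha\in(0,1/2)$ and $\beta>2$. For $\varepsilon\neq0$ let $f_\varepsilon(u)=-u^3+(1+\alpha)u^2+(3\varepsilon^{-2}-\alpha)u-(1+\alpha)\varepsilon^{-2}$. Let $\varepsilon_0>0$ and $z^-,z^0,z^+:\{\varepsilon\in\mathbb C:0<|\varepsilon|<\varepsilon_0\}\to\mathbb C$ be holomorphic functions with $f_\varepsilon(z^-_\varepsilon)=f_\varepsilon(z^0_\varepsilon)=f_\varepsilon(z^+_\varepsilon)=0$, real-valued with $z^-_\varepsilon<z^0_\varepsilon<z^+_\varepsilon$ for $\varepsilon\in(0,\varepsilon_0)$, and with $z^0_\varepsilon=\frac{1+\alpha}{3}+\mathcal O(\varepsilon^2)$, $z^\pm_\varepsilon=\pm\sqrt3\,\varepsilon^{-1}+\frac{1+\alpha}{3}+\mathcal O(\varepsilon)$ as $\varepsilon\to0$ (such $\varepsilon_0$ and functions exist). For $\varepsilon\in(0,\varepsilon_0)$ set $A_\varepsilon=z^+_\varepsilon-z^-_\varepsilon$, $\Phi^{\mathrm{hux}}(x)=(1+\exp(-x/\sqrt2))^{-1}$,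 $\Phi_\varepsilon(x)=A_\varepsilon\Phi^{\mathrm{hux}}(A_\varepsilon x)+z^-_\varepsilon$ and $s_\varepsilon=\sqrt2\,A_\varepsilon\left(\frac{z^0_\varepsilon-z^-_\varepsilon}{z^+_\varepsilon-z^-_\varepsilon}-\frac12\right)$; then $u(t,x)=\Phi_\varepsilon(x-s_\varepsilon t)$ is a travelling wave solution of $\partial_tu=\partial_x^2u+f_\varepsilon(u)$. Let $w_\beta(x)=(1+|x|^2)^{-\beta/2}$, $L^2(\mathbb R,w_\beta)$ the (complex) $L^2$-space with norm $(\int|u|^2w_\beta\,dx)^{1/2}$, $T:L^2(\mathbb R,w_\beta)\to L^2(\mathbb R)$, $Tu=w_\beta^{1/2}u$ (an isometric isomorphism), and $H=T^{-1}(H^2(\mathbb R))$. The linearization $\mathcal L_\varepsilon$ about the wave is the closed, densely defined operator on $L^2(\mathbb R,w_\beta)$ with domain $H$ given by $$\mathcal L_\varepsilon u=\partial_x^2u+s_\varepsilon\partial_xu+f_\varepsilon'(\Phi_\varepsilon)u.$$ A closed operator on a Banach space is Fredholm if its range is closed and its kernel and cokernel are finite-dimensional. For a closed operator $\mathcal A$, $\sigma_0(\mathcal A)$ is the set of $\lambda\in\mathbb C$ such that $\mathcal A-\lambda I$ is not invertible but is Fredholm of index $0$. *)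

(* Defs.v *)
From HB Require Import structures.
From mathcomp Require Import all_boot all_order all_algebra.
From mathcomp Require Import all_classical all_reals all_analysis.
From mathcomp Require Import measurable_realfun complex.

Set Implicit Arguments.
Unset Strict Implicit.
Unset Printing Implicit Defensive.

Import Order.TTheory GRing.Theory Num.Theory.
Import numFieldNormedType.Exports.
Import ComplexField.Normc.

Local Open Scope classical_set_scope.
Local Open Scope ring_scope.
Local Open Scope complex_scope.

Local Notation Re := complex.Re.
Local Notation Im := complex.Im.

Section SquareIntegrable.
Context {R : realType}.
Local Notation C := R[i].
Local Notation mu := (@lebesgue_measure R).

Lemma ae_imply (P Q : R -> Prop) : (forall x, P x -> Q x) ->
  {ae mu, forall x, P x} -> {ae mu, forall x, Q x}.
Proof. exact: (@filterS _ _ (ae_filter_ringOfSetsType mu)). Qed.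

Lemma ae_imply2 (P Q S : R -> Prop) : (forall x, P x -> Q x -> S x) ->
  {ae mu, forall x, P x} -> {ae mu, forall x, Q x} -> {ae mu, forall x, S x}.
Proof. exact: (@filterS2 _ _ (ae_filter_ringOfSetsType mu)). Qed.

Definition cmeasurable (u : R -> C) :=
  measurable_fun [set: R] (fun x => Re (u x)) /\
  measurable_fun [set: R] (fun x => Im (u x)).

Definition sqnorm (w : R -> R) (u : R -> C) : \bar R :=
  (\int[mu]_x (normc (u x) ^+ 2 * w x)%:E)%E.

Definition sqintegrable (w : R -> R) (u : R -> C) :=
  cmeasurable u /\ (sqnorm w u < +oo)%E.

Definition L2norm (w : R -> R) (u : R -> C) : R :=
  Num.sqrt (fine (sqnorm w u)).

Lemma normc_ge0 (z : C) : 0 <= normc z.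
Proof. by case: z => a b; exact: sqrtr_ge0. Qed.

Lemma normc_le (y z : C) : normc (y + z) <= normc y + normc z.
Proof. by rewrite -lecR rmorphD /=; exact: (ler_normD y z). Qed.

Lemma cmeasurable_normc (u : R -> C) :
  cmeasurable u -> measurable_fun [set: R] (fun x => normc (u x)).
Proof.
move=> [mr mi].
have -> : (fun x => normc (u x)) =
    (fun x => Num.sqrt (Re (u x) ^+ 2 + Im (u x) ^+ 2)).
  by apply/funext => x; case: (u x).
have ms : measurable_fun [set: R] (@Num.sqrt R).
  by apply: continuous_measurable_fun => x; exact: sqrt_continuous.
apply: (measurableT_comp ms).
by apply: measurable_funD; exact: measurable_funX.
Qed.

Lemma cmeasurable0 : cmeasurable (0 : R -> C).
Proof. by split => /=; exact: measurable_cst. Qed.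

Lemma cmeasurableD (u v : R -> C) :
  cmeasurable u -> cmeasurable v -> cmeasurable (u + v).
Proof.
move=> [ur ui] [vr vi]; split.
  rewrite (_ : (fun _ => _) = (fun x => Re (u x)) \+ (fun x => Re (v x))).
    exact: measurable_funD.
  by apply/funext => x; rewrite fctE /=; case: (u x) => ? ?; case: (v x).
rewrite (_ : (fun _ => _) = (fun x => Im (u x)) \+ (fun x => Im (v x))).
  exact: measurable_funD.
by apply/funext => x; rewrite fctE /=; case: (u x) => ? ?; case: (v x).
Qed.

Lemma cmeasurableZ (a : C) (u : R -> C) :
  cmeasurable u -> cmeasurable (a *: u).
Proof.
move=> [ur ui]; split.
  rewrite (_ : (fun _ => _) =
      (fun x => Re a * Re (u x)) \- (fun x => Im a * Im (u x))).
    by apply: measurable_funB; apply: measurable_funM.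
  by apply/funext => x; rewrite fctE /=; case: (u x) => ? ?; case: a.
rewrite (_ : (fun _ => _) =
    (fun x => Re a * Im (u x)) \+ (fun x => Im a * Re (u x))).
  by apply: measurable_funD; apply: measurable_funM.
by apply/funext => x; rewrite fctE /=; case: (u x) => ? ?; case: a.
Qed.

Section Weight.
Variable w : R -> R.
Hypothesis mw : measurable_fun [set: R] w.
Hypothesis w_gt0 : forall x, 0 < w x.

Let wabs (u : R -> C) x : R := normc (u x) * Num.sqrt (w x).

Let wabs_ge0 u x : 0 <= wabs u x.
Proof. by rewrite mulr_ge0 ?normc_ge0 ?sqrtr_ge0. Qed.

Let mwabs u : cmeasurable u -> measurable_fun [set: R] (wabs u).
Proof.
move=> mu_; apply: measurable_funM; first exact: cmeasurable_normc.
have ms : measurable_fun [set: R] (@Num.sqrt R).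
  by apply: continuous_measurable_fun => x; exact: sqrt_continuous.
exact: (measurableT_comp ms mw).
Qed.

Let sqnormE u : sqnorm w u = (\int[mu]_x (`|wabs u x| `^ 2)%:E)%E.
Proof.
apply: eq_integral => x _; rewrite ger0_norm// powR_mulrn//.
by rewrite exprMn sqr_sqrtr ?ltW.
Qed.

Lemma sqnorm_ge0 u : (0 <= sqnorm w u)%E.
Proof.
by apply: integral_ge0 => x _; rewrite lee_fin mulr_ge0 ?sqr_ge0 ?ltW.
Qed.

Let LnormE u : 'N[mu]_2%:E[EFin \o wabs u]%E = (sqnorm w u `^ 2^-1)%E.
Proof. by rewrite unlock /Lnorm sqnormE. Qed.

Let L2normE u : sqintegrable w u ->
  (L2norm w u)%:E = 'N[mu]_2%:E[EFin \o wabs u]%E.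
Proof.
move=> [_ foo]; rewrite LnormE /L2norm.
have fn : sqnorm w u \is a fin_num by rewrite ge0_fin_numE ?sqnorm_ge0.
by rewrite -{2}(fineK fn) poweR_EFin powR12_sqrt// fine_ge0 ?sqnorm_ge0.
Qed.

Let Lnorm_triangle u v : cmeasurable u -> cmeasurable v ->
  ('N[mu]_2%:E[EFin \o wabs (u + v)%R] <=
   'N[mu]_2%:E[EFin \o wabs u] + 'N[mu]_2%:E[EFin \o wabs v])%E.
Proof.
move=> mu_ mv.
have := @minkowski_EFin _ _ R mu (wabs u) (wabs v) 2 (mwabs mu_) (mwabs mv).
move=> /(_ (ler1n _ 2)); apply: le_trans.
rewrite unlock /Lnorm gt0_ler_poweR//.
- by rewrite in_itv/= leey andbT; apply: integral_ge0 => x _; rewrite lee_fin powR_ge0.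
- by rewrite in_itv/= leey andbT; apply: integral_ge0 => x _; rewrite lee_fin powR_ge0.
- apply: ge0_le_integral => //=.
  + apply/measurable_EFinP; apply: (measurableT_comp (measurable_powR _)).
    by apply: measurableT_comp => //; apply: mwabs; exact: cmeasurableD.
  + apply/measurable_EFinP; apply: (measurableT_comp (measurable_powR _)).
    by apply: measurableT_comp => //; apply: measurable_funD; exact: mwabs.
  + move=> x _; rewrite lee_fin ge0_ler_powR ?nnegrE//.
    rewrite ger0_norm// ger0_norm ?addr_ge0//.
    by rewrite /wabs -mulrDl ler_wpM2r ?sqrtr_ge0// normc_le.
Qed.

Let fin_L2norm u : cmeasurable u ->
  (sqnorm w u < +oo)%E <-> ('N[mu]_2%:E[EFin \o wabs u] < +oo)%E.
Proof.
move=> _; rewrite LnormE; split; first exact: poweR_lty.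
by move=> /(@lty_poweRy _ _ _); apply; rewrite invr_neq0.
Qed.

Lemma sqintegrable0 : sqintegrable w 0.
Proof.
split; first exact: cmeasurable0.
rewrite /sqnorm integral0_eq// => x _.
by rewrite /= expr0n /= addr0 sqrtr0 expr0n mul0r.
Qed.

Lemma sqintegrableD u v :
  sqintegrable w u -> sqintegrable w v -> sqintegrable w (u + v).
Proof.
move=> [mu_ fu] [mv fv]; have muv := cmeasurableD mu_ mv; split => //.
apply/(fin_L2norm muv); apply: le_lt_trans (Lnorm_triangle mu_ mv) _.
by rewrite lte_add_pinfty//; exact/fin_L2norm.
Qed.

Lemma sqnormZ a u : cmeasurable u ->
  sqnorm w (a *: u) = ((normc a ^+ 2)%:E * sqnorm w u)%E.
Proof.
move=> mu_; rewrite /sqnorm -ge0_integralZl//=.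
- by apply: eq_integral => x _; rewrite -EFinM mulrA -exprMn -normcM.
- apply/measurable_EFinP; apply: measurable_funM => //.
  by apply: measurable_funX; exact: cmeasurable_normc.
- by move=> x _; rewrite lee_fin mulr_ge0 ?sqr_ge0 ?ltW.
- by rewrite lee_fin sqr_ge0.
Qed.

Lemma sqintegrableZ a u : sqintegrable w u -> sqintegrable w (a *: u).
Proof.
move=> [mu_ fu]; split; first exact: cmeasurableZ.
by rewrite sqnormZ// lte_mul_pinfty// lee_fin sqr_ge0.
Qed.

Lemma L2normD u v : sqintegrable w u -> sqintegrable w v ->
  L2norm w (u + v) <= L2norm w u + L2norm w v.
Proof.
move=> iu iv; rewrite -lee_fin EFinD !L2normE//; last exact: sqintegrableD.
by apply: Lnorm_triangle; [case: iu | case: iv].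
Qed.

Lemma L2normZ a u : sqintegrable w u ->
  L2norm w (a *: u) = normc a * L2norm w u.
Proof.
move=> [mu_ fu]; rewrite /L2norm sqnormZ// fineM//.
  by rewrite /= sqrtrM ?sqr_ge0// sqrtr_sqr ger0_norm ?normc_ge0.
by rewrite ge0_fin_numE ?sqnorm_ge0.
Qed.

Lemma eq_L2norm u v :
  {ae mu, forall x, u x = v x} -> cmeasurable u -> cmeasurable v ->
  L2norm w u = L2norm w v.
Proof.
move=> uv mu_ mv; rewrite /L2norm; congr (Num.sqrt (fine _)).
have mI z : cmeasurable z ->
    measurable_fun [set: R] (fun x => (normc (z x) ^+ 2 * w x)%:E).
  move=> mz; apply/measurable_EFinP; apply: measurable_funM => //.
  by apply: measurable_funX; exact: cmeasurable_normc.
apply: ae_eq_integral => //; [exact: mI|exact: mI|].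
by apply: ae_imply uv => x /= -> _.
Qed.

Lemma L2norm_eq0 u : sqintegrable w u -> L2norm w u = 0 ->
  {ae mu, forall x, u x = 0}.
Proof.
move=> iu u0; have [mu_ fu] := iu.
have := L2normE iu; rewrite u0 => /esym /Lnorm_eq0_eq0.
have /measurable_EFinP mW := mwabs mu_.
move=> /(_ mW (ltr0n _ 2)); apply: ae_imply => x /(_ I) /= [] /eqP.
rewrite mulf_eq0 sqrtr_eq0 leNgt w_gt0 orbF => /eqP.
exact: eq0_normc.
Qed.

End Weight.
End SquareIntegrable.

Section WeightedL2.
Context {R : realType}.
Variable beta : R.
Local Notation C := R[i].
Local Notation mu := (@lebesgue_measure R).

Definition weight (x : R) : R := (1 + `|x| ^+ 2) `^ (- beta / 2).

Lemma weight_gt0 x : 0 < weight x.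
Proof. by rewrite powR_gt0// ltr_wpDr ?sqr_ge0. Qed.

Lemma measurable_weight : measurable_fun [set: R] weight.
Proof.
apply: (measurableT_comp (measurable_powR _)).
apply: measurable_funD => //; apply: measurable_funX.
by apply: continuous_measurable_fun => x; exact: norm_continuous.
Qed.

Definition L2pre_pred : {pred R -> C} :=
  fun u => `[< sqintegrable weight u >].

Lemma L2pre_submod_closed : submod_closed L2pre_pred.
Proof.
split; first by apply/asboolP; exact: sqintegrable0.
move=> a u v /asboolP iu /asboolP iv; apply/asboolP.
apply: sqintegrableD => //; [exact: measurable_weight|exact: weight_gt0|].
by apply: sqintegrableZ => //; [exact: measurable_weight|exact: weight_gt0].
Qed.

HB.instance Definition _ :=
  GRing.isSubmodClosed.Build C (R -> C) L2pre_pred L2pre_submod_closed.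

(* The square-integrable functions themselves, before identification of
   functions that agree almost everywhere. *)
Record L2pre : Type :=
  MkL2pre { L2pre_fun : R -> C ; _ : L2pre_fun \in L2pre_pred }.

HB.instance Definition _ := [isSub for L2pre_fun].
HB.instance Definition _ := [Choice of L2pre by <:].
HB.instance Definition _ := [SubChoice_isSubLmodule of L2pre by <:].

Lemma L2preP (u : L2pre) : sqintegrable weight (L2pre_fun u).
Proof. by case: u => u /= /asboolP. Qed.

Lemma L2pre_funD (u v : L2pre) x :
  L2pre_fun (u + v) x = L2pre_fun u x + L2pre_fun v x.
Proof. by []. Qed.

Lemma L2pre_funB (u v : L2pre) x :
  L2pre_fun (u - v) x = L2pre_fun u x - L2pre_fun v x.
Proof. by []. Qed.

Lemma L2pre_funZ a (u : L2pre) x : L2pre_fun (a *: u) x = a * L2pre_fun u x.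
Proof. by []. Qed.

Definition null_pred : {pred L2pre} :=
  fun u => `[< {ae mu, forall x, L2pre_fun u x = 0} >].

Lemma null_zmod_closed : zmod_closed null_pred.
Proof.
split; first by apply/asboolP; exact: aeW.
move=> u v /asboolP u0 /asboolP v0; apply/asboolP.
move: u0 v0; apply: ae_imply2 => x ux vx.
by rewrite L2pre_funB ux vx subrr.
Qed.

HB.instance Definition _ :=
  GRing.isZmodClosed.Build L2pre null_pred null_zmod_closed.

Definition L2w : Type := Quotient.quot null_pred.

HB.instance Definition _ := GRing.Zmodule.on L2w.
HB.instance Definition _ := EqQuotient.on L2w.

Definition L2class (u : L2pre) : L2w := \pi_(L2w)%qT u.

(* A representative of the class. *)
Definition L2w_fun (u : L2w) : R -> C := L2pre_fun (repr u).
Coercion L2w_fun : L2w >-> Funclass.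

Lemma L2reprK (u : L2w) : L2class (repr u) = u.
Proof. exact: reprK. Qed.

Lemma L2class_zmod_morphism : zmod_morphism L2class.
Proof. exact: (raddfB (\pi_(L2w)%qT : L2pre -> L2w)). Qed.

HB.instance Definition _ :=
  GRing.isZmodMorphism.Build L2pre L2w L2class L2class_zmod_morphism.

Lemma L2classD u v : L2class (u + v) = L2class u + L2class v.
Proof. exact: (raddfD L2class). Qed.

Lemma L2class0 : L2class 0 = 0.
Proof. exact: (raddf0 L2class). Qed.

Lemma L2w_eq_pi (u v : L2pre) :
  (L2class u = L2class v) <->
  {ae mu, forall x, L2pre_fun u x = L2pre_fun v x}.
Proof.
split.
  move=> /eqP; rewrite -Quotient.idealrBE => /asboolP.
  by apply: ae_imply => x /eqP; rewrite L2pre_funB subr_eq0 => /eqP.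
move=> uv; apply/eqP; rewrite -Quotient.idealrBE; apply/asboolP.
by apply: ae_imply uv => x uvx; rewrite L2pre_funB uvx subrr.
Qed.

Lemma L2w_eqP (u v : L2w) : u = v <-> {ae mu, forall x, u x = v x}.
Proof. by rewrite -L2w_eq_pi !L2reprK. Qed.

Lemma L2w_piE (u : L2pre) : {ae mu, forall x, L2class u x = L2pre_fun u x}.
Proof. by apply/L2w_eq_pi; rewrite L2reprK. Qed.

Definition L2w_scale (a : C) (u : L2w) : L2w := L2class (a *: repr u).

Lemma L2w_scale_pi a u : L2w_scale a (L2class u) = L2class (a *: u).
Proof.
apply/L2w_eq_pi; apply: ae_imply (L2w_piE u) => x e.
by rewrite !L2pre_funZ; congr (_ * _).
Qed.

Lemma L2w_scaleA a b u : L2w_scale a (L2w_scale b u) = L2w_scale (a * b) u.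
Proof. by rewrite -[u]L2reprK !L2w_scale_pi scalerA. Qed.

Lemma L2w_scale1 : left_id 1 L2w_scale.
Proof. by move=> u; rewrite -[u]L2reprK L2w_scale_pi scale1r. Qed.

Lemma L2w_scaleDr : right_distributive L2w_scale +%R.
Proof.
move=> a u v; rewrite -[u]L2reprK -[v]L2reprK !L2w_scale_pi.
by rewrite -L2classD L2w_scale_pi scalerDr L2classD.
Qed.

Lemma L2w_scaleDl u : {morph L2w_scale^~ u : a b / a + b}.
Proof.
by move=> a b; rewrite -[u]L2reprK !L2w_scale_pi scalerDl L2classD.
Qed.

HB.instance Definition _ := GRing.Zmodule_isLmodule.Build C L2w
  L2w_scaleA L2w_scale1 L2w_scaleDr L2w_scaleDl.

Lemma L2w_addE (u v : L2w) : {ae mu, forall x, L2w_fun (u + v) x = u x + v x}.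
Proof.
have := L2w_piE (repr u + repr v); rewrite L2classD !L2reprK.
by apply: ae_imply => x ->.
Qed.

Lemma L2w_scaleE a (u : L2w) : {ae mu, forall x, L2w_fun (a *: u) x = a * u x}.
Proof. exact: L2w_piE (a *: repr u). Qed.

Lemma L2w_cmeasurable (u : L2w) : cmeasurable u.
Proof. by have [] := L2preP (repr u). Qed.

(* The norm of a [normedModType R[i]] takes its values in [R[i]]. *)
Definition L2w_norm (u : L2w) : C := (L2norm weight u)%:C.

Let L2norm_pi (u : L2w) (v : R -> C) : cmeasurable v ->
  {ae mu, forall x, u x = v x} -> L2norm weight u = L2norm weight v.
Proof.
move=> mv uv; apply: eq_L2norm => //; first exact: measurable_weight.
exact: L2w_cmeasurable.
Qed.

Lemma L2w_normD u v : L2w_norm (u + v) <= L2w_norm u + L2w_norm v.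
Proof.
rewrite /L2w_norm -rmorphD lecR.
have [mU mV] := (L2w_cmeasurable u, L2w_cmeasurable v).
rewrite (L2norm_pi (cmeasurableD mU mV) (L2w_addE u v)).
apply: L2normD; [exact: measurable_weight|exact: weight_gt0|..];
  exact: L2preP.
Qed.

Lemma L2w_normZ (a : C) u : L2w_norm (a *: u) = `|a| * L2w_norm u.
Proof.
rewrite /L2w_norm (L2norm_pi (cmeasurableZ a (L2w_cmeasurable u))).
  rewrite L2normZ ?rmorphM//; [|exact: weight_gt0|exact: L2preP].
  exact: measurable_weight.
exact: L2w_scaleE.
Qed.

Lemma L2w_norm_eq0 u : L2w_norm u = 0 -> u = 0.
Proof.
move=> /complexI u0; rewrite -[u]L2reprK -[RHS]L2class0.
apply/L2w_eq_pi; rewrite [L2pre_fun 0]/=.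
by apply: (L2norm_eq0 measurable_weight weight_gt0 _ u0); exact: L2preP.
Qed.

HB.instance Definition _ := Lmodule_isNormed.Build C L2w
  L2w_normD L2w_normZ L2w_norm_eq0.

End WeightedL2.

(* Unbounded linear operators in a normed space are given by their graphs:
   [A u v] means that [u] belongs to the domain of [A] and [A u = v]. *)
Section FredholmSpectrum.
Context {K : numFieldType} {X : normedModType K}.
Implicit Types (A : X -> X -> Prop) (V : set X) (l : K).

Definition op_range A : set X := [set v | exists u, A u v].

Definition op_kernel A : set X := [set u | A u 0].

(* [A - l I] *)
Definition op_shift A l : X -> X -> Prop := fun u v => A u (v + l *: u).

(* A basis of the subspace [V]. *)
Definition has_dim V (n : nat) := exists b : 'I_n -> X,
  (forall i, V (b i)) /\
  (forall x, V x ->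
     exists! c : {ffun 'I_n -> K}, x = \sum_(i < n) c i *: b i).

(* The classes of the [b i] form a basis of [X / V]. *)
Definition has_codim V (n : nat) := exists b : 'I_n -> X,
  forall x, exists! c : {ffun 'I_n -> K}, V (x - \sum_(i < n) c i *: b i).

Definition fredholm_of_index A (k : int) := exists n m : nat,
  [/\ closed (op_range A), has_dim (op_kernel A) n,
      has_codim (op_range A) m & k = n%:Z - m%:Z].

Definition op_invertible A :=
  (forall v, exists! u, A u v) /\
  (exists M : K, forall u v, A u v -> `|u| <= M * `|v|).

Definition sigma0 A : set K :=
  [set l | ~ op_invertible (op_shift A l) /\
           fredholm_of_index (op_shift A l) 0].

End FredholmSpectrum.

Section Sobolev.
Context {R : realType}.
Local Notation C := R[i].
Local Notation mu := (@lebesgue_measure R).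

(* C^1 with compact support, as in Brezis, Functional Analysis, Sobolev Spaces
   and PDEs, section 8.2. *)
Definition test_function (phi : R -> R) :=
  [/\ forall x, derivable phi x 1, continuous (derive1 phi) &
      exists M : R, forall x, M < `|x| -> phi x = 0].

Definition clocally_integrable (u : R -> C) :=
  locally_integrable [set: R] (fun x => Re (u x)) /\
  locally_integrable [set: R] (fun x => Im (u x)).

Definition weak_derivative (u v : R -> C) :=
  [/\ clocally_integrable u, clocally_integrable v &
      forall phi, test_function phi ->
        (\int[mu]_x (Re (u x) * derive1 phi x)) =
          - (\int[mu]_x (Re (v x) * phi x)) /\
        (\int[mu]_x (Im (u x) * derive1 phi x)) =
          - (\int[mu]_x (Im (v x) * phi x))].

Definition in_L2 (u : R -> C) := sqintegrable (cst 1) u.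

Definition in_H2 (u : R -> C) := exists u1 u2 : R -> C,
  [/\ in_L2 u, in_L2 u1, in_L2 u2, weak_derivative u u1 &
      weak_derivative u1 u2].

End Sobolev.

Section Nagumo.

Definition reaction (K : fieldType) (alpha eps u : K) : K :=
  - u ^+ 3 + (1 + alpha) * u ^+ 2 + (3 * eps ^- 2 - alpha) * u
  - (1 + alpha) * eps ^- 2.

Context {R : realType}.
Local Notation C := R[i].
Local Notation mu := (@lebesgue_measure R).

Definition huxley (x : R) : R := (1 + expR (- x / Num.sqrt 2))^-1.

Definition wave (zm zp x : R) : R := (zp - zm) * huxley ((zp - zm) * x) + zm.

Definition wave_speed (zm z0 zp : R) : R :=
  Num.sqrt 2 * (zp - zm) * ((z0 - zm) / (zp - zm) - 1 / 2).

(* The isometry [T : L2(w) -> L2], on representatives; [domainH] does not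
   depend on the choice of representative. *)
Definition L2w_T (beta : R) (u : R -> C) : R -> C :=
  fun x => (Num.sqrt (weight beta x))%:C * u x.

Definition domainH (beta : R) : set (L2w beta) :=
  [set u | in_H2 (L2w_T beta u)].

(* Graph of [u |-> u'' + s u' + f'(Phi) u] with domain [H]. *)
Definition linearization (beta alpha eps zm z0 zp : R)
    (u v : L2w beta) : Prop :=
  domainH u /\
  exists u1 u2 : R -> C,
    [/\ weak_derivative u u1, weak_derivative u1 u2 &
      {ae mu, forall x, v x = u2 x + (wave_speed zm z0 zp)%:C * u1 x +
        (derive1 (reaction alpha eps) (wave zm zp x))%:C * u x}].

(* [C^o] is [C] as a normed space over itself, so that [derivable] is complex
   differentiability. *)
Definition holomorphic_on (D : set C) (f : C -> C) :=
  forall e, D e -> derivable (f : C^o -> C^o) e 1.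

Definition punctured_disc (r : R) : set C := [set e | 0 < normc e < r].

Definition bigO_at0 (f g : C -> C) :=
  (f : C^o -> C^o) =O_ ((0 : C^o)^') (g : C^o -> C^o).

Definition bigO_right0 (f g : R -> R) :=
  (f : R -> R^o) =O_ ((0 : R)^'+) (g : R -> R^o).

End Nagumo.

(* Main.v *)
Require Import Defs.
From mathcomp Require Import all_boot all_order all_algebra.
From mathcomp Require Import all_classical all_reals all_analysis.
From mathcomp Require Import measurable_realfun complex.
From mathcomp Require Import ring lra.

(** Write A = zp - zm, phi x = huxley (A * x), psi = phi * (1 - phi) and
    k = psi' / psi.  Up to a positive factor psi is the derivative of the wave,
    so the linearization L annihilates it, and the second-order operator
    factors:
      L = D^2 + s D - (k' + k^2 + s k) = (D + q) (D - k),   q = k + s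
    ([reaction_along_wave], [factorization]).

    The explicit front gives k^2 - k' = A^2 (1/2 - psi) >= A^2 / 4.  Hence the
    product of the factors in the other order,
      (D - k) (D + q) = D^2 + s D - (k^2 - k') - s k,
    is bounded above by about - A^2 / 4, although L itself has a kernel.  If
    L u = lam u + v, then p = u' - k u solves
      (D - k) (D + q) p = lam p + (D - k) v,
    and pairing with p in L^2(w) bounds p and p' by v as soon as
    Re lam >= - A^2 / 16 ([energy], [a_priori]).  The weight costs only the
    logarithmic derivative w' / w, which is bounded by beta whereas A grows
    like 1 / eps.  Since lam u = (D + q) p - v, also |lam| |u| <= C |v|: for
    lam <> 0 the operator L - lam is injective with a bounded inverse on its
    range.  A Fredholm operator of index 0 with trivial kernel is onto, so
    such a lam is outside sigma0 ([sigma0_slice]).  Because A >= 1 / eps for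
    small eps ([wave_asymptotics]), the half-plane contains
    Re lam >= - eps^(-2) / 16, which allows c = 1/16 and r = 0.

    For lam = 0 the estimate gives p = 0, so the kernel is spanned by psi
    ([kernel_span]).  The function rho = exp(s x) psi satisfies rho' = q rho
    and therefore spans the kernel of the formal adjoint; the range of L is
    exactly the kernel of v |-> int rho v ([rangeP]).  One inclusion integrates
    (rho p)' = rho L u over the line; for the other, p' + q p = v and then
    u' - k u = p are solved by quadrature ([solve_p], [solve_u]).  As k and q
    are close to - A / sqrt 2 on the far right and to A / sqrt 2 on the far
    left, energy inequalities on the two half-lines show that these solutions
    lie in L^2(w).  The functional is continuous because rho decays
    exponentially, and int rho psi > 0; so the range is closed with complement
    spanned by psi, and L is Fredholm of index 0 with a nontrivial kernel: 0
    is in sigma0.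

    All calculus is done with absolutely continuous functions, in the form
    F b - F a = int_a^b f ([primitive]); du Bois-Reymond's lemma
    ([weak_primitive]) translates weak derivatives into this language. *)

Set Implicit Arguments.
Unset Strict Implicit.
Unset Printing Implicit Defensive.

Import Order.TTheory GRing.Theory Num.Theory.
Import numFieldNormedType.Exports.

Local Open Scope classical_set_scope.
Local Open Scope ring_scope.
Local Open Scope complex_scope.

Import ComplexField.Normc.

Local Notation Re := complex.Re.
Local Notation Im := complex.Im.

(** * Continuously differentiable functions *)

Section ContinuouslyDifferentiable.
Context {R : realType}.
Implicit Types (F G f g : R -> R) (c x : R).

Lemma is_derive_continuous F f : (forall x, is_derive x 1 F (f x)) -> continuous F.
Proof.
by move=> dF x; apply: differentiable_continuous; apply/derivable1_diffP; case: (dF x).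
Qed.

Definition C1 F f := (forall x, is_derive x 1 F (f x)) /\ continuous f.

Lemma C1_continuous F f : C1 F f -> continuous F.
Proof. by move=> [dF _]; exact: is_derive_continuous dF. Qed.

Lemma C1_measurable F f : C1 F f -> measurable_fun [set: R] F.
Proof. by move=> /C1_continuous; exact: continuous_measurable_fun. Qed.

Lemma C1_measurable_deriv F f : C1 F f -> measurable_fun [set: R] f.
Proof. by move=> [_]; exact: continuous_measurable_fun. Qed.

Lemma C1_eq F G f g : F =1 G -> f =1 g -> C1 F f -> C1 G g.
Proof. by move=> /funext -> /funext ->. Qed.

Lemma C1_cst (c : R) : C1 (fun _ : R => c) (fun _ => 0).
Proof. by split => x; [exact: is_derive_cst|exact: cvg_cst]. Qed.

Lemma C1_id : C1 (fun x : R => x) (fun _ => 1).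
Proof. by split => x; [exact: is_derive_id|exact: cvg_cst]. Qed.

Lemma C1D F G f g : C1 F f -> C1 G g -> C1 (fun x => F x + G x) (fun x => f x + g x).
Proof.
move=> [dF cf] [dG cg]; split => x; last by apply: cvgD; [exact: cf|exact: cg].
by have := dF x; have := dG x => ? ?; apply: is_deriveD.
Qed.

Lemma C1Z c F f : C1 F f -> C1 (fun x => c * F x) (fun x => c * f x).
Proof.
move=> [dF cf]; split => x; last by apply: cvgM; [exact: cvg_cst|exact: cf].
by have := dF x => ?; exact: is_deriveZ.
Qed.

Lemma C1_scale (c : R) : C1 (fun x : R => c * x) (fun _ => c).
Proof. by apply: C1_eq (C1Z c C1_id) => x //=; rewrite mulr1. Qed.

Lemma C1M F G f g : C1 F f -> C1 G g ->
  C1 (fun x => F x * G x) (fun x => f x * G x + F x * g x).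
Proof.
move=> pF pG; have [cF cG] := (C1_continuous pF, C1_continuous pG).
move: pF pG => [dF cf] [dG cg]; split => x.
  have := dF x; have := dG x => ? ?.
  by apply: is_derive_eq; rewrite /GRing.scale/=; ring.
by apply: cvgD; apply: cvgM; [exact: cf|exact: cG|exact: cF|exact: cg].
Qed.

Lemma C1V F f : (forall x, F x != 0) -> C1 F f ->
  C1 (fun x => (F x)^-1) (fun x => - f x / F x ^+ 2).
Proof.
move=> F0 pF; have cF := C1_continuous pF; move: pF => [dF cf]; split => x.
  have := dF x => ?; apply: (is_derive_eq (is_deriveV (F0 x) _)).
  by rewrite /GRing.scale/=; field; exact: F0.
apply: cvgM; first by apply: cvgN; exact: cf.
apply: cvgV; first by rewrite sqrf_eq0.
by apply: cvgM; exact: cF.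
Qed.

Lemma C1_comp F f G g : C1 F f -> C1 G g -> C1 (fun x => F (G x)) (fun x => f (G x) * g x).
Proof.
move=> [dF cf] pG; have cG := C1_continuous pG; move: pG => [dG cg]; split => x.
  have H1 := dF (G x); have H2 := dG x.
  exact: (@is_derive1_comp _ F G x _ _ H1 H2).
apply: cvgM; last exact: cg.
by apply: (@continuous_comp _ _ _ G f); [exact: cG|exact: cf].
Qed.

Lemma C1_shift c F f : C1 F f -> C1 (fun x => F (x + c)) (fun x => f (x + c)).
Proof.
move=> FF; apply: C1_eq (C1_comp FF (C1D C1_id (C1_cst c))) => x //=.
by rewrite addr0 mulr1.
Qed.

Lemma C1_expR : C1 (@expR R) (@expR R).
Proof. by split; [move=> x; exact: is_derive_expR|exact: continuous_expR]. Qed.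

End ContinuouslyDifferentiable.

(** * Absolutely continuous functions *)

Section Primitives.
Context {R : realType}.
Local Notation mu := (@lebesgue_measure R).
Implicit Types (F G f g h : R -> R) (a b c x : R).

Local Notation intble D f := (mu.-integrable D (EFin \o f)).

Lemma locint_itv f a b : locally_integrable [set: R] f -> intble `[a, b] f.
Proof.
move=> [mf _ fK]; apply/integrableP; split.
  by apply/measurable_EFinP; exact: measurable_funTS.
by apply: fK => //; exact: segment_compact.
Qed.

Lemma locint_of_itv f : measurable_fun [set: R] f ->
  (forall a b, a <= b -> intble `[a, b] f) -> locally_integrable [set: R] f.
Proof.
move=> mf fi; split => //; first exact: openT.
move=> K _ cK.
have [M [_ MK]] := compact_bounded cK.
have /MK KM : M < `|M| + 1 by rewrite ltr_pwDr// ler_norm.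
set N := `|M| + 1 in KM; have N0 : - N <= N by rewrite ge0_cp// addr_ge0.
have /integrableP[_] := fi _ _ N0; apply: le_lt_trans.
apply: ge0_subset_integral => //=.
- exact: compact_measurable.
- by apply: measurableT_comp => //; apply: measurableT_comp => //; exact: measurable_funTS.
- by move=> x /KM /=; rewrite in_itv/= -ler_norml.
Qed.

(** [F] is locally absolutely continuous with derivative [f]; stating this by
    integrals makes [f] matter only up to a null set. *)
Definition primitive F f :=
  locally_integrable [set: R] f /\
  forall a b, a <= b -> F b - F a = \int[mu]_(x in `[a, b]) f x.

Lemma continuous_locint f : continuous f -> locally_integrable [set: R] f.
Proof.
move=> cf; apply: locint_of_itv; first exact: continuous_measurable_fun.
move=> a b _; apply: continuous_compact_integrable; first exact: segment_compact.
by apply: continuous_subspaceT => x; exact: cf.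
Qed.

Lemma C1_primitive F f : C1 F f -> primitive F f.
Proof.
move=> FF; have cF := C1_continuous FF; case: FF => dF cf.
split; first exact: continuous_locint.
move=> a b; rewrite le_eqVlt => /predU1P[->|ab].
  by rewrite set_itv1 Rintegral_set1 subrr.
rewrite /Rintegral (@continuous_FTC2 _ _ F)//.
- by apply: continuous_subspaceT => x; exact: cf.
- split; first by move=> x _; case: (dF x).
  + exact/cvg_at_right_filter/cF.
  + exact/cvg_at_left_filter/cF.
- by move=> x _; rewrite derive1E; case: (dF x).
Qed.

Lemma primitive_eq F G f g : F =1 G -> f =1 g -> primitive F f -> primitive G g.
Proof. by move=> /funext -> /funext ->. Qed.

Lemma primitive_measurable_deriv F f : primitive F f -> measurable_fun [set: R] f.
Proof. by move=> [[]]. Qed.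

Lemma primitive_cst c : primitive (fun=> c) (fun=> 0).
Proof.
by apply: C1_primitive; split => [x|x]; [exact: is_derive_cst|exact: cvg_cst].
Qed.

Lemma locintZ c f : locally_integrable [set: R] f ->
  locally_integrable [set: R] (fun x => c * f x).
Proof.
move=> fl; apply: locint_of_itv; first by apply: measurable_funM => //; case: fl.
move=> a b _; have := @integrableZl _ _ _ mu _ (measurable_itv `[a, b]) c _ (locint_itv a b fl).
by [].
Qed.

Lemma primitiveZ c F f : primitive F f -> primitive (fun x => c * F x) (fun x => c * f x).
Proof.
move=> [fl Ff]; split; first exact: locintZ.
move=> a b ab; rewrite -mulrBr (Ff _ _ ab) RintegralZl//.
exact: locint_itv.
Qed.

Lemma primitiveD F G f g : primitive F f -> primitive G g ->
  primitive (fun x => F x + G x) (fun x => f x + g x).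
Proof.
move=> [fl Ff] [gl Gg]; split; first exact: locally_integrableD.
move=> a b ab; rewrite opprD addrACA Ff// Gg// RintegralD//; exact: locint_itv.
Qed.

Lemma primitiveB F G f g : primitive F f -> primitive G g ->
  primitive (fun x => F x - G x) (fun x => f x - g x).
Proof.
move=> [fl Ff] [gl Gg]; split; first exact: locally_integrableB.
move=> a b ab; rewrite RintegralB//; [|exact: locint_itv|exact: locint_itv].
by rewrite -Ff// -Gg//; ring.
Qed.

Lemma primitive_continuous F f : primitive F f -> continuous F.
Proof.
move=> [fl Ff] x.
have xx : x - 1 <= x + 1 by lra.
have := parameterized_integral_continuous xx (locint_itv _ _ fl).
move=> /continuous_within_itvP; have xx' : x - 1 < x + 1 by lra.
move=> /(_ xx') [/(_ x)]; rewrite in_itv/= => /(_ _)/wrap[]; first by lra.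
move=> + _ _; rewrite /parameterized_integral => H.
have {}H : F (x - 1) + \int[mu]_(t in `[x - 1, y]) f t @[y --> x] --> F (x - 1) + \int[mu]_(t in `[x - 1, x]) f t.
  by apply: cvgD => //; exact: cvg_cst.
rewrite -Ff in H; last by lra.
rewrite subrKC in H.
apply: cvg_trans H; apply: near_eq_cvg; near=> y.
rewrite -Ff ?subrKC//.
by apply: ltW; near: y; apply: lt_nbhsr; lra.
Unshelve. all: by end_near. Qed.

Lemma primitive_measurable F f : primitive F f -> measurable_fun [set: R] F.
Proof. by move=> /primitive_continuous; exact: continuous_measurable_fun. Qed.

Lemma locintM_continuous f g : locally_integrable [set: R] f -> continuous g ->
  locally_integrable [set: R] (fun x => f x * g x).
Proof.
move=> fl cg; have mg := continuous_measurable_fun cg.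
apply: locint_of_itv; first by apply: measurable_funM => //; case: fl.
move=> a b ab.
rewrite (_ : EFin \o _ = ((EFin \o g) \* (EFin \o f))%E); last first.
  by apply/funext => x /=; rewrite EFinM muleC.
apply: integrableMr; [exact: measurable_itv|exact: measurable_funTS| |exact: locint_itv].
have /compact_bounded[M [Mr MP]] : compact (g @` `[a, b]).
  apply: continuous_compact; last exact: segment_compact.
  by apply: continuous_subspaceT => x; exact: cg.
by exists M; split => // y My x xab; apply: (MP _ My); exists x.
Qed.

End Primitives.

Section Primitives.
Context {R : realType}.
Local Notation mu := (@lebesgue_measure R).
Implicit Types (F G f g h : R -> R) (a b c x : R).

Local Notation intble D f := (mu.-integrable D (EFin \o f)).

Lemma EFin_Rintegral (D : set (measurableTypeR R)) f : measurable D -> intble D f ->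
  (\int[mu]_(x in D) f x)%:E = (\int[mu]_(x in D) (f x)%:E)%E.
Proof. by move=> mD fi; rewrite /Rintegral fineK// (integrable_fin_num mD fi). Qed.

Lemma intble_eq f g : f =1 g -> intble [set: R] f -> intble [set: R] g.
Proof. by move=> /funext ->. Qed.

Lemma intbleD f g : intble [set: R] f -> intble [set: R] g ->
  intble [set: R] (fun x => f x + g x).
Proof. by move=> fi gi; have := @integrableD _ _ _ mu _ measurableT _ _ fi gi. Qed.

Lemma intbleZ c f : intble [set: R] f -> intble [set: R] (fun x => c * f x).
Proof. by move=> fi; have := @integrableZl _ _ _ mu _ measurableT c _ fi. Qed.

(** Both sides are the double integral of f(x) g(y) over the triangle
    a <= y <= x <= b. *)
Lemma triangle_exchange f g a b : a <= b ->
  intble `[a, b] f -> intble `[a, b] g ->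
  \int[mu]_(x in `[a, b]) (f x * \int[mu]_(y in `[a, x]) g y) =
  \int[mu]_(y in `[a, b]) (g y * \int[mu]_(x in `[y, b]) f x).
Proof.
move=> ab fi gi.
have cut_int h : intble `[a, b] h ->
    intble setT (fun x => if x \in `[a, b] then h x else 0).
  move=> hi; rewrite (_ : (fun _ => _) = h \_ `[a, b]).
    by rewrite -restrict_EFin; apply/integrable_restrict => //; rewrite setTI.
  by apply/funext => x; rewrite patchE mem_setE.
pose f0 x := if x \in `[a, b] then f x else 0.
pose g0 x := if x \in `[a, b] then g x else 0.
have f0i : intble setT f0 by exact: cut_int.
have g0i : intble setT g0 by exact: cut_int.
have mf0 : measurable_fun setT f0 by case/integrableP : f0i => /measurable_EFinP.
have mg0 : measurable_fun setT g0 by case/integrableP : g0i => /measurable_EFinP.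
pose T := [set z : R * R | z.2 <= z.1].
have mT : measurable (T : set (measurableTypeR R * measurableTypeR R)%type).
  have := @measurable_fun_le _ (measurableTypeR R * measurableTypeR R)%type R setT
     snd fst measurableT measurable_snd measurable_fst.
  by rewrite setTI.
pose H (z : R * R) : R := f0 z.1 * g0 z.2 * (z.2 <= z.1)%R%:R.
have mH : measurable_fun setT (EFin \o H).
  rewrite (_ : H = fun z : R * R => f0 z.1 * g0 z.2 * \1_T z); last first.
    apply/funext => z; rewrite /H indicE; congr (_ * _%:R).
    by congr nat_of_bool; apply/idP/idP; rewrite inE.
  apply/measurable_EFinP; apply: measurable_funM.
    apply: measurable_funM.
    - exact: (measurableT_comp mf0 measurable_fst).
    - exact: (measurableT_comp mg0 measurable_snd).
  exact: measurable_indic.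
have iH : (mu \x mu)%E.-integrable setT (EFin \o H).
  apply: (integrable12ltyP mu mu mH).2.
  apply: (@le_lt_trans _ _ (\int[mu]_x (`|f0 x|%:E * \int[mu]_y `|g0 y|%:E))%E).
    apply: ge0_le_integral => //=.
    - by move=> x _; apply: integral_ge0.
    - have mH' : measurable_fun setT (abse \o (EFin \o H)) by exact: measurableT_comp.
      by have := @measurable_fun_fubini_tonelli_F _ _ _ _ R mu _ mH' (fun=> abse_ge0 _).
    - apply: emeasurable_funM; last exact: measurable_cst.
      by apply/measurable_EFinP; exact: measurableT_comp.
    - move=> x _; rewrite -ge0_integralZl//=; last first.
        by apply/measurable_EFinP; exact: measurableT_comp.
      apply: ge0_le_integral => //=.
      + have mHx := measurableT_comp mH (measurable_pair1 x).
        exact: (measurableT_comp (@abse_measurable R setT) mHx).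
      + apply: emeasurable_funM; first exact: measurable_cst.
        by apply/measurable_EFinP; exact: measurableT_comp.
      + move=> y _; rewrite -EFinM lee_fin /H/= !normrM.
        rewrite -[leRHS]mulr1 ler_wpM2l ?mulr_ge0//.
        by rewrite normr_nat lern1 leq_b1.
  have /integrableP[_ g0y] := g0i; have /integrableP[_ f0y] := f0i.
  rewrite ge0_integralZr//; last first.
  - exact: integral_ge0.
  - by apply/measurable_EFinP; exact: measurableT_comp.
  by rewrite lte_mul_pinfty// ?integral_ge0// ge0_fin_numE// integral_ge0.
have := Fubini iH.
have gx x : x \in `[a, b] -> (\int[mu]_y (EFin \o H) (x, y) =
    (f x * \int[mu]_(y in `[a, x]) g y)%:E)%E.
  move=> xab; have [ax xb] : a <= x /\ x <= b by move: xab; rewrite in_itv/= => /andP.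
  have gix : intble `[a, x] g.
    by apply: integrableS gi => // y /=; rewrite !in_itv/= => /andP[-> /le_trans ->].
  rewrite EFinM EFin_Rintegral// -integralZl//.
  rewrite [in RHS]integral_mkcond; apply: eq_integral => y _ /=.
  rewrite patchE mem_setE /H/= /f0 /g0 !in_itv/= ax xb/=.
  have [ay|ya] := leP a y => /=; last by rewrite mulr0 mul0r.
  have [yx|xy] := leP y x; last by rewrite mulr0.
  by rewrite (le_trans yx xb) mulr1.
have fy y : y \in `[a, b] -> (\int[mu]_x (EFin \o H) (x, y) =
    (g y * \int[mu]_(x in `[y, b]) f x)%:E)%E.
  move=> yab; have [ay yb] : a <= y /\ y <= b by move: yab; rewrite in_itv/= => /andP.
  have fiy : intble `[y, b] f.
    by apply: integrableS fi => // x /=; rewrite !in_itv/= => /andP[/(le_trans ay) -> ->].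
  rewrite EFinM EFin_Rintegral// -integralZl//.
  rewrite [in RHS]integral_mkcond; apply: eq_integral => x _ /=.
  rewrite patchE mem_setE /H/= /f0 /g0 !in_itv/= ay yb/=.
  have [xb|bx] := leP x b => /=; last by rewrite !andbF mul0r mul0r.
  have [yx|xy] := leP y x; last by rewrite mulr0.
  by rewrite (le_trans ay yx) mulr1 mulrC.
rewrite (_ : (\int[mu]_x _)%E = (\int[mu]_(x in `[a, b]) (f x * \int[mu]_(y in `[a, x]) g y)%:E)%E); last first.
  rewrite [RHS]integral_mkcond; apply: eq_integral => x _ /=.
  rewrite patchE mem_setE; case: ifPn => [/gx//|xab].
  rewrite integral0_eq// => y _; rewrite /H /f0/= (negbTE xab).
  by rewrite mul0r mul0r.
rewrite (_ : (\int[mu]_y \int[mu]_x _)%E = (\int[mu]_(y in `[a, b]) (g y * \int[mu]_(x in `[y, b]) f x)%:E)%E); last first.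
  rewrite [RHS]integral_mkcond; apply: eq_integral => y _ /=.
  rewrite patchE mem_setE; case: ifPn => [/fy//|yab].
  rewrite integral0_eq// => x _; rewrite /H /g0/= (negbTE yab).
  by rewrite mulr0 mul0r.
by rewrite /Rintegral => ->.
Qed.

(** Integration by parts: substituting G x = G a + int_a^x g and
    F y = F b - int_y^b f turns [triangle_exchange] into the product rule. *)
Lemma primitiveM F G f g : primitive F f -> primitive G g ->
  primitive (fun x => F x * G x) (fun x => f x * G x + F x * g x).
Proof.
move=> pF pG; have [cF cG] := (primitive_continuous pF, primitive_continuous pG).
have [[fl Ff] [gl Gg]] := (pF, pG).
have fG : locally_integrable [set: R] (fun x => f x * G x) by exact: locintM_continuous.
have Fg : locally_integrable [set: R] (fun x => F x * g x).
  have -> : (fun x => F x * g x) = (fun x => g x * F x) by apply/funext => x; rewrite mulrC.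
  exact: locintM_continuous.
split; first exact: locally_integrableD.
move=> a b ab.
have fi := locint_itv a b fl; have gi := locint_itv a b gl.
have fGi := locint_itv a b fG; have Fgi := locint_itv a b Fg.
have gF : intble `[a, b] (fun x => g x * F x).
  by apply: eq_integrable Fgi => // x _ /=; rewrite mulrC.
have := triangle_exchange ab fi gi.
have -> : \int[mu]_(x in `[a, b]) (f x * \int[mu]_(y in `[a, x]) g y) =
    \int[mu]_(x in `[a, b]) (f x * G x) - G a * (F b - F a).
  rewrite (Ff _ _ ab) -RintegralZl// -RintegralB//.
    apply: eq_Rintegral => x /set_mem/=; rewrite in_itv/= => /andP[ax _].
    by rewrite -Gg//; ring.
  exact: (locint_itv a b (locintZ _ fl)).
have -> : \int[mu]_(y in `[a, b]) (g y * \int[mu]_(x in `[y, b]) f x) =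
    F b * (G b - G a) - \int[mu]_(x in `[a, b]) (F x * g x).
  rewrite (Gg _ _ ab) -RintegralZl// -RintegralB//.
    apply: eq_Rintegral => x /set_mem/=; rewrite in_itv/= => /andP[_ xb].
    by rewrite -Ff//; ring.
  exact: (locint_itv a b (locintZ _ gl)).
rewrite RintegralD// => E.
have -> : \int[mu]_(x in `[a, b]) (f x * G x) =
  F b * (G b - G a) - \int[mu]_(x in `[a, b]) (F x * g x) + G a * (F b - F a).
  by rewrite -E; ring.
by ring.
Qed.

Lemma primitive_exists f c : locally_integrable [set: R] f ->
  exists2 F, primitive F f & F c = 0.
Proof.
move=> fl.
pose F x := if c <= x then \int[mu]_(t in `[c, x]) f t else - \int[mu]_(t in `[x, c]) f t.
exists F; last by rewrite /F lexx set_itv1 Rintegral_set1.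
have chasles a b d : a <= b -> b <= d ->
    \int[mu]_(t in `[a, d]) f t = \int[mu]_(t in `[a, b]) f t + \int[mu]_(t in `[b, d]) f t.
  move=> ab bd.
  have := @Rintegral_itvB R f (BLeft a) (BRight d) b (locint_itv a d fl).
  rewrite !bnd_simp => /(_ ab bd) /eqP; rewrite subr_eq addrC => /eqP ->; congr (_ + _).
  rewrite Rintegral_itv_obnd_cbnd//.
  by apply: integrableS (locint_itv b d fl) => //; apply: subset_itvr; rewrite bnd_simp.
split => // a b ab; rewrite /F.
have [ca|ac] := leP c a; have [cb|bc] := leP c b.
- by rewrite (chasles c a b)//; ring.
- by have := le_lt_trans ab bc; rewrite ltNge ca.
- by rewrite (chasles a c b) ?(ltW ac)//; ring.
- by rewrite (chasles a b c) ?(ltW bc)//; ring.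
Qed.

End Primitives.

(** * The fundamental lemma for weak derivatives *)

Section Weak.
Context {R : realType}.
Local Notation mu := (@lebesgue_measure R).
Implicit Types (F G f g h u v : R -> R) (a b c x : R).

Local Notation intble D f := (mu.-integrable D (EFin \o f)).

Lemma lebesgue_pt_near h x e : locally_integrable [set: R] h -> lebesgue_pt h x ->
  0 < e -> \forall d \near 0^'+,
    \int[mu]_(y in `[x - d, x + d]) `|h y - h x| <= e * d.
Proof.
move=> hl hx e0.
have e2 : 0 < e / 2 by rewrite divr_gt0.
have : \forall d \near 0^'+, (davg h x d < (e / 2)%:E)%E.
  have := @nbhs_open_ereal_lt R 0 (fun=> e / 2) e2.
  exact: hx.
move=> H; near=> d.
have d0 : 0 < d by near: d; exact: nbhs_right_gt.
have : (davg h x d < (e / 2)%:E)%E by near: d.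
have il : locally_integrable [set: R] (fun y => h y - h x).
  apply: (locally_integrableB hl).
  by apply: continuous_locint => y; exact: cvg_cst.
have i1 : intble `[x - d, x + d] (fun y => `|h y - h x|).
  exact/integrable_norm/locint_itv.
rewrite /davg /iavg lebesgue_measure_ball; last exact: ltW.
rewrite ball_itv.
have d2 : 0 < d *+ 2 by rewrite mulrn_wgt0.
rewrite inver gt_eqF// muleC lte_pdivrMr// -EFinM.
have -> : (\int[mu]_(y in `](x - d)%R, (x + d)%R[) `|((center (h x) \o h) y)%:E| =
   \int[mu]_(y in `[(x - d)%R, (x + d)%R]) (`|h y - h x|)%:E)%E.
  rewrite (@integral_itv_bndoo _ _ _ _ true false)//=.
  apply/measurable_EFinP/measurable_funTS/measurableT_comp => //.
  by case: il.
rewrite -EFin_Rintegral// lte_fin => /ltW/le_trans; apply.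
by have -> : e / 2 * (d *+ 2) = e * d by rewrite -mulr_natr; field.
Unshelve. all: by end_near. Qed.

Lemma Rintegral_itv_cst a b c : a <= b -> \int[mu]_(x in `[a, b]) c = c * (b - a).
Proof.
move=> ab; have [_ /(_ a b ab) <-] : primitive (fun x => c * x) (fun=> c).
  apply: C1_primitive; split => x; last exact: cvg_cst.
  by apply: is_derive_eq; rewrite /GRing.scale/= mulr1.
by rewrite mulrBr.
Qed.

(** At a Lebesgue point the value is the limit of the means over shrinking
    intervals, which all vanish. *)
Lemma lebesgue_pt_eq0 h x : locally_integrable [set: R] h ->
  (forall a b, a <= b -> \int[mu]_(x in `[a, b]) h x = 0) ->
  lebesgue_pt h x -> h x = 0.
Proof.
move=> hl h0 hx.
apply/eqP; rewrite -normr_le0; apply/ler_addgt0Pl => e e0; rewrite addr0.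
have [d [d0 hd]] : exists d, 0 < d /\
    \int[mu]_(y in `[x - d, x + d]) `|h y - h x| <= e * d.
  near ((0 : R)^'+) => d; exists d; split; first by near: d; exact: nbhs_right_gt.
  by near: d; exact: lebesgue_pt_near.
have dd : x - d <= x + d by lra.
have cl : locally_integrable [set: R] (cst (h x)).
  by apply: continuous_locint => y; exact: cvg_cst.
have ih := locint_itv (x - d) (x + d) hl.
have ic := locint_itv (x - d) (x + d) cl.
have idf : intble `[x - d, x + d] (fun y => h y - h x).
  exact: (locint_itv _ _ (locally_integrableB hl cl)).
have := @le_normr_Rintegral _ _ _ mu _ _ (measurable_itv _) idf.
rewrite RintegralB// h0// Rintegral_itv_cst// sub0r normrN.
rewrite normrM [`|_ - _|]ger0_norm; last lra.
move=> H; have {hd}H := le_trans H hd.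
suff : `|h x| * d <= e * d by rewrite ler_pM2r.
by apply: le_trans H; rewrite ler_wpM2l//; lra.
Unshelve. all: by end_near. Qed.

Lemma locint_ae0 h : locally_integrable [set: R] h ->
  (forall a b, a <= b -> \int[mu]_(x in `[a, b]) h x = 0) ->
  {ae mu, forall x, h x = 0}.
Proof.
move=> hl h0; apply: ae_imply (lebesgue_differentiation hl) => x.
exact: lebesgue_pt_eq0.
Qed.

Lemma continuous_ae0 h : continuous h -> {ae mu, forall x, h x = 0} -> forall x, h x = 0.
Proof.
move=> ch h0 x; have mh := continuous_measurable_fun ch.
apply: (lebesgue_pt_eq0 (continuous_locint ch)).
  move=> a b ab; rewrite -[RHS](mul0r (b - a)) -Rintegral_itv_cst//.
  rewrite /Rintegral; congr fine; apply: ae_eq_integral => //.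
  - by apply/measurable_EFinP; exact: measurable_funTS.
  - by apply: ae_imply h0 => y -> _.
apply: (@continuous_lebesgue_pt _ _ _ [set: R]) => //.
- by split => //; exact: openT.
- exact: ch.
Qed.

Lemma primitive_unique F f g : primitive F f -> primitive F g ->
  {ae mu, forall x, f x = g x}.
Proof.
move=> [fl Ff] [gl Fg].
have : {ae mu, forall x, f x - g x = 0}.
  apply: (locint_ae0 (locally_integrableB fl gl)) => a b ab.
  by rewrite RintegralB -?Ff -?Fg ?subrr//; exact: locint_itv.
by apply: ae_imply => x /eqP; rewrite subr_eq0 => /eqP.
Qed.

Lemma ae_Rintegral (D : set (measurableTypeR R)) f g : measurable D ->
  measurable_fun [set: R] f -> measurable_fun [set: R] g ->
  {ae mu, forall x, f x = g x} -> \int[mu]_(x in D) f x = \int[mu]_(x in D) g x.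
Proof.
move=> mD mf mg fg; rewrite /Rintegral; congr fine; apply: ae_eq_integral => //.
- by apply/measurable_EFinP; exact: measurable_funTS.
- by apply/measurable_EFinP; exact: measurable_funTS.
- by apply: ae_imply fg => x -> _.
Qed.

Lemma ae_locint f g : locally_integrable [set: R] f -> measurable_fun [set: R] g ->
  {ae mu, forall x, f x = g x} -> locally_integrable [set: R] g.
Proof.
move=> [mf oT fK] mg fg; split => // K KT cK; have := fK K KT cK.
congr (_ < +oo)%E; apply: ae_eq_integral => //.
- exact: compact_measurable.
- by apply/measurable_EFinP/measurable_funTS/measurableT_comp.
- by apply/measurable_EFinP/measurable_funTS/measurableT_comp.
- by apply: ae_imply fg => x -> _.
Qed.

Lemma primitive_ae F f g : primitive F f -> measurable_fun [set: R] g ->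
  {ae mu, forall x, f x = g x} -> primitive F g.
Proof.
move=> [fl Ff] mg fg; split; first exact: ae_locint fg.
move=> a b ab; rewrite Ff//; apply: ae_Rintegral => //; by case: fl.
Qed.

Lemma Rintegral_supp (D : set (measurableTypeR R)) f :
  (forall x, ~ D x -> f x = 0) ->
  \int[mu]_x f x = \int[mu]_(x in D) f x.
Proof.
move=> f0; rewrite [RHS]Rintegral_mkcond; apply: eq_Rintegral => x _.
by rewrite patchE; case: ifPn => // /negP; rewrite inE => /f0.
Qed.

(** A C1 function whose derivative is piecewise linear; the cutoff
    functions below are its second differences. *)
Lemma C1_mulnorm : C1 (fun x : R => x * `|x|) (fun x => 2 * `|x|).
Proof.
split=> x; last first.
  by apply: cvgM; [exact: cvg_cst|exact: norm_continuous].
have [x0|x0|->] := ltgtP x 0.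
- apply: (@near_eq_is_derive R R^o R^o (fun y => - (y * y))).
    near=> y; rewrite ltr0_norm ?mulrN//.
    by near: y; exact: lt_nbhsl.
  apply: is_derive_eq; rewrite /GRing.scale/= ltr0_norm//; ring.
- apply: (@near_eq_is_derive R R^o R^o (fun y => y * y)).
    near=> y; rewrite gtr0_norm//.
    by near: y; exact: lt_nbhsr.
  apply: is_derive_eq; rewrite /GRing.scale/= gtr0_norm//; ring.
- rewrite normr0 mulr0.
  have H : h^-1 *: ((h *: (1 : R) + 0) * `|h *: (1 : R) + 0| - 0 * `|0 : R|) @[h --> (0 : R)^'] --> (0 : R).
    apply: (@cvg_trans _ (`|h| @[h --> (0 : R)^'])).
      apply: near_eq_cvg; near=> h.
      have h0 : h != 0 by near: h; exact: nbhs_dnbhs_neq.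
      by rewrite /GRing.scale/= mul0r subr0 addr0 mulr1 mulrA mulVf// mul1r.
    have := @norm_continuous _ R 0; rewrite /continuous_at normr0.
    exact: cvg_within_filter.
  apply: DeriveDef; first by apply/cvg_ex; exists 0.
  exact/cvg_lim.
Unshelve. all: by end_near. Qed.

(** The triangular bump of mass 2 supported in [a - d, a + d], written as a
    second difference of the absolute value. *)
Definition tent a (d : R) x := (`|x - a + d| - 2 * `|x - a| + `|x - a - d|) / d ^+ 2.

(** The primitive of [tent], going from -1 to 1 across [a - d, a + d]. *)
Definition ramp a (d : R) x := ((x - a + d) * `|x - a + d|
  - 2 * ((x - a) * `|x - a|) + (x - a - d) * `|x - a - d|) / (2 * d ^+ 2).

Lemma C1_ramp a d : 0 < d -> C1 (ramp a d) (tent a d).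
Proof.
move=> d0; have d1 : d != 0 by rewrite gt_eqF.
have H c := C1_shift c C1_mulnorm.
have := C1Z (2 * d ^+ 2)^-1 (C1D (C1D (H (d - a)) (C1Z (- 2) (H (- a)))) (H (- a - d))).
congr C1; apply/funext => x.
  rewrite /ramp.
  have -> : x + (d - a) = x - a + d by ring.
  have -> : x + (- a - d) = x - a - d by ring.
  by rewrite mulrC mulNr.
rewrite /tent.
have -> : x + (d - a) = x - a + d by ring.
have -> : x + (- a - d) = x - a - d by ring.
by field.
Qed.

Lemma ramp_right a d x : 0 < d -> a + d <= x -> ramp a d x = 1.
Proof.
move=> d0 ax; have d1 : d != 0 by rewrite gt_eqF.
by rewrite /ramp !ger0_norm; [field|lra..].
Qed.

Lemma ramp_left a d x : 0 < d -> x <= a - d -> ramp a d x = - 1.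
Proof.
move=> d0 ax; have d1 : d != 0 by rewrite gt_eqF.
by rewrite /ramp !ler0_norm; [field|lra..].
Qed.

Lemma tent_out a d x : 0 < d -> ~ (a - d <= x <= a + d) -> tent a d x = 0.
Proof.
move=> d0 /negP; rewrite negb_and -!ltNge => /orP[ax|ax].
  by rewrite /tent !ler0_norm; [rewrite (_ : _ + _ = 0) ?mul0r//; ring|lra..].
by rewrite /tent !ger0_norm; [rewrite (_ : _ + _ = 0) ?mul0r//; ring|lra..].
Qed.

Lemma tent_bound a d x : 0 < d -> `|tent a d x| <= 2 / d.
Proof.
move=> d0; have d1 : d != 0 by rewrite gt_eqF.
have -> : 2 / d = (2 * d) / d ^+ 2 by field.
rewrite /tent normrM [`|_^-1|]ger0_norm ?invr_ge0 ?sqr_ge0//.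
rewrite ler_pM2r ?invr_gt0 ?exprn_gt0// ler_norml.
have H (z : R) : 0 <= z /\ `|z| = z \/ z <= 0 /\ `|z| = - z.
  by have [z0|/ltW z0] := leP 0 z; [left; rewrite ger0_norm|right; rewrite ler0_norm].
case: (H (x - a + d)) => -[? ->]; case: (H (x - a)) => -[? ->];
  case: (H (x - a - d)) => -[? ->]; apply/andP; split; lra.
Qed.

Lemma tent_mass a d : 0 < d -> \int[mu]_(x in `[a - d, a + d]) tent a d x = 2.
Proof.
move=> d0; have [_ <-] := C1_primitive (C1_ramp a d0); last lra.
by rewrite ramp_right// ramp_left//; lra.
Qed.

Lemma integrable_supp f a b : locally_integrable [set: R] f ->
  (forall x, ~ (a <= x <= b) -> f x = 0) -> intble [set: R] f.
Proof.
move=> fl f0; rewrite (_ : f = f \_ `[a, b]).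
  rewrite -restrict_EFin; apply/integrable_restrict => //; rewrite setTI.
  exact: locint_itv.
apply/funext => x; rewrite patchE mem_setE in_itv/=.
by case: ifPn => // /negP/f0.
Qed.

(** The tents form an approximate identity of mass 2, bounded by 2 / d on an
    interval of length 2 d; this is enough for convergence at every Lebesgue
    point. *)
Lemma lebesgue_pt_tent h a e : locally_integrable [set: R] h -> lebesgue_pt h a ->
  0 < e -> \forall d \near 0^'+, `|\int[mu]_x (h x * tent a d x) - 2 * h a| <= 2 * e.
Proof.
move=> hl ha e0; near=> d.
have d0 : 0 < d by near: d; exact: nbhs_right_gt.
have hd : \int[mu]_(y in `[a - d, a + d]) `|h y - h a| <= e * d.
  by near: d; exact: lebesgue_pt_near.
have ct := (C1_ramp a d0).2.
have tl := continuous_locint ct.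
have htl := locintM_continuous hl ct.
rewrite (@Rintegral_supp `[a - d, a + d]%classic); last first.
  by move=> x /= /tent_out ->//; rewrite mulr0.
rewrite -[X in X * h a](tent_mass a d0) [X in _ - X]mulrC -RintegralZl//; last exact: locint_itv.
rewrite -RintegralB//; [|exact: locint_itv|exact: (locint_itv _ _ (locintZ _ tl))].
have dl : locally_integrable [set: R] (fun x => h x * tent a d x - h a * tent a d x).
  exact: (locally_integrableB htl (locintZ _ tl)).
have hal : locally_integrable [set: R] (fun x => h x - h a).
  by apply: (locally_integrableB hl); apply: continuous_locint => ?; exact: cvg_cst.
have hni : intble `[a - d, a + d] (fun x => `|h x - h a|).
  exact: (integrable_norm (locint_itv _ _ hal)).
apply: le_trans (@le_normr_Rintegral _ _ _ mu _ _ (measurable_itv _) (locint_itv _ _ dl)) _.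
have -> : 2 * e = 2 / d * (e * d) by field; rewrite gt_eqF.
apply: le_trans (_ : 2 / d * \int[mu]_(y in `[a - d, a + d]) `|h y - h a| <= _); last first.
  by rewrite ler_wpM2l// divr_ge0// ltW.
rewrite -RintegralZl//; apply: le_Rintegral => //.
- exact: (integrable_norm (locint_itv _ _ dl)).
- have := @integrableZl _ _ _ mu _ (measurable_itv `[a - d, a + d]) (2 / d) _ hni.
  by [].
- move=> x _; rewrite -mulrBl normrM mulrC ler_wpM2r//; exact: tent_bound.
Unshelve. all: by end_near. Qed.

(** The difference of two ramps centred at [a] and [b] is a test function
    whose derivative is the difference of two tents.  So the averages of [h]
    near any two Lebesgue points agree, and shrinking the tents shows that [h]
    takes the same value at all of them. *)
Lemma weak_derivative0_const h : locally_integrable [set: R] h ->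
  (forall phi, test_function phi -> \int[mu]_x (h x * derive1 phi x) = 0) ->
  exists c, {ae mu, forall x, h x = c}.
Proof.
move=> hl h0.
have tI a d : 0 < d -> intble [set: R] (fun x => h x * tent a d x).
  move=> d0; apply: (@integrable_supp _ (a - d) (a + d)).
    exact: locintM_continuous hl (C1_ramp a d0).2.
  by move=> x /tent_out ->//; rewrite mulr0.
have eqt a b d : 0 < d ->
    \int[mu]_x (h x * tent a d x) = \int[mu]_x (h x * tent b d x).
  move=> d0; have [dr ct] := C1D (C1_ramp a d0) (C1Z (- 1) (C1_ramp b d0)).
  set phi := fun x => _ in dr.
  have dE : derive1 phi = fun x => tent a d x + - 1 * tent b d x.
    by apply/funext => x; rewrite derive1E; have := dr x => ?; rewrite derive_val.
  have tphi : test_function phi.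
    split; [by move=> x; case: (dr x)|by rewrite dE|].
    exists (`|a| + `|b| + d) => x.
    have [x0|x0] := leP 0 x.
      rewrite [`|x|]ger0_norm// => Mx; rewrite /phi !ramp_right//.
      - ring.
      - have := ler_norm b; have := normr_ge0 a; lra.
      - have := ler_norm a; have := normr_ge0 b; lra.
    rewrite [`|x|]ltr0_norm// => Mx; rewrite /phi !ramp_left//.
    - ring.
    - have := ler_norm (- b); have := normr_ge0 a; rewrite normrN; lra.
    - have := ler_norm (- a); have := normr_ge0 b; rewrite normrN; lra.
  have := h0 _ tphi; rewrite dE.
  rewrite (_ : (fun _ => _) = (fun x => h x * tent a d x - h x * tent b d x)); last first.
    by apply/funext => x; ring.
  by rewrite RintegralB ?tI// => /eqP; rewrite subr_eq0 => /eqP.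
have leq a b : lebesgue_pt h a -> lebesgue_pt h b -> h a = h b.
  move=> ha hb; apply/eqP; rewrite -subr_eq0 -normr_le0.
  apply/ler_addgt0Pl => e e0; rewrite addr0.
  have e2 : 0 < e / 2 by rewrite divr_gt0.
  near ((0 : R)^'+) => d.
  have d0 : 0 < d by near: d; exact: nbhs_right_gt.
  have := eqt a b d d0.
  have : `|\int[mu]_x (h x * tent a d x) - 2 * h a| <= 2 * (e / 2).
    by near: d; exact: lebesgue_pt_tent.
  have : `|\int[mu]_x (h x * tent b d x) - 2 * h b| <= 2 * (e / 2).
    by near: d; exact: lebesgue_pt_tent.
  rewrite !ler_norml => /andP[? ?] /andP[? ?] E; apply/andP; split; lra.
have [[x0 hx0]|nh] := pselect (exists x, lebesgue_pt h x).
  exists (h x0); apply: ae_imply (lebesgue_differentiation hl) => x hx; exact: leq.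
exists 0; apply: ae_imply (lebesgue_differentiation hl) => x hx.
by case: nh; exists x.
Unshelve. all: by end_near. Qed.

End Weak.

Section Weak.
Context {R : realType}.
Local Notation mu := (@lebesgue_measure R).
Implicit Types (F G f g h u v : R -> R) (a b c x : R).

Local Notation intble D f := (mu.-integrable D (EFin \o f)).

Definition weak u v := [/\ locally_integrable [set: R] u, locally_integrable [set: R] v &
  forall phi : R -> R, test_function phi ->
    \int[mu]_x (u x * derive1 phi x) = - \int[mu]_x (v x * phi x)].

Lemma test_function_C1 (phi : R -> R) : test_function phi -> C1 phi (derive1 phi).
Proof.
move=> [dp cp _]; split => // x; apply: DeriveDef; first exact: dp.
by rewrite derive1E.
Qed.

Lemma test_function_supp (phi : R -> R) : test_function phi -> exists2 M, 0 <= M &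
  forall x, ~ (- M <= x <= M) -> phi x = 0 /\ derive1 phi x = 0.
Proof.
move=> [dp cp [M0 phi0]]; exists `|M0| => // x /negP xM.
have {}xM : `|M0| < `|x| by rewrite ltNge ler_norml.
have M0x : M0 < `|x| by apply: le_lt_trans xM; exact: ler_norm.
split; first exact: phi0.
rewrite derive1E (@near_eq_derive R R^o R^o phi (cst 0)) ?derive_cst//.
near=> y; apply: phi0; near: y.
exact: (@norm_continuous _ R x) _ (lt_nbhsr M0x).
Unshelve. all: by end_near. Qed.

Lemma primitive_weak F f u : primitive F f -> measurable_fun [set: R] u ->
  {ae mu, forall x, u x = F x} -> weak u f.
Proof.
move=> pF mu_ uF; have [fl Ff] := pF; have cF := primitive_continuous pF.
have Fl := continuous_locint cF.
split => //.
  by apply: (ae_locint Fl) => //; apply: ae_imply uF => x ->.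
move=> phi tphi; have Cphi := test_function_C1 tphi.
have [M M0 supp] := test_function_supp tphi.
have [_ /(_ (- M - 1) (M + 1))] := primitiveM pF (C1_primitive Cphi).
have [-> _] : phi (M + 1) = 0 /\ derive1 phi (M + 1) = 0 by apply: supp => /andP[]; lra.
have [-> _] : phi (- M - 1) = 0 /\ derive1 phi (- M - 1) = 0 by apply: supp => /andP[]; lra.
have out x : ~ `[- M - 1, M + 1]%classic x -> phi x = 0 /\ derive1 phi x = 0.
  by rewrite /= in_itv/= => xM; apply: supp => /andP[? ?]; apply: xM; apply/andP; split; lra.
rewrite !mulr0 subrr => /(_ _)/wrap[]; first lra.
have l1 := locintM_continuous fl (C1_continuous Cphi).
have l2 := locintM_continuous Fl Cphi.2.
rewrite RintegralD//; [|exact: locint_itv..].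
rewrite -(@Rintegral_supp _ `[- M - 1, M + 1]%classic (fun x => f x * phi x)); last first.
  by move=> x /out[-> _]; rewrite mulr0.
rewrite -(@Rintegral_supp _ `[- M - 1, M + 1]%classic (fun x => F x * derive1 phi x)); last first.
  by move=> x /out[_ ->]; rewrite mulr0.
move=> /eqP; rewrite eq_sym addrC addr_eq0 => /eqP <-.
apply: ae_Rintegral => //.
- by apply: measurable_funM => //; exact: continuous_measurable_fun Cphi.2.
- by case: l2.
- by apply: ae_imply uF => x ->.
Qed.

(** Du Bois-Reymond: subtracting a primitive of [v] leaves a function with
    vanishing weak derivative. *)
Lemma weak_primitive u v : weak u v ->
  exists2 F, primitive F v & {ae mu, forall x, u x = F x}.
Proof.
move=> [ul vl uv]; have [V pV _] := primitive_exists 0 vl.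
have cV := primitive_continuous pV; have Vl := continuous_locint cV.
have [_ _ Vv] := primitive_weak pV (continuous_measurable_fun cV) (aeW _ (fun=> erefl)).
have [c hc] : exists c, {ae mu, forall x, u x - V x = c}.
  apply: weak_derivative0_const; first exact: locally_integrableB.
  move=> phi tphi; have Cphi := test_function_C1 tphi.
  have [M M0 supp] := test_function_supp tphi.
  rewrite (_ : (fun x => _) = (fun x => u x * derive1 phi x - V x * derive1 phi x)); last first.
    by apply/funext => x; rewrite mulrBl.
  have iI w : locally_integrable [set: R] w -> intble [set: R] (fun x => w x * derive1 phi x).
    move=> wl; apply: (@integrable_supp _ _ (- M) M).
      exact: locintM_continuous wl Cphi.2.
    by move=> x /supp[_ ->]; rewrite mulr0.
  by rewrite RintegralB ?iI// uv// Vv// subrr.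
exists (fun x => V x + c).
  have := primitiveD pV (primitive_cst c); congr primitive.
  by apply/funext => x; rewrite addr0.
by apply: ae_imply hc => x <-; rewrite subrKC.
Qed.

End Weak.

(** * Integrability on the line *)

Section Line.
Context {R : realType}.
Local Notation mu := (@lebesgue_measure R).
Implicit Types (F G f g h u v : R -> R) (a b c x : R).

Local Notation intble D f := (mu.-integrable D (EFin \o f)).

(** A test function equal to 1 on [- n, n] and to 0 outside [- 3 n, 3 n], with
    slope at most 2 / n. *)
Definition plateau (n : R) x := (ramp (- 2 * n) n x - ramp (2 * n) n x) / 2.

Definition dplateau (n : R) x := (tent (- 2 * n) n x - tent (2 * n) n x) / 2.

Lemma C1_plateau n : 0 < n -> C1 (plateau n) (dplateau n).
Proof.
move=> n0; have := C1Z 2^-1 (C1D (C1_ramp (- 2 * n) n0) (C1Z (- 1) (C1_ramp (2 * n) n0))).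
by congr C1; apply/funext => x; rewrite /plateau /dplateau; field.
Qed.

Lemma plateau1 n x : 0 < n -> `|x| <= n -> plateau n x = 1.
Proof.
move=> n0; rewrite ler_norml => /andP[? ?].
by rewrite /plateau ramp_right ?ramp_left//; [field|lra..].
Qed.

Lemma plateau0 n x : 0 < n -> 3 * n <= `|x| -> plateau n x = 0.
Proof.
move=> n0; have [x0|x0] := leP 0 x.
  rewrite ger0_norm// => nx.
  by rewrite /plateau !ramp_right// ?subrr ?mul0r//; lra.
rewrite ltr0_norm// => nx.
by rewrite /plateau !ramp_left// ?subrr ?mul0r//; lra.
Qed.

Lemma ramp_bound a d x : 0 < d -> `|ramp a d x| <= 1.
Proof.
move=> d0; have d1 : d != 0 by rewrite gt_eqF.
have [xl|xl] := leP x (a - d); first by rewrite ramp_left// normrN normr1.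
have [xr|xr] := leP (a + d) x; first by rewrite ramp_right// normr1.
have -> : ramp a d x = ((x - a + d) ^+ 2 - 2 * ((x - a) * `|x - a|) - (x - a - d) ^+ 2) / (2 * d ^+ 2).
  by rewrite /ramp [`|x - a + d|]ger0_norm ?[`|x - a - d|]ler0_norm; [field|lra..].
rewrite ler_norml ler_pdivlMr ?ler_pdivrMr ?mulr_gt0 ?exprn_gt0//.
have [xa|xa] := leP 0 (x - a).
  by rewrite ger0_norm//; apply/andP; split; nra.
by rewrite ltr0_norm//; apply/andP; split; nra.
Qed.

Lemma plateau_bound n x : 0 < n -> `|plateau n x| <= 1.
Proof.
move=> n0; rewrite /plateau normrM [`|2^-1|]ger0_norm// ler_pdivrMr// mul1r.
by apply: le_trans (ler_normB _ _) _; have := ramp_bound (- 2 * n) x n0; have := ramp_bound (2 * n) x n0; lra.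
Qed.

Lemma dplateau_bound n x : 0 < n -> `|dplateau n x| <= 2 / n.
Proof.
move=> n0; rewrite /dplateau normrM [`|2^-1|]ger0_norm// ler_pdivrMr//.
apply: le_trans (ler_normB _ _) _; have := tent_bound (- 2 * n) x n0; have := tent_bound (2 * n) x n0; lra.
Qed.

Lemma test_plateau n : 0 < n -> test_function (plateau n) /\ derive1 (plateau n) = dplateau n.
Proof.
move=> n0; have [dr ct] := C1_plateau n0.
have dE : derive1 (plateau n) = dplateau n.
  by apply/funext => x; rewrite derive1E; have := dr x => ?; rewrite derive_val.
split => //; split; [by move=> x; case: (dr x)|by rewrite dE|].
by exists (3 * n) => x nx; rewrite plateau0// ltW.
Qed.

(** Boundary terms at infinity vanish as soon as the function and its
    derivative are integrable: testing against a plateau of width n moves the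
    derivative to the plateau, at the price of a factor 2 / n. *)
Lemma Rintegral_primitive0 F f : primitive F f -> intble [set: R] F -> intble [set: R] f ->
  \int[mu]_x f x = 0.
Proof.
move=> pF Fi fi.
have [_ _ Ff] := primitive_weak pF (primitive_measurable pF) (aeW _ (fun=> erefl)).
pose f_ (n : nat) x := f x * plateau n.+1%:R x.
have mf : measurable_fun [set: R] f by case/integrableP : fi => /measurable_EFinP.
have mp n : measurable_fun [set: R] (plateau n.+1%:R).
  by apply: continuous_measurable_fun; exact: C1_continuous (C1_plateau (ltr0Sn R n)).
have mdp n : measurable_fun [set: R] (dplateau n.+1%:R).
  by apply: continuous_measurable_fun; exact: (C1_plateau (ltr0Sn R n)).2.
have fn n : `|\int[mu]_x f_ n x| <= 2 / n.+1%:R * \int[mu]_x `|F x|.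
  have n0 : 0 < n.+1%:R :> R by [].
  have [tp dE] := test_plateau n0.
  have := Ff _ tp; rewrite dE => /eqP; rewrite eq_sym eqr_oppLR => /eqP ->.
  rewrite normrN.
  have Fd : intble [set: R] (fun x => F x * dplateau n.+1%:R x).
    have mFd : measurable_fun [set: R] (fun x => F x * dplateau n.+1%:R x).
      by apply: measurable_funM => //; exact: primitive_measurable pF.
    have gi := @integrableZl _ _ _ mu _ measurableT (2 / n.+1%:R) _ (integrable_norm Fi).
    apply: le_integrable gi => //; first exact/measurable_EFinP.
    move=> x _; rewrite /= lee_fin normrM mulrC [leRHS]ger0_norm ?mulr_ge0//.
    by rewrite ler_wpM2r//; exact: dplateau_bound.
  apply: le_trans (@le_normr_Rintegral _ _ _ mu _ _ measurableT Fd) _.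
  rewrite -RintegralZl//; last exact: integrable_norm.
  apply: le_Rintegral => //; first exact: integrable_norm.
    exact: (@integrableZl _ _ _ mu _ measurableT (2 / n.+1%:R) _ (integrable_norm Fi)).
  by move=> x _; rewrite normrM mulrC ler_wpM2r//; exact: dplateau_bound.
have c1 : \int[mu]_x f_ n x @[n --> \oo] --> 0.
  apply/norm_cvg0P; apply: (@squeeze_cvgr _ _ _ _ (cst 0) (fun n => 2 * (\int[mu]_x `|F x|) * harmonic n)).
  - apply: nearW => n; rewrite normr_ge0/=; apply: le_trans (fn n) _.
    by rewrite le_eqVlt; apply/orP; left; apply/eqP; rewrite /harmonic/=; ring.
  - exact: cvg_cst.
  - rewrite -[X in _ --> X](mulr0 (2 * (\int[mu]_x `|F x|))); apply: cvgM; first exact: cvg_cst.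
    exact: cvg_harmonic.
have mf_ n : measurable_fun setT (EFin \o f_ n).
  by apply/measurable_EFinP; exact: measurable_funM.
have lf : {ae mu, forall x, setT x -> (EFin \o f_ n) x @[n --> \oo] --> (EFin \o f) x}.
  apply: aeW => x _; apply: cvg_near_cst; near=> n.
  rewrite /= /f_ plateau1 ?mulr1//.
  have : `|x| <= n%:R by near: n; exact: nbhs_infty_ger.
  by move=> /le_trans; apply; rewrite ler_nat.
have bf : {ae mu, forall x n, setT x -> (`|(EFin \o f_ n) x| <= `|f x|%:E)%E}.
  apply: aeW => x n _; rewrite lee_fin normrM -[leRHS]mulr1 ler_wpM2l//.
  exact: plateau_bound.
have [_ _ c2] := @dominated_convergence _ _ _ mu setT measurableT (fun n => EFin \o f_ n)
   (EFin \o f) (fun x => `|f x|%:E) mf_ ((measurable_EFinP _ _).2 mf) lf (integrable_norm fi) bf.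
have c3 : \int[mu]_x f_ n x @[n --> \oo] --> \int[mu]_x f x.
  move: c2; rewrite -(EFin_Rintegral measurableT fi) => /fine_cvg; exact.
exact: (cvg_unique _ c3 c1).
Unshelve. all: by end_near. Qed.

Lemma ge0_integral_exhaust (D : set (measurableTypeR R)) f C : measurable D ->
  measurable_fun [set: R] f -> (forall x, 0 <= f x) ->
  (forall n : nat, (\int[mu]_(x in D `&` `[(- n%:R)%R, n%:R%R]) (f x)%:E <= C%:E)%E) ->
  (\int[mu]_(x in D) (f x)%:E <= C%:E)%E.
Proof.
move=> mD mf f0 fC.
have c := @ge0_nondecreasing_set_cvg_integral _ (measurableTypeR R) R
  (fun n : nat => D `&` `[- (n%:R : R), (n%:R : R)]%classic) (EFin \o f) mu.
have U : \bigcup_n (D `&` `[- (n%:R : R), (n%:R : R)]%classic) = D.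
  apply/seteqP; split => [x [n _ [//]]|x Dx].
  exists (Num.Def.truncn `|x|).+1 => //=; split => //=.
  by rewrite in_itv/= -ler_norml ltW// truncnS_gt.
rewrite U in c.
apply: (@cvge_le _ _ _ _ _ _ _ _ (c _ _ _ _)) => //.
- by apply: nearW => n; exact: fC.
- move=> m n mn; rewrite subsetEset => x /= -[Dx]; rewrite !in_itv/= => /andP[? ?].
  have mn' : m%:R <= n%:R :> R by rewrite ler_nat.
  by split => //; apply/andP; split; lra.
- by move=> n; exact: measurableI.
- by move=> n; apply/measurable_EFinP; exact: measurable_funTS.
- by move=> n x _; rewrite lee_fin.
Qed.

Lemma ge0_integrable f C : measurable_fun [set: R] f -> (forall x, 0 <= f x) ->
  (forall n : nat, (\int[mu]_(x in `[(- n%:R)%R, n%:R%R]) (f x)%:E <= C%:E)%E) ->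
  intble [set: R] f.
Proof.
move=> mf f0 fC; apply/integrableP; split; first exact/measurable_EFinP.
under eq_integral do rewrite /= ger0_norm//.
apply: le_lt_trans (ltry C).
by apply: ge0_integral_exhaust => // n; rewrite setTI.
Qed.

(** Integrated form of a differential inequality; [sg] is the sign of the
    derivative in it. *)
Lemma energy_itv F f h (dl sg : R) a b : a <= b -> primitive F f ->
  locally_integrable [set: R] h ->
  (forall x, a <= x <= b -> dl * F x <= sg * f x + h x) ->
  dl * \int[mu]_(x in `[a, b]) F x <= sg * (F b - F a) + \int[mu]_(x in `[a, b]) h x.
Proof.
move=> ab pF hl H; have [fl Ff] := pF.
have Fl := continuous_locint (primitive_continuous pF).
have sfl := locintZ sg fl.
rewrite Ff// -!RintegralZl//; [|exact: locint_itv..].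
rewrite -RintegralD//; [|exact: locint_itv..].
apply: le_Rintegral => //; first exact: (locint_itv a b (locintZ dl Fl)).
exact: (locint_itv a b (locally_integrableD sfl hl)).
Qed.

Lemma Rintegral_itv_le h a b : intble [set: R] h -> (forall x, 0 <= h x) ->
  \int[mu]_(x in `[a, b]) h x <= \int[mu]_x h x.
Proof.
move=> hi h0; rewrite -lee_fin !EFin_Rintegral//; last exact: integrableS hi.
apply: ge0_subset_integral => //.
- by case/integrableP : hi.
- by move=> x _; rewrite lee_fin.
Qed.

Lemma integrable_locint h : intble [set: R] h -> locally_integrable [set: R] h.
Proof. by move=> hi; apply: open_integrable_locally => //; exact: openT. Qed.

(** The differential inequalities bound the integral of [F] over [X, b] and
    [a, - X] by boundary terms and the integral of [h].  The upper bound [B] on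
    the boundary terms has to be known beforehand only for the sign [sg] that
    makes [F] grow away from the origin; for the opposite sign it follows from
    [F] being nonnegative. *)
Lemma energy_integrable F f h (dl sg B X : R) : 0 < dl -> 0 <= X -> primitive F f ->
  (forall x, 0 <= F x) -> (forall x, 0 <= h x) -> intble [set: R] h ->
  (forall x, X <= x -> dl * F x <= sg * f x + h x) ->
  (forall x, x <= - X -> dl * F x <= - sg * f x + h x) ->
  (forall x, X <= x -> sg * (F x - F X) <= B) ->
  (forall x, x <= - X -> sg * (F x - F (- X)) <= B) ->
  intble [set: R] F.
Proof.
move=> dl0 X0 pF F0 h0 hi Hr Hl Br Bl.
have hl := integrable_locint hi.
have Fl := continuous_locint (primitive_continuous pF).
set H := \int[mu]_x h x.
have mF := primitive_measurable pF.
have I0 : 0 <= \int[mu]_(x in `[- X, X]) F x by apply: Rintegral_ge0.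
have right b : X <= b -> \int[mu]_(x in `[X, b]) F x <= (B + H) / dl.
  move=> Xb; rewrite ler_pdivlMr// mulrC.
  apply: le_trans (energy_itv (sg := sg) Xb pF hl _) _.
    by move=> x /andP[? ?]; exact: Hr.
  by apply: lerD; [exact: Br|exact: Rintegral_itv_le].
have left a : a <= - X -> \int[mu]_(x in `[a, - X]) F x <= (B + H) / dl.
  move=> aX; rewrite ler_pdivlMr// mulrC.
  apply: le_trans (energy_itv (sg := - sg) aX pF hl _) _.
    by move=> x /andP[? ?]; exact: Hl.
  by apply: lerD; [rewrite mulNr -mulrN opprB; exact: Bl|exact: Rintegral_itv_le].
pose C := (B + H) / dl + \int[mu]_(x in `[- X, X]) F x + (B + H) / dl.
apply: (@ge0_integrable F C mF F0) => n.
rewrite -EFin_Rintegral//; last exact: locint_itv.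
rewrite lee_fin.
have [P pP _] := primitive_exists 0 Fl.
have [_ PF] := pP.
have Pm a b : a <= b -> P a <= P b.
  by move=> ab; rewrite -subr_ge0 PF//; apply: Rintegral_ge0.
have n0 : 0 <= n%:R :> R by exact: ler0n.
rewrite -PF; last lra.
pose N := Num.max n%:R X.
have nN : n%:R <= N by rewrite le_max lexx.
have XN : X <= N by rewrite le_max lexx orbT.
have := right N XN; have := left (- N); rewrite lerN2 => /(_ XN).
rewrite /C -!PF//; [|lra..].
have := Pm _ _ nN; have := Pm (- N) (- n%:R); rewrite lerN2 => /(_ nN).
lra.
Qed.

Section SquareIntegrable.
Variable w : R -> R.
Hypothesis w_gt0 : forall x, 0 < w x.
Hypothesis mw : measurable_fun [set: R] w.

Definition wsqint f := measurable_fun [set: R] f /\ intble [set: R] (fun x => f x ^+ 2 * w x).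

Definition wsqn f := \int[mu]_x (f x ^+ 2 * w x).

Lemma sqn_ge0 f : 0 <= wsqn f.
Proof. by apply: Rintegral_ge0 => x _; rewrite mulr_ge0 ?sqr_ge0 ?ltW. Qed.

Let sqw_ge0 (f : R -> R) x : 0 <= f x ^+ 2 * w x.
Proof. exact: mulr_ge0 (sqr_ge0 _) (ltW (w_gt0 x)). Qed.

Let intble_le f g : measurable_fun [set: R] f -> intble [set: R] g ->
  (forall x, `|f x| <= g x) -> intble [set: R] f.
Proof.
move=> mf gi fg; apply: le_integrable gi => //; first exact/measurable_EFinP.
by move=> x _ /=; rewrite lee_fin (le_trans (fg x))// ler_norm.
Qed.

Lemma sqint_le f g c : measurable_fun [set: R] f -> wsqint g -> 0 <= c ->
  (forall x, `|f x| <= c * `|g x|) -> wsqint f.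
Proof.
move=> mf [mg gi] c0 fg; split => //.
have mw2 : measurable_fun [set: R] (fun x => f x ^+ 2 * w x).
  by apply: measurable_funM => //; exact: measurable_funX.
apply: (intble_le mw2 (intbleZ (c ^+ 2) gi)).
move=> x; rewrite ger0_norm ?sqw_ge0//.
rewrite mulrA ler_wpM2r ?(ltW (w_gt0 x))// -exprMn -real_normK ?num_real//.
rewrite -[leRHS]real_normK ?num_real// lerXn2r ?nnegrE//.
by rewrite normrM (ger0_norm c0).
Qed.

Lemma sqintD f g : wsqint f -> wsqint g -> wsqint (fun x => f x + g x).
Proof.
move=> [mf fi] [mg gi]; have mfg := measurable_funD mf mg; split => //.
have mw2 : measurable_fun [set: R] (fun x => (f x + g x) ^+ 2 * w x).
  by apply: measurable_funM => //; exact: measurable_funX.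
apply: (intble_le mw2 (intbleD (intbleZ 2 fi) (intbleZ 2 gi))).
move=> x; rewrite ger0_norm ?(sqw_ge0 (fun x => f x + g x))//.
rewrite !mulrA -mulrDl ler_wpM2r ?(ltW (w_gt0 x))//.
have := sqr_ge0 (f x - g x); nra.
Qed.

Lemma sqintM f (g : R -> R) c : (forall x, `|g x| <= c) -> measurable_fun [set: R] g -> wsqint f ->
  wsqint (fun x => g x * f x).
Proof.
move=> gc mg fi; have c0 : 0 <= c by apply: le_trans (gc 0).
have mgf : measurable_fun [set: R] (fun x => g x * f x) by apply: measurable_funM => //; case: fi.
by apply: (sqint_le mgf fi c0) => x; rewrite normrM ler_wpM2r.
Qed.

Lemma sqintZ c f : wsqint f -> wsqint (fun x => c * f x).
Proof. by apply: (@sqintM _ _ `|c|) => //; exact: measurable_cst. Qed.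

Lemma sqintB f g : wsqint f -> wsqint g -> wsqint (fun x => f x - g x).
Proof.
move=> fi gi; have := sqintD fi (sqintZ (-1) gi).
by congr wsqint; apply/funext => x; rewrite mulN1r.
Qed.

Lemma sqint_mul f g : wsqint f -> wsqint g -> intble [set: R] (fun x => f x * g x * w x).
Proof.
move=> [mf fi] [mg gi]; have mw2 : measurable_fun [set: R] (fun x => f x * g x * w x).
  by apply: measurable_funM => //; exact: measurable_funM.
apply: (intble_le mw2 (intbleD fi gi)).
move=> x; rewrite normrM (gtr0_norm (w_gt0 x)) -mulrDl ler_wpM2r ?(ltW (w_gt0 x))//.
have := sqr_ge0 (f x - g x); have := sqr_ge0 (f x + g x).
by rewrite ler_norml => ? ?; apply/andP; split; nra.
Qed.

Lemma ae_sqint f g : wsqint f -> measurable_fun [set: R] g ->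
  {ae mu, forall x, f x = g x} -> wsqint g.
Proof.
move=> [mf fi] mg fg; split => //; have /integrableP[mi ilt] := fi.
have mg2 : measurable_fun [set: R] (fun x => g x ^+ 2 * w x).
  by apply: measurable_funM => //; exact: measurable_funX.
apply/integrableP; split; first exact/measurable_EFinP.
move: ilt; congr (_ < +oo)%E; apply: ae_eq_integral => //.
- exact: measurableT_comp.
- by apply: measurableT_comp => //; exact/measurable_EFinP.
- by apply: ae_imply fg => x /= -> _.
Qed.

Lemma ae_sqn f g : measurable_fun [set: R] f -> measurable_fun [set: R] g ->
  {ae mu, forall x, f x = g x} -> wsqn f = wsqn g.
Proof.
move=> mf mg fg; apply: ae_Rintegral => //.
- by apply: measurable_funM => //; exact: measurable_funX.
- by apply: measurable_funM => //; exact: measurable_funX.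
- by apply: ae_imply fg => x ->.
Qed.

Lemma sqn_eq0 f : wsqint f -> wsqn f = 0 -> {ae mu, forall x, f x = 0}.
Proof.
move=> [mf fi] f0; have /integrableP[mi _] := fi.
have : (\int[mu]_x `|(f x ^+ 2 * w x)%:E| = 0)%E.
  under eq_integral do rewrite abse_EFin ger0_norm ?sqw_ge0//.
  by rewrite -EFin_Rintegral// -/(wsqn f) f0.
move=> /(ae_eq_integral_abs mu measurableT mi).1.
apply: ae_imply => x /(_ I) [] /eqP; rewrite mulf_eq0 (gt_eqF (w_gt0 x)) orbF sqrf_eq0.
by move=> /eqP.
Qed.

End SquareIntegrable.

End Line.

(** * The factored operator in a weighted space *)

Section AbstractOperator.
Context {R : realType}.
Local Notation mu := (@lebesgue_measure R).
Implicit Types (F G f g h u v p dp : R -> R) (a b c x : R).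

Local Notation intble D f := (mu.-integrable D (EFin \o f)).

(* The front enters through [k] only, which is coercive in the sense of
   k^2 - k' and has the sign of - x outside [- X, X].  [B] bounds whatever stays
   bounded while [A] grows. *)
Variables (w eta k dk psi : R -> R) (B s A X : R).
Hypothesis w_gt0 : forall x, 0 < w x.
Hypothesis w_C1 : C1 w (fun x => eta x * w x).
Hypothesis eta_cont : continuous eta.
Hypothesis eta_bound : forall x, `|eta x| <= B.
Hypothesis s_bound : `|s| <= B.
Hypothesis A_gt0 : 0 < A.
Hypothesis A_large : 100 * B <= A.
Hypothesis k_C1 : C1 k dk.
Hypothesis k_bound : forall x, `|k x| <= A.
Hypothesis dk_bound : forall x, `|dk x| <= A ^+ 2.
Hypothesis k_coercive : forall x, A ^+ 2 / 4 <= k x ^+ 2 - dk x.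
Hypothesis psi_gt0 : forall x, 0 < psi x.
Hypothesis psi_C1 : C1 psi (fun x => k x * psi x).
Hypothesis X_ge0 : 0 <= X.
Hypothesis k_right : forall x, X <= x -> k x <= - (A / 4).
Hypothesis k_left : forall x, x <= - X -> A / 4 <= k x.

Let B_ge0 : 0 <= B. Proof. exact: le_trans (normr_ge0 _) s_bound. Qed.

Let mw : measurable_fun [set: R] w. Proof. exact: C1_measurable w_C1. Qed.
Let mk : measurable_fun [set: R] k. Proof. exact: C1_measurable k_C1. Qed.
Let mdk : measurable_fun [set: R] dk. Proof. exact: C1_measurable_deriv k_C1. Qed.
Let meta : measurable_fun [set: R] eta. Proof. exact: continuous_measurable_fun. Qed.

(** The coefficient q of the left factor, and the logarithmic derivative of the
    kernel element [rho] of the adjoint. *)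
Definition dual_rate x := k x + s.

(** Equal to psi'' / psi + s psi' / psi, so that [psi] solves the equation. *)
Definition potential x := dk x + k x ^+ 2 + s * k x.

Let s_bounds : - B <= s <= B. Proof. by rewrite -ler_norml. Qed.
Let eta_bounds x : - B <= eta x <= B. Proof. by rewrite -ler_norml. Qed.
Let k_bounds x : - A <= k x <= A. Proof. by rewrite -ler_norml. Qed.

Lemma dual_rate_bound x : `|dual_rate x| <= 2 * A.
Proof.
have /andP[? ?] := s_bounds; have /andP[? ?] := k_bounds x.
have B0 := B_ge0; have BA := A_large.
by rewrite ler_norml /dual_rate; apply/andP; split; lra.
Qed.

Lemma dual_rate_C1 : C1 dual_rate dk.
Proof.
by apply: C1_eq (C1D k_C1 (C1_cst s)) => x //=; rewrite addr0.
Qed.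

Let mq : measurable_fun [set: R] dual_rate. Proof. exact: C1_measurable dual_rate_C1. Qed.

Local Notation sqint := (wsqint w).
Local Notation sqn := (wsqn w).

(** The integrand of the energy identity at one point, for the values [P] of
    p, [DP] of p', [K] of k, [ETA] of w' / w.  The last three terms of the left
    side are the derivative of k p^2 w divided by w, which integrates to 0.
    After expansion the quadratic form is - DP^2 - (K^2 - DK) P^2 up to terms
    with a factor s or eta, which are small against A, and terms with V, which
    are absorbed by Young's inequality. *)
Lemma energy_pointwise (P DP V K DK ETA : R) :
  `|ETA| <= B -> `|K| <= A -> A ^+ 2 / 4 <= K ^+ 2 - DK ->
  - (DP + (K + s) * P - V) * (DP + (K + ETA) * P) + DK * P ^+ 2 + 2 * K * P * DP + K * ETA * P ^+ 2
   <= - (DP ^+ 2 / 2) - A ^+ 2 / 8 * P ^+ 2 + 17 * V ^+ 2.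
Proof.
have B0 := B_ge0; have BA := A_large; have A0 := A_gt0.
move=> eb kb kc; have := s_bound; move: eb kb; rewrite !ler_norml.
move=> /andP[e1 e2] /andP[k1 k2] /andP[s1 s2].
have -> : - (DP + (K + s) * P - V) * (DP + (K + ETA) * P) + DK * P ^+ 2 + 2 * K * P * DP + K * ETA * P ^+ 2
  = - DP ^+ 2 - (s + ETA) * (P * DP) - (K ^+ 2 - DK) * P ^+ 2 - s * (K + ETA) * P ^+ 2 + V * DP
   + V * ((K + ETA) * P) by ring.
have h1 : - ((s + ETA) * (P * DP)) <= DP ^+ 2 / 4 + (s + ETA) ^+ 2 * P ^+ 2.
  have := sqr_ge0 (DP / 2 + (s + ETA) * P); lra.
have h2 : V * DP <= DP ^+ 2 / 4 + V ^+ 2 by have := sqr_ge0 (DP / 2 - V); lra.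
have h3 : V * ((K + ETA) * P) <= (K + ETA) ^+ 2 / 64 * P ^+ 2 + 16 * V ^+ 2.
  have := sqr_ge0 ((K + ETA) * P / 8 - 4 * V); lra.
have P0 := sqr_ge0 P.
have c1 : (s + ETA) ^+ 2 <= 4 * B ^+ 2 by nra.
have c2 : (K + ETA) ^+ 2 <= 4 * A ^+ 2 by nra.
have c3 : - (2 * A * B) <= s * (K + ETA).
  have : `|s * (K + ETA)| <= B * (2 * A).
    by rewrite normrM ler_pM//; rewrite ler_norml; apply/andP; split; lra.
  by rewrite ler_norml => /andP[]; lra.
have c4 : 4 * B ^+ 2 + 2 * A * B <= A ^+ 2 / 16 by nra.
have := ler_wpM2r P0 c1; have := ler_wpM2r P0 c2; have := ler_wpM2r P0 c3.
have := ler_wpM2r P0 c4; have := ler_wpM2r P0 kc.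
lra.
Qed.

Let sqint_mul f g : sqint f -> sqint g -> intble [set: R] (fun x => f x * g x * w x).
Proof. exact: sqint_mul. Qed.

Let sqint_k f : sqint f -> sqint (fun x => k x * f x).
Proof. by move=> fi; apply: (sqintM _ _ k_bound) => //. Qed.

Let sqint_q f : sqint f -> sqint (fun x => dual_rate x * f x).
Proof. by move=> fi; apply: (sqintM _ _ dual_rate_bound) => //. Qed.

Let sqint_dk f : sqint f -> sqint (fun x => dk x * f x).
Proof. by move=> fi; apply: (sqintM _ _ dk_bound) => //. Qed.

Let sqint_eta f : sqint f -> sqint (fun x => eta x * f x).
Proof. by move=> fi; apply: (sqintM _ _ eta_bound) => //. Qed.

(** The weak form of pairing (D - k) (D + q) p = (D - k) (g + v) with p in
    L^2(w), where v = p' + q p - g.  Only first derivatives occur, so nothing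
    has to be differentiated that is merely square-integrable. *)
Lemma energy p dp g dg : primitive p dp -> primitive g dg ->
  sqint p -> sqint dp -> sqint g -> sqint dg ->
  \int[mu]_x ((dg x - k x * g x) * p x * w x) + sqn dp / 2 + A ^+ 2 / 8 * sqn p
   <= 17 * sqn (fun x => dp x + dual_rate x * p x - g x).
Proof.
move=> pp pg ip idp ig idg.
pose f1 x := (dg x - k x * g x) * p x * w x.
have i1 : intble [set: R] f1 by apply: sqint_mul => //; apply: sqintB => //; exact: sqint_k.
pose f2 x := (dg x * p x + g x * dp x) * w x + g x * p x * (eta x * w x).
have [z2 i2] : \int[mu]_x f2 x = 0 /\ intble [set: R] f2.
  have i2 : intble [set: R] f2.
    apply: intble_eq (intbleD (intbleD (sqint_mul idg ip) (sqint_mul ig idp)) (sqint_mul (sqint_eta ig) ip)).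
    by move=> x; rewrite /f2; ring.
  split => //; apply: Rintegral_primitive0 (primitiveM (primitiveM pg pp) (C1_primitive w_C1)) _ i2.
  exact: sqint_mul.
pose f3 x := dk x * p x ^+ 2 * w x + 2 * (k x * p x * dp x * w x) + k x * p x ^+ 2 * (eta x * w x).
have [z3 i3] : \int[mu]_x f3 x = 0 /\ intble [set: R] f3.
  have i3 : intble [set: R] f3.
    apply: intble_eq (intbleD (intbleD (sqint_mul (sqint_dk ip) ip)
      (intbleZ 2 (sqint_mul (sqint_k ip) idp))) (sqint_mul (sqint_eta (sqint_k ip)) ip)).
    by move=> x; rewrite /f3; ring.
  have p3 : primitive (fun x => k x * p x * p x * w x) f3.
    apply: primitive_eq (primitiveM (primitiveM (primitiveM (C1_primitive k_C1) pp) pp) (C1_primitive w_C1)) => // x.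
    by rewrite /f3; ring.
  split => //; apply: Rintegral_primitive0 p3 _ i3.
  exact: sqint_mul (sqint_k ip) ip.
(* f2 and f3 are the derivatives of g p w and k p^2 w *)
pose v x := dp x + dual_rate x * p x - g x.
have iv : sqint v by apply: sqintB => //; apply: sqintD => //; exact: sqint_q.
have [_ ip2] := ip; have [_ idp2] := idp; have [_ iv2] := iv.
have i5 := intbleD (intbleD i1 (intbleZ 2^-1 idp2)) (intbleZ (A ^+ 2 / 8) ip2).
have i6 := intbleD (intbleD (intbleZ 17 iv2) i2) (intbleZ (-1) i3).
have /(le_Rintegral measurableT i5 i6) : forall x, setT x ->
   f1 x + 2^-1 * (dp x ^+ 2 * w x) + A ^+ 2 / 8 * (p x ^+ 2 * w x) <=
   17 * (v x ^+ 2 * w x) + f2 x + -1 * f3 x.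
  move=> x _.
  have := ler_wpM2r (ltW (w_gt0 x)) (energy_pointwise (p x) (dp x) (v x) (eta_bound x) (k_bound x) (k_coercive x)).
  have -> : dp x + (k x + s) * p x - v x = g x by rewrite /v /dual_rate; ring.
  by rewrite /f1 /f2 /f3; lra.
rewrite (RintegralD measurableT (intbleD i1 (intbleZ 2^-1 idp2)) (intbleZ (A ^+ 2 / 8) ip2)).
rewrite (RintegralD measurableT i1 (intbleZ 2^-1 idp2)).
rewrite (RintegralD measurableT (intbleD (intbleZ 17 iv2) i2) (intbleZ (-1) i3)).
rewrite (RintegralD measurableT (intbleZ 17 iv2) i2).
by rewrite !RintegralZl// z2 z3 /sqn; lra.
Qed.

Lemma sqn3_le f g h : sqint f -> sqint g -> sqint h ->
  sqn (fun x => f x + g x - h x) <= 3 * (sqn f + sqn g + sqn h).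
Proof.
move=> fi gi hi; have [_ fi2] := fi; have [_ gi2] := gi; have [_ hi2] := hi.
have [_ i1] := sqintB w_gt0 mw (sqintD w_gt0 mw fi gi) hi.
have i2 := intbleD (intbleD fi2 gi2) hi2.
rewrite /sqn -!RintegralD//; last exact: intbleD.
rewrite -RintegralZl//; apply: le_Rintegral => //; first exact: intbleZ.
move=> x _; rewrite -!mulrDl mulrA ler_wpM2r ?(ltW (w_gt0 x))//.
have := sqr_ge0 (f x - g x); have := sqr_ge0 (f x + h x); have := sqr_ge0 (g x + h x).
lra.
Qed.

Lemma sqn_le_bound f (c : R -> R) C : (forall x, `|c x| <= C) -> measurable_fun [set: R] c ->
  sqint f -> sqn (fun x => c x * f x) <= C ^+ 2 * sqn f.
Proof.
move=> cC mc fi; have [_ fi2] := fi.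
have [_ i1] := sqintM w_gt0 mw cC mc fi.
rewrite /sqn -RintegralZl//; apply: le_Rintegral => //; first exact: intbleZ.
move=> x _; rewrite mulrA ler_wpM2r ?(ltW (w_gt0 x))// exprMn ler_wpM2r ?sqr_ge0//.
rewrite -real_normK ?num_real// lerXn2r ?nnegrE//.
exact: le_trans (cC x).
Qed.

Definition operator u u1 u2 x := u2 x + s * u1 x - potential x * u x.

Lemma operator_measurable u u1 u2 : measurable_fun [set: R] u ->
  measurable_fun [set: R] u1 -> measurable_fun [set: R] u2 ->
  measurable_fun [set: R] (operator u u1 u2).
Proof.
move=> mu0 mu1 mu2; apply: measurable_funB.
  by apply: measurable_funD => //; exact: measurable_funM.
apply: measurable_funM => //; apply: measurable_funD; last exact: measurable_funM.
by apply: measurable_funD => //; exact: measurable_funX.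
Qed.

Lemma primitive_p u u1 u2 : primitive u u1 -> primitive u1 u2 ->
  primitive (fun x => u1 x - k x * u x) (fun x => u2 x - (dk x * u x + k x * u1 x)).
Proof. by move=> pu pu1; apply: primitiveB => //; apply: primitiveM => //; exact: C1_primitive. Qed.

Lemma factorization u u1 u2 x :
  u2 x - (dk x * u x + k x * u1 x) + dual_rate x * (u1 x - k x * u x) = operator u u1 u2 x.
Proof. by rewrite /operator /potential /dual_rate; ring. Qed.

(** The real form of the resolvent estimate for lam = a + i b; a prime marks
    imaginary parts.  [energy] is used with g = lam u: then (D - k) g = lam p,
    whose pairing with p is Re lam times the squared norm of p, as the
    contributions of b cancel between the two components. *)
Lemma a_priori a b u u1 u2 u' u1' u2' : - (A ^+ 2 / 16) <= a ->
  primitive u u1 -> primitive u1 u2 -> primitive u' u1' -> primitive u1' u2' ->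
  sqint u -> sqint u1 -> sqint u2 -> sqint u' -> sqint u1' -> sqint u2' ->
  let v x := operator u u1 u2 x - (a * u x - b * u' x) in
  let v' x := operator u' u1' u2' x - (a * u' x + b * u x) in
  A ^+ 2 / 16 * (sqn (fun x => u1 x - k x * u x) + sqn (fun x => u1' x - k x * u' x))
    <= 17 * (sqn v + sqn v') /\
  (a ^+ 2 + b ^+ 2) * (sqn u + sqn u') <= 4000 * (sqn v + sqn v').
Proof.
move=> aA pu pu1 pu' pu1' iu iu1 iu2 iu' iu1' iu2' v v'.
set p := fun x => u1 x - k x * u x; set p' := fun x => u1' x - k x * u' x.
pose dp x := u2 x - (dk x * u x + k x * u1 x).
pose dp' x := u2' x - (dk x * u' x + k x * u1' x).
have pp : primitive p dp by exact: primitive_p.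
have pp' : primitive p' dp' by exact: primitive_p.
have ip : sqint p by apply: sqintB => //; exact: sqint_k.
have ip' : sqint p' by apply: sqintB => //; exact: sqint_k.
have idp : sqint dp by apply: sqintB => //; apply: sqintD => //; [exact: sqint_dk|exact: sqint_k].
have idp' : sqint dp' by apply: sqintB => //; apply: sqintD => //; [exact: sqint_dk|exact: sqint_k].
pose g x := a * u x - b * u' x; pose dg x := a * u1 x - b * u1' x.
pose g' x := a * u' x + b * u x; pose dg' x := a * u1' x + b * u1 x.
have ig : sqint g by apply: sqintB => //; exact: sqintZ.
have ig' : sqint g' by apply: sqintD => //; exact: sqintZ.
have idg : sqint dg by apply: sqintB => //; exact: sqintZ.
have idg' : sqint dg' by apply: sqintD => //; exact: sqintZ.
have pg : primitive g dg by apply: primitiveB; exact: primitiveZ.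
have pg' : primitive g' dg' by apply: primitiveD; exact: primitiveZ.
have vE : (fun x => dp x + dual_rate x * p x - g x) = v.
  by apply/funext => x; rewrite /v -factorization.
have vE' : (fun x => dp' x + dual_rate x * p' x - g' x) = v'.
  by apply/funext => x; rewrite /v' -factorization.
have iv : sqint v by rewrite -vE; apply: sqintB => //; apply: sqintD => //; exact: sqint_q.
have iv' : sqint v' by rewrite -vE'; apply: sqintB => //; apply: sqintD => //; exact: sqint_q.
have := energy pp pg ip idp ig idg; rewrite vE.
have := energy pp' pg' ip' idp' ig' idg'; rewrite vE'.
have i1 : intble [set: R] (fun x => (dg x - k x * g x) * p x * w x).
  by apply: sqint_mul => //; apply: sqintB => //; exact: sqint_k.
have i2 : intble [set: R] (fun x => (dg' x - k x * g' x) * p' x * w x).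
  by apply: sqint_mul => //; apply: sqintB => //; exact: sqint_k.
have : \int[mu]_x ((dg x - k x * g x) * p x * w x) + \int[mu]_x ((dg' x - k x * g' x) * p' x * w x)
   = a * (sqn p + sqn p').
  rewrite /sqn -RintegralD// -RintegralD//; [|by case: ip|by case: ip'].
  rewrite -RintegralZl//; last by apply: intbleD; [case: ip|case: ip'].
  by apply: eq_Rintegral => x _; rewrite /dg /g /dg' /g' /p /p'; ring.
have n1 := sqn_ge0 w_gt0 p; have n1' := sqn_ge0 w_gt0 p'.
have n2 := sqn_ge0 w_gt0 dp; have n2' := sqn_ge0 w_gt0 dp'.
have n3 := sqn_ge0 w_gt0 v; have n3' := sqn_ge0 w_gt0 v'.
move=> E e1 e2.
have an : - (A ^+ 2 / 16) * (sqn p + sqn p') <= a * (sqn p + sqn p').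
  by rewrite ler_wpM2r// addr_ge0.
have A20 : 0 < A ^+ 2 by rewrite exprn_gt0.
have c1 : A ^+ 2 / 16 * (sqn p + sqn p') + (sqn dp + sqn dp') / 2 <= 17 * (sqn v + sqn v') by lra.
have An : 0 <= A ^+ 2 / 16 * (sqn p + sqn p') by rewrite mulr_ge0// ?addr_ge0// divr_ge0// ltW.
split; first lra.
have -> : (a ^+ 2 + b ^+ 2) * (sqn u + sqn u') = sqn g + sqn g'.
  have [[_ iu_] [_ iu_']] := (iu, iu').
  have [[_ ig_] [_ ig_']] := (ig, ig').
  rewrite /sqn -RintegralD// -RintegralD// -RintegralZl//; last exact: intbleD.
  by apply: eq_Rintegral => x _; rewrite /g /g'; ring.
have gE : g = fun x => dp x + dual_rate x * p x - v x.
  by apply/funext => x; rewrite -vE; ring.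
have gE' : g' = fun x => dp' x + dual_rate x * p' x - v' x.
  by apply/funext => x; rewrite -vE'; ring.
(* lam u = p' + q p - v, and |q p| <= 2 A |p| is controlled by the bound above *)
have := sqn3_le idp (sqint_q ip) iv; rewrite -gE.
have := sqn3_le idp' (sqint_q ip') iv'; rewrite -gE'.
have := sqn_le_bound dual_rate_bound mq ip; have := sqn_le_bound dual_rate_bound mq ip'.
rewrite exprMn; lra.
Qed.

(** With lam = 0 and v = 0 the estimate says that u' = k u, so u / psi is
    constant. *)
Lemma a_priori_kernel u u1 u2 : primitive u u1 -> primitive u1 u2 ->
  sqint u -> sqint u1 -> sqint u2 -> {ae mu, forall x, operator u u1 u2 x = 0} ->
  exists c, forall x, u x = c * psi x.
Proof.
move=> pu pu1 iu iu1 iu2 Lu.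
have aA : - (A ^+ 2 / 16) <= 0 by rewrite oppr_le0 divr_ge0// sqr_ge0.
have [+ _] := a_priori 0 aA pu pu1 pu pu1 iu iu1 iu2 iu iu1 iu2.
have mop := operator_measurable iu.1 iu1.1 iu2.1.
have sqn0 : sqn (operator u u1 u2) = 0.
  have m0 : measurable_fun [set: R] (fun _ : R => 0 : R) by exact: measurable_cst.
  rewrite (ae_sqn mw mop m0 Lu) /sqn.
  rewrite (_ : (fun x => _) = cst 0) ?Rintegral_cst ?mul0r//.
  by apply/funext => x /=; rewrite expr0n mul0r.
have -> : (fun x => operator u u1 u2 x - (0 * u x - 0 * u x)) = operator u u1 u2.
  by apply/funext => x; ring.
have -> : (fun x => operator u u1 u2 x - (0 * u x + 0 * u x)) = operator u u1 u2.
  by apply/funext => x; ring.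
rewrite sqn0.
set p := fun x => u1 x - k x * u x => le0.
have ip : sqint p by apply: sqintB => //; exact: sqint_k.
have A20 : 0 < A ^+ 2 by rewrite exprn_gt0.
have p0 : sqn p = 0.
  apply/eqP; rewrite eq_le sqn_ge0// andbT.
  suff : A ^+ 2 * sqn p <= A ^+ 2 * 0 by rewrite ler_pM2l.
  lra.
have pae := sqn_eq0 w_gt0 ip p0.
have psi0 x : psi x != 0 by rewrite gt_eqF.
have ipsi := C1V psi0 psi_C1.
have pc : primitive (fun x => u x / psi x) (fun=> 0).
  apply: primitive_ae (primitiveM pu (C1_primitive ipsi)) (measurable_cst _) _.
  apply: ae_imply pae => x; rewrite /p => /eqP; rewrite subr_eq0 => /eqP ->.
  by rewrite /=; field; exact: psi0.
exists (u 0 / psi 0) => x; have [_ H] := pc.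
suff <- : u x / psi x = u 0 / psi 0 by rewrite divfK.
have H0 y z : y <= z -> u y / psi y = u z / psi z.
  move=> yz; apply/eqP; rewrite eq_sym -subr_eq0; apply/eqP; rewrite H//.
  by rewrite Rintegral_itv_cst// mul0r.
by have [x0|/ltW x0] := leP x 0; [rewrite (H0 x 0)|rewrite (H0 0 x)].
Qed.

(** Solves rho' = q rho, hence is annihilated by the adjoint - D + q of the
    left factor. *)
Definition rho x := expR (s * x) * psi x.

Lemma rho_gt0 x : 0 < rho x. Proof. by rewrite mulr_gt0 ?expR_gt0. Qed.

Lemma rho_C1 : C1 rho (fun x => dual_rate x * rho x).
Proof.
have e1 := C1_comp C1_expR (C1_scale s).
by apply: C1_eq (C1M e1 psi_C1) => x //; rewrite /rho /dual_rate; ring.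
Qed.

Let rho_neq0 x : rho x != 0. Proof. by rewrite gt_eqF ?rho_gt0. Qed.

Let w_neq0 x : w x != 0. Proof. by rewrite gt_eqF. Qed.

(** Its integral is the squared norm of the functional v |-> int rho v on
    L^2(w). *)
Definition dens x := rho x ^+ 2 / w x.

Lemma dens_gt0 x : 0 < dens x.
Proof. by rewrite divr_gt0 ?exprn_gt0 ?rho_gt0. Qed.

Lemma dens_C1 : C1 dens (fun x => (2 * dual_rate x - eta x) * dens x).
Proof.
apply: C1_eq (C1M (C1M rho_C1 rho_C1) (C1V w_neq0 w_C1)) => x; first by [].
by rewrite /dens; field.
Qed.

(** psi^2 w has logarithmic derivative 2 k + eta, which is at most - A / 4 on
    the far right and at least A / 4 on the far left. *)
Lemma psi_sqint : sqint psi.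
Proof.
split; first exact: C1_measurable psi_C1.
have F0 x : 0 <= psi x ^+ 2 * w x by rewrite mulr_ge0 ?sqr_ge0// ltW.
have F1 : C1 (fun x => psi x ^+ 2 * w x) (fun x => (2 * k x + eta x) * (psi x ^+ 2 * w x)).
  by apply: C1_eq (C1M (C1M psi_C1 psi_C1) w_C1) => x //=; ring.
have A4 : 0 < A / 4 by rewrite divr_gt0.
apply: (@energy_integrable R _ _ (fun=> 0) (A / 4) (- 1) (psi X ^+ 2 * w X + psi (- X) ^+ 2 * w (- X)) X A4 X_ge0 (C1_primitive F1)).
- exact: F0.
- by [].
- exact: integrable0.
- move=> x Xx; rewrite addr0 mulN1r -mulNr ler_wpM2r//.
  by have := k_right Xx; have /andP[? ?] := eta_bounds x; have := A_large; lra.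
- move=> x Xx; rewrite addr0 opprK mul1r ler_wpM2r//.
  by have := k_left Xx; have /andP[? ?] := eta_bounds x; have := A_large; lra.
- by move=> x _; have := F0 x; have := F0 (- X); lra.
- by move=> x _; have := F0 x; have := F0 X; lra.
Qed.

Lemma psi_kernel : [/\ primitive psi (fun x => k x * psi x),
  primitive (fun x => k x * psi x) (fun x => dk x * psi x + k x * (k x * psi x)),
  sqint (fun x => k x * psi x), sqint (fun x => dk x * psi x + k x * (k x * psi x)) &
  forall x, operator psi (fun x => k x * psi x) (fun x => dk x * psi x + k x * (k x * psi x)) x = 0].
Proof.
have pi := psi_sqint; split.
- exact: C1_primitive.
- by apply: primitiveM; exact: C1_primitive.
- exact: sqint_k.
- by apply: sqintD => //; [exact: sqint_dk|exact/sqint_k/sqint_k].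
- by move=> x; rewrite /operator /potential; ring.
Qed.

Let locint0 : locally_integrable [set: R] (fun=> 0 : R).
Proof. exact/integrable_locint/integrable0. Qed.

(** The logarithmic derivative 2 q - eta of [dens] is at most - A / 4 there, so
    a tail weighs at most 4 / A times the value where it starts. *)
Lemma dens_right x y : X <= x -> x <= y -> (A / 4) * \int[mu]_(t in `[x, y]) dens t <= dens x.
Proof.
move=> Xx xy.
have H t : x <= t <= y -> A / 4 * dens t <= - 1 * ((2 * dual_rate t - eta t) * dens t) + 0.
  move=> /andP[xt _]; rewrite addr0 mulN1r -mulNr ler_wpM2r ?(ltW (dens_gt0 t))//.
  have := k_right (le_trans Xx xt); have /andP[? ?] := s_bounds.
  have /andP[? ?] := eta_bounds t; have := A_large; rewrite /dual_rate; lra.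
have := energy_itv xy (C1_primitive dens_C1) locint0 H.
rewrite Rintegral_itv_cst// mul0r addr0 => /le_trans; apply.
have := dens_gt0 y; lra.
Qed.

Lemma dens_left x y : x <= - X -> y <= x -> (A / 4) * \int[mu]_(t in `[y, x]) dens t <= dens x.
Proof.
move=> Xx xy.
have H t : y <= t <= x -> A / 4 * dens t <= 1 * ((2 * dual_rate t - eta t) * dens t) + 0.
  move=> /andP[_ xt]; rewrite addr0 mul1r ler_wpM2r ?(ltW (dens_gt0 t))//.
  have := k_left (le_trans xt Xx); have /andP[? ?] := s_bounds.
  have /andP[? ?] := eta_bounds t; have := A_large; rewrite /dual_rate; lra.
have := energy_itv xy (C1_primitive dens_C1) locint0 H.
rewrite Rintegral_itv_cst// mul0r addr0 => /le_trans; apply.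
have := dens_gt0 y; lra.
Qed.

Lemma dens_int : intble [set: R] dens.
Proof.
have A4 : 0 < A / 4 by rewrite divr_gt0.
apply: (@energy_integrable R dens _ (fun=> 0) (A / 4) (- 1) (dens X + dens (- X)) X A4 X_ge0 (C1_primitive dens_C1)).
- by move=> x; rewrite ltW ?dens_gt0.
- by [].
- exact: integrable0.
- move=> x Xx; rewrite addr0 mulN1r -mulNr ler_wpM2r ?(ltW (dens_gt0 x))//.
  have := k_right Xx; have /andP[? ?] := s_bounds.
  have /andP[? ?] := eta_bounds x; have := A_large; rewrite /dual_rate; lra.
- move=> x Xx; rewrite addr0 opprK mul1r ler_wpM2r ?(ltW (dens_gt0 x))//.
  have := k_left Xx; have /andP[? ?] := s_bounds.
  have /andP[? ?] := eta_bounds x; have := A_large; rewrite /dual_rate; lra.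
- by move=> x _; have := dens_gt0 x; have := dens_gt0 (- X); lra.
- by move=> x _; have := dens_gt0 x; have := dens_gt0 X; lra.
Qed.

Let mdens : measurable_fun [set: R] dens. Proof. exact: C1_measurable dens_C1. Qed.

Let sub_half (D : set (measurableTypeR R)) (y z C : R) : measurable D -> D `<=` `[y, z]%classic ->
  \int[mu]_(t in `[y, z]) dens t <= C -> (\int[mu]_(t in D) (dens t)%:E <= C%:E)%E.
Proof.
move=> mD DI; rewrite -lee_fin EFin_Rintegral//; last first.
  exact: locint_itv (integrable_locint dens_int).
apply: le_trans; apply: ge0_subset_integral => //.
- by apply/measurable_EFinP/measurable_funTS.
- by move=> t _; rewrite lee_fin ltW ?dens_gt0.
Qed.

Lemma dens_halfright x : X <= x -> \int[mu]_(t in `]x, +oo[) dens t <= 4 / A * dens x.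
Proof.
move=> Xx; rewrite -lee_fin EFin_Rintegral//; last exact: integrableS dens_int.
apply: ge0_integral_exhaust => //; first by move=> t; rewrite ltW ?dens_gt0.
move=> n; pose y := Num.max x n%:R.
apply: (@sub_half _ x y); first exact: measurableI.
  move=> t /= []; rewrite !in_itv/= andbT => /ltW -> /andP[_ tn].
  by rewrite /y le_max tn orbT.
have xy : x <= y by rewrite /y le_max lexx.
rewrite -(ler_pM2l (_ : 0 < A / 4)) ?divr_gt0// (le_trans (dens_right Xx xy))//.
rewrite le_eqVlt; apply/orP; left; apply/eqP; field; exact: lt0r_neq0.
Qed.

Lemma dens_halfleft x : x <= - X -> \int[mu]_(t in `]-oo, x]) dens t <= 4 / A * dens x.
Proof.
move=> Xx; rewrite -lee_fin EFin_Rintegral//; last exact: integrableS dens_int.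
apply: ge0_integral_exhaust => //; first by move=> t; rewrite ltW ?dens_gt0.
move=> n; pose y := Num.min x (- n%:R).
apply: (@sub_half _ y x); first exact: measurableI.
  move=> t /= []; rewrite !in_itv/= => -> /andP[tn _].
  by rewrite /y ge_min tn orbT.
have xy : y <= x by rewrite /y ge_min lexx.
rewrite -(ler_pM2l (_ : 0 < A / 4)) ?divr_gt0// (le_trans (dens_left Xx xy))//.
rewrite le_eqVlt; apply/orP; left; apply/eqP; field; exact: lt0r_neq0.
Qed.

Lemma rho_int v : sqint v -> intble [set: R] (fun x => rho x * v x).
Proof.
move=> iv; have ir : sqint (fun x => rho x / w x).
  split; first exact: C1_measurable (C1M rho_C1 (C1V w_neq0 w_C1)).
  by apply: intble_eq dens_int => x; rewrite /dens; field.
by apply: intble_eq (sqint_mul ir iv) => x; field.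
Qed.

(** Young's inequality for rho v = (rho / sqrt w) (v sqrt w); keeping [tau]
    free replaces an appeal to Cauchy-Schwarz. *)
Lemma young_dual (D : set (measurableTypeR R)) tau v : measurable D -> 0 < tau -> sqint v ->
  `|\int[mu]_(x in D) (rho x * v x)| <= (tau * \int[mu]_(x in D) dens x + sqn v / tau) / 2.
Proof.
move=> mD t0 iv; have [mv iv2] := iv.
have ri := rho_int iv.
have riD : intble D (fun x => rho x * v x) by apply: integrableS ri.
have nriD := integrable_norm riD.
apply: le_trans (@le_normr_Rintegral _ _ _ mu _ _ mD riD) _.
have le : \int[mu]_(x in D) (v x ^+ 2 * w x) <= sqn v.
  rewrite -lee_fin !EFin_Rintegral//; last exact: integrableS iv2.
  apply: ge0_subset_integral => //; first by case/integrableP : iv2.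
  by move=> x _; rewrite lee_fin mulr_ge0 ?sqr_ge0 ?ltW.
have i1 : intble D (fun x => tau / 2 * dens x) by apply: integrableS (intbleZ _ dens_int).
have i2 : intble D (fun x => (2 * tau)^-1 * (v x ^+ 2 * w x)) by apply: integrableS (intbleZ _ iv2).
have i3 : intble D (fun x => tau / 2 * dens x + (2 * tau)^-1 * (v x ^+ 2 * w x)).
  exact: integrableS (intbleD (intbleZ _ dens_int) (intbleZ _ iv2)).
apply: le_trans (le_Rintegral mD nriD i3 _) _.
  move=> x _; rewrite /= normrM (gtr0_norm (rho_gt0 x)).
  have -> : tau / 2 * dens x + (2 * tau)^-1 * (v x ^+ 2 * w x) =
     rho x * `|v x| + ((tau * rho x - w x * `|v x|) ^+ 2) / (2 * tau * w x).
    rewrite -(real_normK (num_real (v x))) /dens; field.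
    by rewrite w_neq0 gt_eqF.
  by rewrite lerDl divr_ge0 ?sqr_ge0// !mulr_ge0// ltW.
rewrite RintegralD// !RintegralZl//; [|exact: integrableS iv2|exact: integrableS dens_int].
have : (2 * tau)^-1 * \int[mu]_(x in D) (v x ^+ 2 * w x) <= (2 * tau)^-1 * sqn v.
  by rewrite ler_wpM2l// invr_ge0 mulr_ge0// ltW.
have -> : (2 * tau)^-1 = (tau^-1) / 2 by field; rewrite gt_eqF.
lra.
Qed.

(** rho (p' + q p) is the derivative of rho p. *)
Lemma range_orthogonal u u1 u2 : primitive u u1 -> primitive u1 u2 ->
  sqint u -> sqint u1 -> sqint u2 -> \int[mu]_x (rho x * operator u u1 u2 x) = 0.
Proof.
move=> pu pu1 iu iu1 iu2.
have ip : sqint (fun x => u1 x - k x * u x) by apply: sqintB => //; exact: sqint_k.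
have idp : sqint (fun x => u2 x - (dk x * u x + k x * u1 x)).
  by apply: sqintB => //; apply: sqintD => //; [exact: sqint_dk|exact: sqint_k].
have iop : sqint (operator u u1 u2).
  have := sqintD w_gt0 mw idp (sqint_q ip).
  by congr (wsqint w); apply/funext => x; rewrite factorization.
have pr := primitiveM (C1_primitive rho_C1) (primitive_p pu pu1).
apply: Rintegral_primitive0 _ (rho_int ip) (rho_int iop).
apply: primitive_eq pr => // x; rewrite -factorization; ring.
Qed.

Let young x y : - (A / 8 * x ^+ 2 + 8 / A * y ^+ 2) <= 2 * x * y <= A / 8 * x ^+ 2 + 8 / A * y ^+ 2.
Proof.
have A0 := A_gt0.
have E : A / 8 * x ^+ 2 + 8 / A * y ^+ 2 - 2 * x * y = (A / 8 * x - y) ^+ 2 / (A / 8).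
  by field; exact: lt0r_neq0.
have E' : A / 8 * x ^+ 2 + 8 / A * y ^+ 2 + 2 * x * y = (A / 8 * x + y) ^+ 2 / (A / 8).
  by field; exact: lt0r_neq0.
have : 0 <= (A / 8 * x - y) ^+ 2 / (A / 8) by rewrite divr_ge0 ?sqr_ge0// divr_ge0// ltW.
have : 0 <= (A / 8 * x + y) ^+ 2 / (A / 8) by rewrite divr_ge0 ?sqr_ge0// divr_ge0// ltW.
by rewrite -E -E' => ? ?; apply/andP; split; lra.
Qed.

(** Since rho' = q rho, the equation p' + q p = v reads (rho p)' = rho v and
    is solved by integrating from - oo; because the total integral vanishes,
    integrating from + oo gives the same function.  Choosing on each side the
    formula with the short tail bounds p^2 w at infinity, because the integral
    of [dens] over that tail is at most 4 / A times its value at x.  As the homogeneous solution 1 / rho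
    grows, this a priori bound is what the energy inequality needs as boundary
    term to make p^2 w integrable. *)
Lemma solve_p v : sqint v -> \int[mu]_x (rho x * v x) = 0 ->
  exists p, primitive p (fun x => v x - dual_rate x * p x) /\ sqint p.
Proof.
move=> iv v0; have [mv iv2] := iv.
have ri := rho_int iv; have rl := integrable_locint ri.
have riD (D : set (measurableTypeR R)) : measurable D -> intble D (fun x => rho x * v x).
  by move=> mD; apply: integrableS ri.
pose P x := \int[mu]_(t in `]-oo, x]) (rho t * v t).
have pP : primitive P (fun x => rho x * v x).
  split => // a b ab; rewrite /P.
  rewrite (@Rintegral_itvB R _ -oo%O (BRight b) a (riD _ _))// ?bnd_simp//.
  by rewrite Rintegral_itv_obnd_cbnd//; exact: riD.
have PE x : P x = - \int[mu]_(t in `]x, +oo[) (rho t * v t).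
  have := @Rintegral_itvB R (fun t => rho t * v t) -oo%O +oo%O x (riD _ _).
  rewrite !bnd_simp => /(_ _ _ _) H.
  rewrite -H// -[X in _ = - (X - _)]/(\int[mu]_(t in `]-oo, +oo[) _) set_itvNyy v0 sub0r opprK.
  by [].
pose p x := P x / rho x.
have ppr : primitive p (fun x => v x - dual_rate x * p x).
  apply: primitive_eq (primitiveM pP (C1_primitive (C1V rho_neq0 rho_C1))) => x //.
  by rewrite /p; field.
exists p; split => //.
pose K := ((4 / A + sqn v) / 2) ^+ 2.
have A0 := A_gt0.
(* For tau = sqrt (w x) / rho x both terms of Young's inequality become
   constants once P x is multiplied by tau to form p x * sqrt (w x). *)
have Pbound x : `|P x| <= (Num.sqrt (w x) / rho x * (4 / A * dens x) + sqn v / (Num.sqrt (w x) / rho x)) / 2 ->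
    p x ^+ 2 * w x <= K.
  move=> H; have r0 := rho_gt0 x.
  have sw0 : 0 < Num.sqrt (w x) by rewrite sqrtr_gt0.
  have t0 : 0 < Num.sqrt (w x) / rho x by rewrite divr_gt0.
  have swE : Num.sqrt (w x) ^+ 2 = w x by rewrite sqr_sqrtr// ltW.
  have -> : p x ^+ 2 * w x = (`|P x| * (Num.sqrt (w x) / rho x)) ^+ 2.
    transitivity (P x ^+ 2 / rho x ^+ 2 * Num.sqrt (w x) ^+ 2).
      by rewrite swE /p; field.
    by rewrite -(real_normK (num_real (P x))); field.
  have nn : 0 <= sqn v by exact: sqn_ge0.
  rewrite /K lerXn2r ?nnegrE//; first by rewrite mulr_ge0// ltW.
    by rewrite divr_ge0// addr_ge0// divr_ge0// ltW.
  apply: le_trans (ler_wpM2r (ltW t0) H) _.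
  rewrite le_eqVlt; apply/orP; left; apply/eqP.
  have -> : dens x = rho x ^+ 2 / Num.sqrt (w x) ^+ 2 by rewrite swE.
  field.
  by rewrite !lt0r_neq0.
have Pr x : X <= x -> p x ^+ 2 * w x <= K.
  move=> Xx; apply: Pbound; rewrite PE normrN.
  have t0 : 0 < Num.sqrt (w x) / rho x by rewrite divr_gt0 ?rho_gt0// sqrtr_gt0.
  apply: le_trans (young_dual (measurable_itv _) t0 iv) _.
  by rewrite ler_pM2r// lerD2r ler_pM2l//; exact: dens_halfright.
have Pl x : x <= - X -> p x ^+ 2 * w x <= K.
  move=> Xx; apply: Pbound; rewrite /P.
  have t0 : 0 < Num.sqrt (w x) / rho x by rewrite divr_gt0 ?rho_gt0// sqrtr_gt0.
  apply: le_trans (young_dual (measurable_itv _) t0 iv) _.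
  by rewrite ler_pM2r// lerD2r ler_pM2l//; exact: dens_halfleft.
split; first exact: primitive_measurable ppr.
clearbody p; have pw0 x : 0 <= p x ^+ 2 * w x by rewrite mulr_ge0 ?sqr_ge0// ltW.
have pw : primitive (fun x => p x ^+ 2 * w x)
   (fun x => (2 * p x * (v x - dual_rate x * p x) + eta x * p x ^+ 2) * w x).
  apply: primitive_eq (primitiveM (primitiveM ppr ppr) (C1_primitive w_C1)) => x //.
  by rewrite /=; ring.
have yng x := young (p x) (v x).
have A8 : 0 < A / 8 by rewrite divr_gt0.
apply: (@energy_integrable R _ _ (fun x => 8 / A * (v x ^+ 2 * w x)) (A / 8) 1 K X A8 X_ge0 pw).
- exact: pw0.
- by move=> x; rewrite mulr_ge0 ?divr_ge0// ?(ltW A0)// mulr_ge0 ?sqr_ge0// ltW.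
- exact: intbleZ.
- move=> x Xx.
  suff H : A / 8 * p x ^+ 2 <= 2 * p x * (v x - dual_rate x * p x) + eta x * p x ^+ 2 + 8 / A * v x ^+ 2.
    by have := ler_wpM2r (ltW (w_gt0 x)) H; lra.
  have /andP[y1 y2] := yng x.
  have : 3 * A / 8 <= - (2 * dual_rate x) + eta x.
    have := k_right Xx; have /andP[? ?] := s_bounds.
    have /andP[? ?] := eta_bounds x; have := A_large; rewrite /dual_rate; lra.
  move=> /(ler_wpM2r (sqr_ge0 (p x))); have := mulr_ge0 (ltW A0) (sqr_ge0 (p x)); lra.
- move=> x Xx.
  suff H : A / 8 * p x ^+ 2 <= - (2 * p x * (v x - dual_rate x * p x) + eta x * p x ^+ 2) + 8 / A * v x ^+ 2.
    by have := ler_wpM2r (ltW (w_gt0 x)) H; lra.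
  have /andP[y1 y2] := yng x.
  have : 3 * A / 8 <= 2 * dual_rate x - eta x.
    have := k_left Xx; have /andP[? ?] := s_bounds.
    have /andP[? ?] := eta_bounds x; have := A_large; rewrite /dual_rate; lra.
  move=> /(ler_wpM2r (sqr_ge0 (p x))); have := mulr_ge0 (ltW A0) (sqr_ge0 (p x)); lra.
- by move=> x /Pr; have := pw0 X; lra.
- by move=> x /Pl; have := pw0 (- X); lra.
Qed.

(** Variation of constants u = psi int_0^x p / psi.  The homogeneous solution
    psi decays in both directions, so the energy inequality bounds u^2 w by
    its values at X and - X. *)
Lemma solve_u p dp : primitive p dp -> sqint p ->
  exists u, primitive u (fun x => k x * u x + p x) /\ sqint u.
Proof.
move=> pp ip; have [mp ip2] := ip.
have psi0 x : psi x != 0 by rewrite gt_eqF.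
have ipsi := C1V psi0 psi_C1.
have cpsi : continuous (fun x => p x * (psi x)^-1).
  move=> x; apply: cvgM; first exact: (primitive_continuous pp).
  exact: (C1_continuous ipsi).
have [Y pY _] := primitive_exists 0 (continuous_locint cpsi).
have [u pu] : exists u, primitive u (fun x => k x * u x + p x).
  exists (fun x => psi x * Y x).
  apply: primitive_eq (primitiveM (C1_primitive psi_C1) pY) => x //.
  by field.
exists u; split => //; split; first exact: primitive_measurable pu.
have uw0 x : 0 <= u x ^+ 2 * w x by rewrite mulr_ge0 ?sqr_ge0// ltW.
have uw : primitive (fun x => u x ^+ 2 * w x)
   (fun x => (2 * u x * (k x * u x + p x) + eta x * u x ^+ 2) * w x).
  apply: primitive_eq (primitiveM (primitiveM pu pu) (C1_primitive w_C1)) => x //.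
  by rewrite /=; ring.
have A0 := A_gt0.
have yng x := young (u x) (p x).
have A8 : 0 < A / 8 by rewrite divr_gt0.
apply: (@energy_integrable R _ _ (fun x => 8 / A * (p x ^+ 2 * w x)) (A / 8) (- 1)
   (u X ^+ 2 * w X + u (- X) ^+ 2 * w (- X)) X A8 X_ge0 uw).
- exact: uw0.
- by move=> x; rewrite mulr_ge0 ?divr_ge0// ?(ltW A0)// mulr_ge0 ?sqr_ge0// ltW.
- exact: intbleZ.
- move=> x Xx.
  suff H : A / 8 * u x ^+ 2 <= - (2 * u x * (k x * u x + p x) + eta x * u x ^+ 2) + 8 / A * p x ^+ 2.
    by have := ler_wpM2r (ltW (w_gt0 x)) H; lra.
  have /andP[y1 y2] := yng x.
  have : 3 * A / 8 <= - (2 * k x) - eta x.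
    have := k_right Xx; have /andP[? ?] := eta_bounds x; have := A_large; lra.
  move=> /(ler_wpM2r (sqr_ge0 (u x))); have := mulr_ge0 (ltW A0) (sqr_ge0 (u x)); lra.
- move=> x Xx.
  suff H : A / 8 * u x ^+ 2 <= 2 * u x * (k x * u x + p x) + eta x * u x ^+ 2 + 8 / A * p x ^+ 2.
    by have := ler_wpM2r (ltW (w_gt0 x)) H; lra.
  have /andP[y1 y2] := yng x.
  have : 3 * A / 8 <= 2 * k x + eta x.
    have := k_left Xx; have /andP[? ?] := eta_bounds x; have := A_large; lra.
  move=> /(ler_wpM2r (sqr_ge0 (u x))); have := mulr_ge0 (ltW A0) (sqr_ge0 (u x)); lra.
- by move=> x _; have := uw0 (- X); have := uw0 x; lra.
- by move=> x _; have := uw0 X; have := uw0 x; lra.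
Qed.

Lemma solve v : sqint v -> \int[mu]_x (rho x * v x) = 0 ->
  exists u u1 u2, [/\ primitive u u1, primitive u1 u2 &
    [/\ sqint u, sqint u1, sqint u2 & forall x, operator u u1 u2 x = v x]].
Proof.
move=> iv v0; have [p [pp ip]] := solve_p iv v0.
have [u [pu iu]] := solve_u pp ip.
pose u1 x := k x * u x + p x.
pose u2 x := (dk x * u x + k x * u1 x) + (v x - dual_rate x * p x).
exists u, u1, u2.
have iu1 : sqint u1 by apply: sqintD => //; exact: sqint_k.
split => //.
  by apply: primitiveD => //; apply: primitiveM => //; exact: C1_primitive.
split => //.
  apply: sqintD => //; first by apply: sqintD => //; [exact: sqint_dk|exact: sqint_k].
  by apply: sqintB => //; exact: sqint_q.
by move=> x; rewrite -factorization /u2 /u1 /=; ring.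
Qed.

End AbstractOperator.

(** * The weight and the front *)

Section Weight.
Context {R : realType}.
Variable beta : R.
Hypothesis beta_gt0 : 0 < beta.
Implicit Types x : R.

Local Notation w := (weight beta).

(** The logarithmic derivative of the weight. *)
Definition wlog x : R := - beta * x / (1 + x ^+ 2).

Definition dwlog x : R := - beta * (1 - x ^+ 2) / (1 + x ^+ 2) ^+ 2.

Let d0 x : 0 < 1 + x ^+ 2. Proof. by rewrite ltr_wpDr ?sqr_ge0. Qed.

Let d_neq0 x : 1 + x ^+ 2 != 0. Proof. by rewrite gt_eqF. Qed.

Let d_C1 : C1 (fun x : R => 1 + x ^+ 2) (fun x => 2 * x).
Proof.
split => x; first by apply: is_derive_eq; rewrite /GRing.scale/=; ring.
by apply: cvgM; [exact: cvg_cst|exact: cvg_id].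
Qed.

Lemma wlog_C1 : C1 wlog dwlog.
Proof.
apply: C1_eq (C1M (C1Z (- beta) C1_id) (C1V d_neq0 d_C1)) => x //=.
by rewrite /dwlog; field.
Qed.

Lemma wlog_bound x : `|wlog x| <= beta.
Proof.
rewrite /wlog normrM [`|_^-1|]ger0_norm ?invr_ge0 ?(ltW (d0 x))// ler_pdivrMr//.
rewrite normrM normrN (gtr0_norm beta_gt0) ler_wpM2l ?(ltW beta_gt0)//.
have := sqr_ge0 (x - 1); have := sqr_ge0 (x + 1).
by rewrite ler_norml => ? ?; apply/andP; split; nra.
Qed.

Lemma dwlog_bound x : `|dwlog x| <= beta.
Proof.
rewrite /dwlog normrM [`|_^-1|]ger0_norm ?invr_ge0 ?sqr_ge0// ler_pdivrMr ?exprn_gt0//.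
rewrite normrM normrN (gtr0_norm beta_gt0) ler_wpM2l ?(ltW beta_gt0)//.
have := sqr_ge0 x.
by rewrite ler_norml => ?; apply/andP; split; nra.
Qed.

Lemma weight_C1 : C1 w (fun x => wlog x * w x).
Proof.
have dw x : is_derive x 1 w (wlog x * w x).
  have wE : w = (@powR R ^~ (- beta / 2)) \o (fun y => 1 + y ^+ 2).
    by apply/funext => y; rewrite /weight /= real_normK ?num_real.
  have H1 := is_derive1_powR (- beta / 2) (d0 x); have H2 := d_C1.1 x.
  have := @is_derive1_comp _ (@powR R ^~ (- beta / 2)) (fun y => 1 + y ^+ 2) x _ _ H1 H2.
  rewrite -wE; congr is_derive; rewrite wE /= /wlog.
  rewrite powRB; last by rewrite d_neq0 implybT.
  by rewrite powRr1 ?ltW//; field.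
split => // x; apply: cvgM; first exact: C1_continuous wlog_C1 x.
exact: is_derive_continuous dw x.
Qed.

Lemma sqrt_weight_C1 : C1 (fun x => Num.sqrt (w x)) (fun x => wlog x / 2 * Num.sqrt (w x)).
Proof.
have [dw _] := weight_C1; have cw := C1_continuous weight_C1; split => x.
  have w0 := weight_gt0 beta x.
  apply: is_derive_eq.
    by apply: (is_derive1_comp (is_derive1_sqrt w0)); exact: dw.
  have s0 : Num.sqrt (w x) != 0 by rewrite gt_eqF// sqrtr_gt0.
  rewrite -{2}(sqr_sqrtr (ltW w0)); field.
  exact: s0.
apply: cvgM; first by apply: cvgM; [exact: (C1_continuous wlog_C1)|exact: cvg_cst].
apply: (@continuous_comp _ _ _ w Num.sqrt); first exact: cw.
exact: sqrt_continuous.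
Qed.

End Weight.

Section Huxley.
Context {R : realType}.
Implicit Types x : R.
Local Notation r2 := (Num.sqrt 2 : R).

Let r2_gt0 : 0 < r2. Proof. by rewrite sqrtr_gt0. Qed.
Let r2_neq0 : r2 != 0. Proof. by rewrite gt_eqF. Qed.
Let r2E : r2 ^+ 2 = 2. Proof. by rewrite sqr_sqrtr. Qed.

Let e_gt0 x : 0 < 1 + expR (- x / r2). Proof. by rewrite ltr_wpDr ?expR_ge0. Qed.
Let e_neq0 x : 1 + expR (- x / r2) != 0. Proof. by rewrite gt_eqF. Qed.

Lemma huxley_gt0 x : 0 < huxley x. Proof. by rewrite invr_gt0. Qed.

Lemma huxley_lt1 x : huxley x < 1.
Proof. by rewrite /huxley invf_lt1// ltrDl expR_gt0. Qed.

Lemma huxley_C1 : C1 (@huxley R) (fun x => huxley x * (1 - huxley x) / r2).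
Proof.
have e1 : C1 (fun x => 1 + expR (- x / r2)) (fun x => - expR (- x / r2) / r2).
  apply: C1_eq (C1D (C1_cst 1) (C1_comp C1_expR (C1_scale (- r2^-1)))) => x.
    by rewrite mulNr mulrC -mulNr.
  by rewrite add0r mulrN mulNr [_ * x]mulrC mulNr mulNr.
apply: C1_eq (C1V e_neq0 e1) => x //.
rewrite /huxley; field.
by rewrite r2_neq0 e_neq0.
Qed.

Lemma huxley_right x : 3 <= x -> 3 / 4 <= huxley x.
Proof.
move=> x3; rewrite /huxley -[3 / 4]invrK lef_pV2 ?posrE// invf_div.
have : 3 <= expR (x / r2).
  apply: le_trans (expR_ge1Dx _).
  have : 2 <= x / r2; last lra.
  rewrite ler_pdivlMr//; have := r2E; have := r2_gt0; nra.
move=> H; rewrite mulNr expRN -lerBrDl.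
have -> : 4 / 3 - 1 = 3^-1 :> R by field.
by rewrite lef_pV2 ?posrE ?expR_gt0.
Qed.

Lemma huxley_left x : x <= - 3 -> huxley x <= 1 / 4.
Proof.
move=> x3; rewrite /huxley -[1 / 4]invrK lef_pV2 ?posrE// invf_div divr1.
have : 3 <= expR (- x / r2); last lra.
apply: le_trans (expR_ge1Dx _).
have : 2 <= - x / r2; last lra.
rewrite ler_pdivlMr//; have := r2E; have := r2_gt0; nra.
Qed.

Variable A : R.
Hypothesis A_gt0 : 0 < A.

Definition front x := huxley (A * x).
Definition front_bump x := front x * (1 - front x).
(** The logarithmic derivative of [front_bump]. *)
Definition front_rate x := A * (1 - 2 * front x) / r2.
Definition dfront_rate x := - A ^+ 2 * front_bump x.

Lemma front_C1 : C1 front (fun x => A / r2 * front_bump x).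
Proof.
apply: C1_eq (C1_comp huxley_C1 (C1_scale A)) => x //.
by rewrite /front_bump /front; ring.
Qed.

Lemma front_rate_C1 : C1 front_rate dfront_rate.
Proof.
apply: C1_eq (C1Z (A / r2) (C1D (C1_cst 1) (C1Z (- 2) front_C1))) => x.
  by rewrite /front_rate; field.
transitivity (- 2 * A ^+ 2 * front_bump x / r2 ^+ 2); first by field.
by rewrite r2E /dfront_rate; field.
Qed.

Lemma front_bump_gt0 x : 0 < front_bump x.
Proof. by rewrite mulr_gt0 ?huxley_gt0// subr_gt0 huxley_lt1. Qed.

Lemma front_bump_le x : front_bump x <= 1 / 4.
Proof. by rewrite /front_bump; have := sqr_ge0 (1 / 2 - front x); lra. Qed.

Lemma front_bump_C1 : C1 front_bump (fun x => front_rate x * front_bump x).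
Proof.
apply: C1_eq (C1M front_C1 (C1D (C1_cst 1) (C1Z (- 1) front_C1))) => x.
  by rewrite /front_bump; ring.
by rewrite /front_rate /front_bump; field.
Qed.

Lemma front_rate_sqr x : front_rate x ^+ 2 = A ^+ 2 * (1 / 2 - 2 * front_bump x).
Proof. by rewrite /front_rate expr_div_n r2E /front_bump; field. Qed.

Lemma front_rate_bound x : `|front_rate x| <= A.
Proof.
have A0 := ltW A_gt0.
rewrite -(ger0_norm A0) -ler_sqr ?nnegrE// !real_normK ?num_real// front_rate_sqr.
rewrite -[leRHS]mulr1 ler_wpM2l ?sqr_ge0//.
have := front_bump_gt0 x; lra.
Qed.

Lemma dfront_rate_bound x : `|dfront_rate x| <= A ^+ 2.
Proof.
rewrite /dfront_rate normrM normrN (ger0_norm (sqr_ge0 A)) -[leRHS]mulr1.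
rewrite ler_wpM2l ?sqr_ge0// ger0_norm ?ltW ?front_bump_gt0//.
have := front_bump_le x; lra.
Qed.

(** k^2 - k' = A^2 (1/2 - phi (1 - phi)), and phi (1 - phi) <= 1/4. *)
Lemma front_rate_coercive x : A ^+ 2 / 4 <= front_rate x ^+ 2 - dfront_rate x.
Proof.
rewrite front_rate_sqr /dfront_rate; have := ler_wpM2l (sqr_ge0 A) (front_bump_le x).
lra.
Qed.

Lemma front_rate_right x : 3 / A <= x -> front_rate x <= - (A / 4).
Proof.
rewrite ler_pdivrMr// mulrC => /huxley_right; rewrite -/(front x) => h.
rewrite /front_rate ler_pdivrMr//.
have : r2 <= 2 by have := r2E; have := r2_gt0; nra.
have := A_gt0; nra.
Qed.

Lemma front_rate_left x : x <= - (3 / A) -> A / 4 <= front_rate x.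
Proof.
rewrite lerNr ler_pdivrMr// mulNr lerNr mulrC => /huxley_left; rewrite -/(front x) => h.
rewrite /front_rate ler_pdivlMr//.
have : r2 <= 2 by have := r2E; have := r2_gt0; nra.
have := A_gt0; nra.
Qed.

End Huxley.

(** * The roots of the cubic *)

Section Wave.
Context {R : realType}.
Implicit Types (alpha e x : R).

(** Dividing differences of the values at the roots by the differences of the
    roots gives Vieta's relations. *)
Lemma cubic_vieta alpha e (zm z0 zp : R) : zm < z0 -> z0 < zp ->
  reaction alpha e zm = 0 -> reaction alpha e z0 = 0 -> reaction alpha e zp = 0 ->
  1 + alpha = zm + z0 + zp /\ 3 * e ^- 2 - alpha = - (zm * z0 + zm * zp + z0 * zp).
Proof.
rewrite /reaction; set E := e ^- 2 => h1 h2 rm r0 rp.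
have d1 : z0 - zm != 0 by rewrite subr_eq0 gt_eqF.
have d2 : zp - z0 != 0 by rewrite subr_eq0 gt_eqF.
have d3 : zp - zm != 0 by rewrite subr_eq0 gt_eqF// (lt_trans h1).
have q1 : - (z0 ^+ 2 + z0 * zm + zm ^+ 2) + (1 + alpha) * (z0 + zm) + (3 * E - alpha) = 0.
  apply: (mulfI d1); rewrite mulr0; move: rm r0.
  set L := (X in X = 0) => Lm; set L0 := (X in X = 0) => L00.
  by have -> : 0 = L0 - L; [rewrite Lm L00 subrr|rewrite /L0 /L; ring].
have q2 : - (zp ^+ 2 + zp * z0 + z0 ^+ 2) + (1 + alpha) * (zp + z0) + (3 * E - alpha) = 0.
  apply: (mulfI d2); rewrite mulr0; move: rp r0.
  set L := (X in X = 0) => Lm; set L0 := (X in X = 0) => L00.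
  by have -> : 0 = L - L0; [rewrite Lm L00 subrr|rewrite /L0 /L; ring].
have q3 : 1 + alpha = zm + z0 + zp.
  apply: (mulfI d3); lra.
by split => //; rewrite q3 in q1; lra.
Qed.

Lemma derive1_reaction alpha e x : derive1 (reaction alpha e) x =
  - 3 * x ^+ 2 + 2 * (1 + alpha) * x + (3 * e ^- 2 - alpha).
Proof.
rewrite derive1E; apply: derive_val.
have -> : reaction alpha e = fun u => - u ^+ 3 + (1 + alpha) * u ^+ 2
   + (3 * e ^- 2 - alpha) * u - (1 + alpha) * e ^- 2 by [].
by apply: is_derive_eq; rewrite /GRing.scale/=; ring.
Qed.

Lemma wave_speedE (zm z0 zp : R) : zm < zp ->
  wave_speed zm z0 zp = Num.sqrt 2 * (z0 - (zm + zp) / 2).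
Proof.
move=> h; have d : zp - zm != 0 by rewrite subr_eq0 gt_eqF.
by rewrite /wave_speed; field.
Qed.

(** The zeroth-order coefficient of the linearization is the potential for which
    the derivative of the wave is in the kernel.  Vieta's relations express it
    by the roots; then both sides are polynomials in the front. *)
Lemma reaction_along_wave alpha e (zm z0 zp : R) x : zm < z0 -> z0 < zp ->
  reaction alpha e zm = 0 -> reaction alpha e z0 = 0 -> reaction alpha e zp = 0 ->
  derive1 (reaction alpha e) (wave zm zp x) =
  - potential (front_rate (zp - zm)) (dfront_rate (zp - zm)) (wave_speed zm z0 zp) x.
Proof.
move=> h1 h2 rm r0 rp; have [q1 q2] := cubic_vieta h1 h2 rm r0 rp.
rewrite derive1_reaction q1 q2 wave_speedE ?(lt_trans h1)//.
have r2 : Num.sqrt 2 != 0 :> R by rewrite gt_eqF// sqrtr_gt0.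
rewrite /potential front_rate_sqr /wave -/(front (zp - zm) x).
have -> : Num.sqrt 2 * (z0 - (zm + zp) / 2) * front_rate (zp - zm) x =
  (z0 - (zm + zp) / 2) * (zp - zm) * (1 - 2 * front (zp - zm) x).
  by rewrite /front_rate; field.
by rewrite /dfront_rate /front_bump; field.
Qed.

Lemma reaction_real alpha e x : reaction alpha%:C e%:C x%:C = (reaction alpha e x)%:C.
Proof.
by rewrite /reaction !(rmorphB, rmorphD, rmorphM, rmorphN, rmorphXn, rmorph1, fmorphV, rmorph_nat)/=.
Qed.

Lemma bigO_at0_real (f g : R[i] -> R[i]) : bigO_at0 f g ->
  exists K d : R, [/\ 0 < K, 0 < d & forall e, 0 < e < d -> normc (f e%:C) <= K * normc (g e%:C)].
Proof.
move=> /eqO_exP[K K0 /= fg].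
have Kr : K = (complex.Re K)%:C.
  by move: K0; rewrite ltcE => /andP[/eqP /=]; case: (K) => a b /= -> _.
have {}K0 : 0 < complex.Re K by move: K0; rewrite ltcE => /andP[].
case: fg => d /= d0 fg.
have dr : d = (complex.Re d)%:C.
  by move: d0; rewrite ltcE => /andP[/eqP /=]; case: (d) => a b /= -> _.
have {}d0 : 0 < complex.Re d by move: d0; rewrite ltcE => /andP[].
exists (complex.Re K), (complex.Re d); split => // e /andP[e0 ed].
have ec : 0 <= e%:C by rewrite lecR ltW.
have : `|f e%:C| <= K * `|g e%:C|.
  apply: fg; last by apply/eqP => /complexI ez; rewrite ez ltxx in e0.
  by rewrite /= sub0r normrN ger0_norm// dr ltcR.
by rewrite Kr -lecR rmorphM.
Qed.

Lemma normc_re (z : R[i]) : `|complex.Re z| <= normc z.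
Proof. by case: z => a b; rewrite /= -sqrtr_sqr ler_wsqrtr// lerDl sqr_ge0. Qed.

Lemma normc_real (x : R) : normc x%:C = `|x|.
Proof. by rewrite /= expr0n addr0 sqrtr_sqr. Qed.

(** A = 2 sqrt 3 / eps + O(eps), and in z0 - (zm + zp) / 2 the terms of order
    1 / eps and the constants (1 + alpha) / 3 cancel, so the speed tends to 0. *)
Lemma wave_asymptotics alpha (eps0 B : R) (zm z0 zp : R[i] -> R[i]) : 0 < eps0 -> 0 < B ->
  bigO_at0 (fun e : R[i] => z0 e - ((1 + alpha) / 3)%:C) (fun e : R[i] => e ^+ 2) ->
  bigO_at0 (fun e : R[i] => zp e - ((Num.sqrt 3)%:C * e^-1 + ((1 + alpha) / 3)%:C)) (fun e : R[i] => e) ->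
  bigO_at0 (fun e : R[i] => zm e - (- (Num.sqrt 3)%:C * e^-1 + ((1 + alpha) / 3)%:C)) (fun e : R[i] => e) ->
  exists eps1 : R, 0 < eps1 <= eps0 /\ forall e, 0 < e < eps1 ->
    [/\ e^-1 <= complex.Re (zp e%:C) - complex.Re (zm e%:C),
        B <= complex.Re (zp e%:C) - complex.Re (zm e%:C) &
        `|Num.sqrt 2 * (complex.Re (z0 e%:C) - (complex.Re (zm e%:C) + complex.Re (zp e%:C)) / 2)| <= 1].
Proof.
move=> eps00 B0 /bigO_at0_real[K [d [K0 d0 H0]]] /bigO_at0_real[Kp [dp [Kp0 dp0 Hp]]].
move=> /bigO_at0_real[Km [dm [Km0 dm0 Hm]]].
pose L := K + Kp + Km + 1.
have L0 : 1 <= L by rewrite /L; lra.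
(* The second minimum makes every O-term at most 1/2 and 1 / eps at least B. *)
pose eps1 := Num.min (Num.min eps0 (Num.min d (Num.min dp dm))) (Num.min (2 * L)^-1 B^-1).
exists eps1; split.
  have L1 : 0 < 2 * L by lra.
  apply/andP; split; last by rewrite /eps1 !ge_min lexx.
  by rewrite /eps1 !lt_min eps00 d0 dp0 dm0 !invr_gt0 B0 L1.
move=> e /andP[e0]; rewrite /eps1 !lt_min => /andP[/andP[ee0 /andP[ed /andP[edp edm]]] /andP[eL eB]].
have {}H0 := H0 e (introT andP (conj e0 ed)).
have {}Hp := Hp e (introT andP (conj e0 edp)).
have {}Hm := Hm e (introT andP (conj e0 edm)).
have He : normc e%:C = e by rewrite normc_real gtr0_norm.
have He2 : normc (e%:C ^+ 2) = e ^+ 2 by rewrite !expr2 normcM He.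
rewrite He2 in H0; rewrite He in Hp Hm.
have ReB (z : R[i]) (x : R) : complex.Re (z - x%:C) = complex.Re z - x by case: z.
have Ep : (Num.sqrt 3)%:C * (e%:C)^-1 + ((1 + alpha) / 3)%:C =
    (Num.sqrt 3 * e^-1 + (1 + alpha) / 3)%:C by rewrite [RHS]rmorphD [X in _ = X + _]rmorphM fmorphV.
have Em : - (Num.sqrt 3)%:C * (e%:C)^-1 + ((1 + alpha) / 3)%:C =
    (- Num.sqrt 3 * e^-1 + (1 + alpha) / 3)%:C by rewrite [RHS]rmorphD [X in _ = X + _]rmorphM rmorphN fmorphV.
rewrite Ep in Hp; rewrite Em in Hm.
have := le_trans (normc_re _) H0; have := le_trans (normc_re _) Hp; have := le_trans (normc_re _) Hm.
rewrite !ReB.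
set a := complex.Re (zm _); set b := complex.Re (zp _); set c := complex.Re (z0 _).
set r3 := Num.sqrt 3; set m := (1 + alpha) / 3.
move=> /ler_normlP[m1 m2] /ler_normlP[p1 p2] /ler_normlP[c1 c2].
have r3_1 : 1 <= r3 by rewrite -[leLHS]sqrtr1 ler_wsqrtr// ler1n.
have Le : L * e <= 1 / 2.
  have : e * (2 * L) < 1 by rewrite -ltr_pdivlMr ?mulr_gt0//; lra.
  lra.
have e1 : e <= 1 / 2.
  have : e * 1 <= e * L by rewrite ler_wpM2l// ltW.
  lra.
have ie : 2 <= e^-1.
  by rewrite -[2]invrK lef_pV2 ?posrE//; lra.
have Ke : (Kp + Km) * e <= 1 / 2.
  have : (Kp + Km) * e <= L * e by rewrite ler_wpM2r ?(ltW e0)// /L; lra.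
  lra.
have ri : e^-1 <= r3 * e^-1 by rewrite ler_peMl// invr_ge0 ltW.
have ab : e^-1 <= b - a by lra.
split => //.
  by apply: le_trans ab; rewrite -[leLHS]invrK lef_pV2 ?posrE ?invr_gt0// ltW.
have Ke2 : K * e ^+ 2 <= K * e / 2.
  have : K * e * e <= K * e * (1 / 2) by rewrite ler_wpM2l// mulr_ge0 ?ltW.
  lra.
have Ke3 : (K + Kp + Km) * e <= 1 / 2 - e by rewrite /L in Le; lra.
have Kpe : 0 <= Kp * e by rewrite mulr_ge0 ?ltW.
have Kme : 0 <= Km * e by rewrite mulr_ge0 ?ltW.
have Kce : 0 <= K * e by rewrite mulr_ge0 ?ltW.
have r2_2 : Num.sqrt 2 <= 2 :> R.
  have : Num.sqrt 2 ^+ 2 = 2 :> R by rewrite sqr_sqrtr.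
  have := sqrtr_ge0 (2 : R); nra.
have r2_0 : 0 <= Num.sqrt 2 :> R by exact: sqrtr_ge0.
rewrite normrM (ger0_norm r2_0).
have h : `|c - (a + b) / 2| <= 1 / 2 by rewrite ler_norml; apply/andP; split; lra.
have := ler_pM r2_0 (normr_ge0 _) r2_2 h; lra.
Qed.

End Wave.

(** * Complex functions through their components *)

Section Split.
Context {R : realType}.
Local Notation mu := (@lebesgue_measure R).
Local Notation C := R[i].
Local Notation intble D f := (mu.-integrable D (EFin \o f)).
Implicit Types (u v : R -> C) (x : R).

Lemma primitive_ae_eq (F f G g : R -> R) : primitive F f -> primitive G g ->
  {ae mu, forall x, F x = G x} -> F =1 G.
Proof.
move=> pF pG FG x; apply/eqP; rewrite -subr_eq0; apply/eqP.
apply: (@continuous_ae0 _ (fun x => F x - G x)).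
  by move=> y; apply: cvgB; [exact: primitive_continuous pF y|exact: primitive_continuous pG y].
by apply: ae_imply FG => y ->; rewrite subrr.
Qed.

Lemma re_scale (a : R) (z : C) : Re (a%:C * z) = a * Re z.
Proof. by case: z => b c /=; rewrite mul0r subr0. Qed.

Lemma im_scale (a : R) (z : C) : Im (a%:C * z) = a * Im z.
Proof. by case: z => b c /=; rewrite mul0r addr0. Qed.

Lemma re_add (y z : C) : Re (y + z) = Re y + Re z. Proof. by case: y; case: z. Qed.
Lemma im_add (y z : C) : Im (y + z) = Im y + Im z. Proof. by case: y; case: z. Qed.
Lemma re_mul (y z : C) : Re (y * z) = Re y * Re z - Im y * Im z.
Proof. by case: y; case: z. Qed.
Lemma im_mul (y z : C) : Im (y * z) = Re y * Im z + Im y * Re z.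
Proof. by case: y; case: z. Qed.

Lemma normc_sqr (z : C) : normc z ^+ 2 = Re z ^+ 2 + Im z ^+ 2.
Proof. by case: z => a b /=; rewrite sqr_sqrtr// addr_ge0 ?sqr_ge0. Qed.

Section Weighted.
Variable w : R -> R.
Hypothesis w_gt0 : forall x, 0 < w x.
Hypothesis mw : measurable_fun [set: R] w.

Lemma sqintegrable_split u : sqintegrable w u <->
  wsqint w (fun x => Re (u x)) /\ wsqint w (fun x => Im (u x)).
Proof.
split.
  move=> [[mr mi] fin].
  have mn : measurable_fun [set: R] (fun x => normc (u x) ^+ 2 * w x).
    by apply: measurable_funM => //; apply: measurable_funX; exact: cmeasurable_normc.
  have ni : intble [set: R] (fun x => normc (u x) ^+ 2 * w x).
    apply/integrableP; split; first exact/measurable_EFinP.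
    have nn x : 0 <= normc (u x) ^+ 2 * w x by rewrite mulr_ge0 ?sqr_ge0 ?(ltW (w_gt0 x)).
    by under eq_integral do rewrite /= ger0_norm//.
  have dom (f : R -> R) : measurable_fun [set: R] f ->
      (forall x, f x ^+ 2 <= normc (u x) ^+ 2) -> wsqint w f.
    move=> mf fu; split => //; apply: le_integrable ni => //.
      by apply/measurable_EFinP; apply: measurable_funM => //; exact: measurable_funX.
    move=> x _ /=; rewrite lee_fin !ger0_norm ?(mulr_ge0 (sqr_ge0 _) (ltW (w_gt0 _)))//.
    by rewrite ler_wpM2r ?(ltW (w_gt0 x)).
  by split; apply: dom => // x; rewrite normc_sqr ?lerDl ?lerDr sqr_ge0.
move=> [[mr ir] [mi ii]]; split; first by split.
have := @integrableD _ _ _ mu _ measurableT _ _ ir ii.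
move=> /integrableP[_]; apply: le_lt_trans; rewrite /sqnorm.
rewrite le_eqVlt; apply/orP; left; apply/eqP; apply: eq_integral => x _ /=.
by rewrite -mulrDl -normc_sqr ger0_norm// mulr_ge0 ?sqr_ge0 ?(ltW (w_gt0 _)).
Qed.

Lemma L2norm_split u : sqintegrable w u ->
  L2norm w u ^+ 2 = wsqn w (fun x => Re (u x)) + wsqn w (fun x => Im (u x)).
Proof.
move=> iu; have [[_ ir] [_ ii]] := (sqintegrable_split u).1 iu.
rewrite /L2norm sqr_sqrtr; last first.
  by apply: fine_ge0; apply: sqnorm_ge0.
rewrite /wsqn -RintegralD// /sqnorm /Rintegral; congr fine.
by apply: eq_integral => x _; rewrite -mulrDl -normc_sqr.
Qed.

End Weighted.

Lemma weak_derivative_split u v : weak_derivative u v <->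
  weak (fun x => Re (u x)) (fun x => Re (v x)) /\ weak (fun x => Im (u x)) (fun x => Im (v x)).
Proof.
split.
  move=> [[ur ui] [vr vi] uv].
  by split; split => // phi tphi; have [] := uv _ tphi.
move=> [[ur vr uvr] [ui vi uvi]]; split => // phi tphi.
by split; [exact: uvr|exact: uvi].
Qed.

End Split.

Section Component.
Context {R : realType}.
Local Notation mu := (@lebesgue_measure R).
Variables (beta : R) (k dk : R -> R) (A s : R).
Hypothesis beta_gt0 : 0 < beta.
Hypothesis k_C1 : C1 k dk.
Hypothesis k_bound : forall x, `|k x| <= A.
Hypothesis dk_bound : forall x, `|dk x| <= A ^+ 2.

Local Notation w := (weight beta).
Local Notation sw := (fun x => Num.sqrt (weight beta x)).
Local Notation eta := (@wlog R beta).
Local Notation sqint := (wsqint w).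
Local Notation op := (operator k dk s).

Let w_gt0 x : 0 < w x. Proof. exact: weight_gt0. Qed.
Let mw : measurable_fun [set: R] w. Proof. exact: measurable_weight. Qed.
Let sw_gt0 x : 0 < sw x. Proof. by rewrite /= sqrtr_gt0. Qed.
Let swE x : sw x ^+ 2 = w x. Proof. by rewrite sqr_sqrtr// ltW. Qed.
Let sw_C1 : C1 sw (fun x => eta x / 2 * sw x). Proof. exact: sqrt_weight_C1. Qed.
Let msw : measurable_fun [set: R] sw. Proof. exact: C1_measurable sw_C1. Qed.

(** The isometry between L^2(w) and L^2, one component at a time. *)
Lemma sqint_sw (f : R -> R) : sqint f <-> wsqint (cst 1) (fun x => sw x * f x).
Proof.
have E : (fun x => (sw x * f x) ^+ 2 * cst 1 x) = (fun x => f x ^+ 2 * w x).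
  by apply/funext => x; rewrite mulr1 exprMn swE mulrC.
rewrite /wsqint E; split => -[mf fi]; split => //; first exact: measurable_funM.
rewrite (_ : f = fun x => (sw x)^-1 * (sw x * f x)); last first.
  by apply/funext => x; rewrite mulKf// gt_eqF.
apply: measurable_funM => //; apply: C1_measurable (C1V _ sw_C1) => x.
by rewrite gt_eqF.
Qed.

Let eta_half_sqint f : sqint f -> sqint (fun x => eta x / 2 * f x).
Proof.
move=> fi; apply: (@sqintM _ w w_gt0 mw _ _ beta) => //.
  move=> x; rewrite normrM [`|2^-1|]ger0_norm// ler_pdivrMr//.
  have := wlog_bound beta_gt0 x; have := beta_gt0; lra.
apply: measurable_funM => //; exact: C1_measurable (wlog_C1 beta).
Qed.

Let Z_C1 : C1 (fun x => eta x / 2) (fun x => dwlog beta x / 2).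
Proof. by apply: C1_eq (C1Z 2^-1 (wlog_C1 beta)) => x /=; rewrite mulrC. Qed.

Let potential_sqint f : sqint f -> sqint (fun x => potential k dk s x * f x).
Proof.
move=> fi; apply: (@sqintM _ w w_gt0 mw _ _ (A ^+ 2 + A ^+ 2 + `|s| * A)) => //.
  move=> x; rewrite /potential .
  apply: le_trans (ler_normD _ _) _; apply: lerD; last by rewrite normrM ler_wpM2l.
  apply: le_trans (ler_normD _ _) _; apply: lerD; first exact: dk_bound.
  rewrite normrX lerXn2r// ?nnegrE//.
  exact: le_trans (k_bound x).
have mk := C1_measurable k_C1; have mdk := C1_measurable_deriv k_C1.
apply: measurable_funD; last exact: measurable_funM.
by apply: measurable_funD => //; exact: measurable_funX.
Qed.

(** The third and fourth hypotheses on [f], about sqrt w f and its weak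
    derivative, are what membership in the domain provides.  They make u' an
    element of L^2(w), because (sqrt w u)' = sqrt w (eta u / 2 + u'), and then
    u'' is one by the equation. *)
Lemma component_elim (f f1 f2 y1 g : R -> R) :
  weak f f1 -> weak f1 f2 -> sqint f -> weak (fun x => sw x * f x) y1 ->
  wsqint (cst 1) y1 -> sqint g ->
  {ae mu, forall x, g x = f2 x + s * f1 x - potential k dk s x * f x} ->
  exists U U1 U2, [/\ primitive U U1, primitive U1 U2,
    [/\ sqint U, sqint U1 & sqint U2],
    {ae mu, forall x, f x = U x} & {ae mu, forall x, g x = op U U1 U2 x}].
Proof.
move=> wf wf1 fi wy y1i gi gE.
have [U pU fU] := weak_primitive wf.
have [U1 pU1 fU1] := weak_primitive wf1.
have pUU1 : primitive U U1 by apply: primitive_ae pU (primitive_measurable pU1) fU1.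
have iU : sqint U by apply: ae_sqint fi (primitive_measurable pU) fU.
have [Y pY fY] := weak_primitive wy.
have pS := primitiveM (C1_primitive sw_C1) pUU1.
have SY : (fun x => sw x * U x) =1 Y.
  apply: primitive_ae_eq pS pY _.
  by apply: ae_imply2 fU fY => x -> ->.
have ae1 := primitive_unique pY (primitive_eq SY (frefl _) pS).
have mU1 := primitive_measurable pU1.
have mS1 : measurable_fun [set: R] (fun x => eta x / 2 * sw x * U x + sw x * U1 x).
  exact: primitive_measurable_deriv pS.
have iZ : sqint (fun x => eta x / 2 * U x + U1 x).
  apply/sqint_sw.
  apply: (@ae_sqint _ (cst 1) _ y1) => //.
    by have := mS1; congr measurable_fun; apply/funext => x /=; ring.
  by apply: ae_imply ae1 => x ->; ring.
have iU1 : sqint U1.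
  have := sqintB w_gt0 mw iZ (eta_half_sqint iU).
  by congr wsqint; apply/funext => x; ring.
have m2 := primitive_measurable_deriv pU1.
have aeE : {ae mu, forall x, g x = op U U1 f2 x}.
  by apply: ae_imply2 fU (ae_imply2 (fun x a b => conj a b) fU1 gE) => x h [h1 ->]; rewrite /operator h h1.
exists U, U1, f2; split => //; split => //.
have iR : sqint (fun x => g x - s * U1 x + potential k dk s x * U x).
  apply: sqintD => //; last exact: potential_sqint.
  by apply: sqintB => //; exact: sqintZ.
apply: (ae_sqint mw iR m2).
by apply: ae_imply aeE => x ->; rewrite /operator; ring.
Qed.

(** Conversely, sqrt w u has the derivative sqrt w (eta u / 2 + u'), and the
    same computation applies once more; eta and its derivative are bounded. *)
Lemma component_intro (f U U1 U2 : R -> R) : measurable_fun [set: R] f ->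
  primitive U U1 -> primitive U1 U2 -> sqint U -> sqint U1 -> sqint U2 ->
  {ae mu, forall x, f x = U x} ->
  weak f U1 /\ weak U1 U2 /\
  exists y1 y2, [/\ wsqint (cst 1) (fun x => sw x * f x), wsqint (cst 1) y1,
     wsqint (cst 1) y2, weak (fun x => sw x * f x) y1 & weak y1 y2].
Proof.
move=> mf pU pU1 iU iU1 iU2 fU.
split; first exact: primitive_weak pU mf fU.
split; first exact: primitive_weak pU1 (primitive_measurable pU1) (aeW _ (fun=> erefl)).
pose Z x := eta x / 2 * U x + U1 x.
pose dZ x := dwlog beta x / 2 * U x + eta x / 2 * U1 x + U2 x.
have pZ : primitive Z dZ by apply: primitiveD => //; apply: primitiveM => //; exact: C1_primitive.
have iZ : sqint Z by apply: sqintD => //; exact: eta_half_sqint.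
have idZ : sqint dZ.
  apply: sqintD => //; apply: sqintD => //; last exact: eta_half_sqint.
  apply: (@sqintM _ w w_gt0 mw _ _ beta) => //.
    move=> x; rewrite normrM [`|2^-1|]ger0_norm// ler_pdivrMr//.
    have := dwlog_bound beta_gt0 x; have := beta_gt0; lra.
  apply: measurable_funM => //; exact: C1_measurable_deriv (wlog_C1 beta).
exists (fun x => sw x * Z x), (fun x => sw x * (eta x / 2 * Z x + dZ x)); split.
- apply/sqint_sw; apply: (@ae_sqint _ w mw U) => //.
  by apply: ae_imply fU => x ->.
- exact/sqint_sw.
- by apply/sqint_sw; apply: sqintD => //; exact: eta_half_sqint.
- have p1 : primitive (fun x => sw x * U x) (fun x => sw x * Z x).
    apply: primitive_eq (primitiveM (C1_primitive sw_C1) pU) => x //.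
    by rewrite /Z; ring.
  apply: primitive_weak p1 _ _; first exact: measurable_funM.
  by apply: ae_imply fU => x ->.
- have p2 : primitive (fun x => sw x * Z x) (fun x => sw x * (eta x / 2 * Z x + dZ x)).
    apply: primitive_eq (primitiveM (C1_primitive sw_C1) pZ) => x //.
    by ring.
  exact: primitive_weak p2 (primitive_measurable p2) (aeW _ (fun=> erefl)).
Qed.

End Component.

(** * The spectrum near the origin *)

Section Lines.
Context {R : realType}.
Local Notation mu := (@lebesgue_measure R).
Local Notation C := R[i].
Local Notation intble D f := (mu.-integrable D (EFin \o f)).

Lemma Rintegral_gt0 (f : R -> R) : continuous f -> (forall x, 0 < f x) ->
  intble [set: R] f -> 0 < \int[mu]_x f x.
Proof.
move=> cf f0 fi; rewrite lt_neqAle Rintegral_ge0 ?andbT; last by move=> x _; exact: ltW.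
apply/eqP => E; have /integrableP[mi _] := fi.
have : (\int[mu]_x `|(f x)%:E| = 0)%E.
  under eq_integral do rewrite abse_EFin (gtr0_norm (f0 _)).
  by rewrite -EFin_Rintegral// -E.
move=> /(ae_eq_integral_abs mu measurableT mi).1 H.
have : {ae mu, forall x, f x = 0} by apply: ae_imply H => x /(_ I) [].
move=> /(continuous_ae0 cf)/(_ 0) f00; by have := f0 0; rewrite f00 ltxx.
Qed.

Section Representatives.
Variable beta : R.
Local Notation w := (weight beta).
Implicit Types u v : L2w beta.

Lemma L2w_sqint u : wsqint w (fun x => Re (u x)) /\ wsqint w (fun x => Im (u x)).
Proof.
apply/sqintegrable_split; [exact: weight_gt0|exact: measurable_weight|].
exact: L2preP (repr u).
Qed.

Lemma L2w_exists (f g : R -> R) : wsqint w f -> wsqint w g ->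
  exists u, {ae mu, forall x, u x = f x +i* g x}.
Proof.
move=> fi gi.
have H : sqintegrable w (fun x => f x +i* g x).
  by apply/sqintegrable_split; [exact: weight_gt0|exact: measurable_weight|].
have H' : (fun x => f x +i* g x) \in @L2pre_pred R beta by apply/asboolP.
exists (L2class (MkL2pre H')).
exact: (L2w_piE (MkL2pre H')).
Qed.

Lemma L2w_subE u v : {ae mu, forall x, L2w_fun (u - v) x = u x - v x}.
Proof.
rewrite -[- v]scaleN1r; apply: ae_imply2 (L2w_addE u (-1 *: v)) (L2w_scaleE (-1) v) => x -> ->.
by rewrite mulN1r.
Qed.

Lemma L2w_0E : {ae mu, forall x, (0 : L2w beta) x = 0}.
Proof. by apply: ae_imply (L2w_subE 0 0) => x; rewrite subrr => ->; rewrite subrr. Qed.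

Lemma L2norm_L2w u :
  L2norm w u ^+ 2 = wsqn w (fun x => Re (u x)) + wsqn w (fun x => Im (u x)).
Proof.
apply: L2norm_split; [exact: weight_gt0|exact: measurable_weight|].
exact: L2preP (repr u).
Qed.

Lemma L2norm_ge0 u : 0 <= L2norm w u. Proof. exact: sqrtr_ge0. Qed.

Lemma L2w_normE u : `|u| = (L2norm w u)%:C. Proof. by []. Qed.

End Representatives.

Section Spectrum.
Variables (alpha beta e zm z0 zp : R).
Hypothesis beta_gt0 : 0 < beta.
Hypothesis zm_z0 : zm < z0.
Hypothesis z0_zp : z0 < zp.
Hypothesis zm_root : reaction alpha e zm = 0.
Hypothesis z0_root : reaction alpha e z0 = 0.
Hypothesis zp_root : reaction alpha e zp = 0.
Let A := zp - zm.
Let s := wave_speed zm z0 zp.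
Let B := beta + 1.
Hypothesis s_le1 : `|s| <= 1.
Hypothesis A_large : 100 * B <= A.

Local Notation L := (linearization (beta := beta) alpha e zm z0 zp).
Local Notation w := (weight beta).
Local Notation k := (front_rate A).
Local Notation dk := (dfront_rate A).
Local Notation psi := (front_bump A).
Local Notation sqint := (wsqint w).
Local Notation sqn := (wsqn w).
Local Notation op := (operator k dk s).
Local Notation rho := (rho psi s).
Implicit Types u v : L2w beta.

Let A_gt0 : 0 < A. Proof. by rewrite subr_gt0 (lt_trans zm_z0). Qed.
Let w_gt0 x : 0 < w x. Proof. exact: weight_gt0. Qed.
Let mw : measurable_fun [set: R] w. Proof. exact: measurable_weight. Qed.
Let w_C1 : C1 w (fun x => wlog beta x * w x). Proof. exact: weight_C1. Qed.
Let eta_cont : continuous (wlog beta). Proof. exact: C1_continuous (wlog_C1 beta). Qed.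
Let eta_bound x : `|wlog beta x| <= B.
Proof. by apply: le_trans (wlog_bound beta_gt0 x) _; rewrite /B lerDl. Qed.
Let s_bound : `|s| <= B. Proof. by apply: le_trans s_le1 _; rewrite /B lerDr ltW. Qed.
Let k_C1 : C1 k dk. Proof. exact: front_rate_C1. Qed.
Let k_bound x : `|k x| <= A. Proof. exact: front_rate_bound. Qed.
Let dk_bound x : `|dk x| <= A ^+ 2. Proof. exact: dfront_rate_bound. Qed.
Let k_coercive x : A ^+ 2 / 4 <= k x ^+ 2 - dk x. Proof. exact: front_rate_coercive. Qed.
Let psi_gt0 x : 0 < psi x. Proof. exact: front_bump_gt0. Qed.
Let psi_C1 : C1 psi (fun x => k x * psi x). Proof. exact: front_bump_C1. Qed.
(* Beyond this distance the front is within 1/4 of its limits. *)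
Let X := 3 / A.
Let X_ge0 : 0 <= X. Proof. by rewrite divr_ge0// ltW. Qed.
Let k_right x : X <= x -> k x <= - (A / 4). Proof. exact: front_rate_right. Qed.
Let k_left x : x <= - X -> A / 4 <= k x. Proof. exact: front_rate_left. Qed.

Let mop (F F1 F2 : R -> R) : sqint F -> sqint F1 -> sqint F2 ->
  measurable_fun [set: R] (op F F1 F2).
Proof. by move=> [mF _] [mF1 _] [mF2 _]; have := operator_measurable s k_C1 mF mF1 mF2; exact. Qed.

Let reactionE x : derive1 (reaction alpha e) (wave zm zp x) = - potential k dk s x.
Proof. exact: reaction_along_wave. Qed.

(** The linearization in terms of real absolutely continuous functions; it acts
    on real and imaginary parts separately since its coefficients are real. *)
Lemma lin_elim u v : L u v -> exists U U1 U2 V V1 V2,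
  [/\ [/\ primitive U U1, primitive U1 U2, primitive V V1 & primitive V1 V2],
   [/\ sqint U, sqint U1 & sqint U2], [/\ sqint V, sqint V1 & sqint V2],
   {ae mu, forall x, u x = U x +i* V x} &
   {ae mu, forall x, v x = op U U1 U2 x +i* op V V1 V2 x}].
Proof.
move=> [[y1 [y2 [_ iy1 _ wy _]]] [u1 [u2 [wu wu1 vE]]]].
have [iur iui] := L2w_sqint u; have [ivr ivi] := L2w_sqint v.
have [wur wui] := (weak_derivative_split _ _).1 wu.
have [wur1 wui1] := (weak_derivative_split _ _).1 wu1.
have [wyr wyi] := (weak_derivative_split _ _).1 wy.
have [iyr iyi] : wsqint (cst 1) (fun x => Re (y1 x)) /\ wsqint (cst 1) (fun x => Im (y1 x)).
  by apply/(sqintegrable_split (fun=> ltr01)) => //; exact: measurable_cst.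
have vrE : {ae mu, forall x, Re (v x) = Re (u2 x) + s * Re (u1 x) - potential k dk s x * Re (u x)}.
  apply: ae_imply vE => x ->; rewrite !re_add !re_scale reactionE -/s; ring.
have viE : {ae mu, forall x, Im (v x) = Im (u2 x) + s * Im (u1 x) - potential k dk s x * Im (u x)}.
  apply: ae_imply vE => x ->; rewrite !im_add !im_scale reactionE -/s; ring.
have wyr' : weak (fun x => Num.sqrt (w x) * Re (u x)) (fun x => Re (y1 x)).
  by move: wyr; congr weak; apply/funext => x; rewrite /L2w_T re_scale.
have wyi' : weak (fun x => Num.sqrt (w x) * Im (u x)) (fun x => Im (y1 x)).
  by move: wyi; congr weak; apply/funext => x; rewrite /L2w_T im_scale.
have [U [U1 [U2 [pU pU1 iU uU vU]]]] :=
  component_elim beta_gt0 k_C1 k_bound dk_bound wur wur1 iur wyr' iyr ivr vrE.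
have [V [V1 [V2 [pV pV1 iV uV vV]]]] :=
  component_elim beta_gt0 k_C1 k_bound dk_bound wui wui1 iui wyi' iyi ivi viE.
exists U, U1, U2, V, V1, V2; split => //.
- by apply: ae_imply2 uU uV => x; case: (u x) => a b /= -> ->.
- by apply: ae_imply2 vU vV => x; case: (v x) => a b /= -> ->.
Qed.

Lemma lin_intro u v (U U1 U2 V V1 V2 : R -> R) :
  primitive U U1 -> primitive U1 U2 -> primitive V V1 -> primitive V1 V2 ->
  sqint U -> sqint U1 -> sqint U2 -> sqint V -> sqint V1 -> sqint V2 ->
  {ae mu, forall x, u x = U x +i* V x} ->
  {ae mu, forall x, v x = op U U1 U2 x +i* op V V1 V2 x} -> L u v.
Proof.
move=> pU pU1 pV pV1 iU iU1 iU2 iV iV1 iV2 uE vE.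
have [[mr _] [mi _]] := L2w_sqint u.
have [wU [wU1 [y1 [y2 [i0 i1 i2 wy wy1]]]]] := component_intro beta_gt0 mr pU pU1 iU iU1 iU2
  (ae_imply (fun x (h : u x = U x +i* V x) => congr1 (@complex.Re R) h) uE).
have [wV [wV1 [z1 [z2 [j0 j1 j2 wz wz1]]]]] := component_intro beta_gt0 mi pV pV1 iV iV1 iV2
  (ae_imply (fun x (h : u x = U x +i* V x) => congr1 (@complex.Im R) h) uE).
have L2I (f : R -> C) : wsqint (cst 1) (fun x => Re (f x)) ->
    wsqint (cst 1) (fun x => Im (f x)) -> in_L2 f.
  by move=> fr fi; apply/(sqintegrable_split (fun=> ltr01)) => //; exact: measurable_cst.
split.
  exists (fun x => y1 x +i* z1 x), (fun x => y2 x +i* z2 x); split.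
  - apply: L2I.
      by move: i0; congr wsqint; apply/funext => x; rewrite /L2w_T re_scale.
    by move: j0; congr wsqint; apply/funext => x; rewrite /L2w_T im_scale.
  - exact: L2I.
  - exact: L2I.
  - apply/weak_derivative_split; split.
      by move: wy; congr weak; apply/funext => x; rewrite /L2w_T re_scale.
    by move: wz; congr weak; apply/funext => x; rewrite /L2w_T im_scale.
  - exact/weak_derivative_split.
exists (fun x => U1 x +i* V1 x), (fun x => U2 x +i* V2 x); split.
- exact/weak_derivative_split.
- exact/weak_derivative_split.
- apply: ae_imply2 uE vE => x -> ->; rewrite reactionE /operator -/s.
  by apply/eqP; rewrite eq_complex /=; apply/andP; split; apply/eqP; ring.
Qed.

Lemma linB u v u' v' : L u v -> L u' v' -> L (u - u') (v - v').
Proof.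
move=> /lin_elim[U [U1 [U2 [V [V1 [V2 [[pU pU1 pV pV1] [iU iU1 iU2] [iV iV1 iV2] uE vE]]]]]]].
move=> /lin_elim[U' [U1' [U2' [V' [V1' [V2' [[pU' pU1' pV' pV1'] [iU' iU1' iU2'] [iV' iV1' iV2'] uE' vE']]]]]]].
apply: (lin_intro (primitiveB pU pU') (primitiveB pU1 pU1') (primitiveB pV pV') (primitiveB pV1 pV1')); try exact: sqintB.
- apply: ae_imply2 (ae_imply2 (fun x a b => conj a b) uE uE') (L2w_subE u u') => x [-> ->] ->.
  by [].
- apply: ae_imply2 (ae_imply2 (fun x a b => conj a b) vE vE') (L2w_subE v v') => x [-> ->] ->.
  by apply/eqP; rewrite eq_complex /= /operator; apply/andP; split; apply/eqP; ring.
Qed.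

Lemma resolvent_estimate (lam : C) u v : - (A ^+ 2 / 16) <= Re lam -> L u (v + lam *: u) ->
  normc lam ^+ 2 * L2norm w u ^+ 2 <= 4000 * L2norm w v ^+ 2.
Proof.
move=> hl /lin_elim[U [U1 [U2 [V [V1 [V2 [[pU pU1 pV pV1] [iU iU1 iU2] [iV iV1 iV2] uE vE]]]]]]].
have [_] := a_priori w_gt0 w_C1 eta_cont eta_bound s_bound A_gt0 A_large k_C1 k_bound dk_bound k_coercive
  (Im lam) hl pU pU1 pV pV1 iU iU1 iU2 iV iV1 iV2.
have [[mur _] [mui _]] := L2w_sqint u; have [[mvr _] [mvi _]] := L2w_sqint v.
rewrite normc_sqr !L2norm_L2w.
have vE' : {ae mu, forall x, v x + lam * u x = op U U1 U2 x +i* op V V1 V2 x}.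
  apply: ae_imply2 vE (ae_imply2 (fun x a b => conj a b) (L2w_addE v (lam *: u)) (L2w_scaleE lam u)).
  by move=> x h [h1 h2]; rewrite -h2 -h1.
set v1 := fun x => op U U1 U2 x - _; set v2 := fun x => op V V1 V2 x - _.
have v1E : {ae mu, forall x, Re (v x) = v1 x}.
  apply: ae_imply2 vE' uE => x h h'; have := congr1 (@complex.Re R) h.
  by rewrite re_add re_mul h' /= => hh; rewrite /v1 -hh; ring.
have v2E : {ae mu, forall x, Im (v x) = v2 x}.
  apply: ae_imply2 vE' uE => x h h'; have := congr1 (@complex.Im R) h.
  by rewrite im_add im_mul h' /= => hh; rewrite /v2 -hh; ring.
have [[mU _] [mV _]] := (iU, iV).
have mv1 : measurable_fun [set: R] v1.
  by apply: measurable_funB; [exact: mop|apply: measurable_funB; exact: measurable_funM].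
have mv2 : measurable_fun [set: R] v2.
  by apply: measurable_funB; [exact: mop|apply: measurable_funD; exact: measurable_funM].
rewrite (ae_sqn mw mur mU (ae_imply (fun x (h : u x = U x +i* V x) => congr1 (@complex.Re R) h) uE)).
rewrite (ae_sqn mw mui mV (ae_imply (fun x (h : u x = U x +i* V x) => congr1 (@complex.Im R) h) uE)).
by rewrite (ae_sqn mw mvr mv1 v1E) (ae_sqn mw mvi mv2 v2E).
Qed.

Lemma psi_front_sqint : sqint psi.
Proof. exact: psi_sqint w_gt0 w_C1 eta_bound A_gt0 A_large psi_C1 X_ge0 k_right k_left. Qed.

Let sqint0 : sqint (fun=> 0).
Proof. by have := sqintZ w_gt0 mw 0 psi_front_sqint; congr wsqint; apply/funext => x; rewrite mul0r. Qed.

Lemma kernel_element : exists Psi : L2w beta,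
  {ae mu, forall x, Psi x = psi x +i* 0} /\ L Psi 0.
Proof.
have [Psi PsiE] := L2w_exists psi_front_sqint sqint0.
exists Psi; split => //.
have [p1 p2 i1 i2 opE] := psi_kernel s w_gt0 w_C1 eta_bound A_gt0 A_large k_C1 k_bound dk_bound psi_C1 X_ge0 k_right k_left.
have p0 := primitive_cst (0 : R).
apply: (lin_intro p1 p2 p0 p0 psi_front_sqint i1 i2 sqint0 sqint0 sqint0) => //.
have z0E := L2w_0E beta.
apply: ae_imply z0E => x ->; rewrite opE.
by apply/eqP; rewrite eq_complex /= /operator; apply/andP; split; apply/eqP; ring.
Qed.

Section Kernel.
Variable Psi : L2w beta.
Hypothesis PsiE : {ae mu, forall x, Psi x = psi x +i* 0}.
Hypothesis LPsi : L Psi 0.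

Let psi_cont : continuous psi. Proof. exact: C1_continuous psi_C1. Qed.

Lemma Psi_neq0 : Psi != 0.
Proof.
apply/eqP => P0; have PE := PsiE; rewrite P0 in PE.
have z0E := L2w_0E beta.
have : {ae mu, forall x, psi x = 0}.
  by apply: ae_imply2 PE z0E => x -> /eqP; rewrite eq_complex /= => /andP[/eqP].
by move=> /(continuous_ae0 psi_cont)/(_ 0) h; have := psi_gt0 0; rewrite h ltxx.
Qed.

Lemma kernel_span u : L u 0 -> exists c : C, u = c *: Psi.
Proof.
move=> /lin_elim[U [U1 [U2 [V [V1 [V2 [[pU pU1 pV pV1] [iU iU1 iU2] [iV iV1 iV2] uE vE]]]]]]].
have z0E := L2w_0E beta.
have opU : {ae mu, forall x, op U U1 U2 x = 0}.
  by apply: ae_imply2 vE z0E => x -> /eqP; rewrite eq_complex /= => /andP[/eqP].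
have opV : {ae mu, forall x, op V V1 V2 x = 0}.
  by apply: ae_imply2 vE z0E => x -> /eqP; rewrite eq_complex /= => /andP[_ /eqP].
have [c Uc] := a_priori_kernel w_gt0 w_C1 eta_cont eta_bound s_bound A_gt0 A_large k_C1 k_bound dk_bound
  k_coercive psi_gt0 psi_C1 pU pU1 iU iU1 iU2 opU.
have [d Vd] := a_priori_kernel w_gt0 w_C1 eta_cont eta_bound s_bound A_gt0 A_large k_C1 k_bound dk_bound
  k_coercive psi_gt0 psi_C1 pV pV1 iV iV1 iV2 opV.
exists (c +i* d); apply/L2w_eqP.
apply: ae_imply2 (ae_imply2 (fun x a b => conj a b) uE PsiE) (L2w_scaleE (c +i* d) Psi) => x [-> h] ->.
rewrite h Uc Vd; apply/eqP; rewrite eq_complex /=; apply/andP; split; apply/eqP; ring.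
Qed.

Let rho_int' (f : R -> R) : sqint f -> intble [set: R] (fun x => rho x * f x).
Proof. exact: rho_int w_gt0 w_C1 eta_bound s_bound A_gt0 A_large psi_gt0 psi_C1 X_ge0 k_right k_left f. Qed.

Let rho_C1' : C1 rho (fun x => dual_rate k s x * rho x). Proof. exact: rho_C1. Qed.

Let mrho : measurable_fun [set: R] rho. Proof. exact: C1_measurable rho_C1'. Qed.

(** The complex-linear functional defined by the kernel element of the
    adjoint. *)
Definition pairing v : C :=
  (\int[mu]_x (rho x * Re (v x))) +i* (\int[mu]_x (rho x * Im (v x))).

Definition psi_mass : R := \int[mu]_x (rho x * psi x).

Lemma psi_mass_gt0 : 0 < psi_mass.
Proof.
apply: Rintegral_gt0.
- by move=> x; apply: cvgM; [exact: (C1_continuous rho_C1')|exact: psi_cont].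
- by move=> x; rewrite mulr_gt0// mulr_gt0 ?expR_gt0.
- exact/rho_int'/psi_front_sqint.
Qed.

Lemma pairing_ae v (f g : R -> R) : measurable_fun [set: R] f -> measurable_fun [set: R] g ->
  {ae mu, forall x, v x = f x +i* g x} ->
  pairing v = (\int[mu]_x (rho x * f x)) +i* (\int[mu]_x (rho x * g x)).
Proof.
move=> mf mg vE; have [[mr _] [mi _]] := L2w_sqint v.
by rewrite /pairing; congr (_ +i* _); apply: ae_Rintegral => //; try exact: measurable_funM;
  apply: ae_imply vE => x ->.
Qed.

Lemma pairingB u v : pairing (u - v) = pairing u - pairing v.
Proof.
have [iur iui] := L2w_sqint u; have [ivr ivi] := L2w_sqint v.
have [[mur _] [mui _]] := (iur, iui); have [[mvr _] [mvi _]] := (ivr, ivi).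
rewrite (@pairing_ae (u - v) (fun x => Re (u x) - Re (v x)) (fun x => Im (u x) - Im (v x))).
- have E (f g : R -> R) : sqint f -> sqint g ->
      \int[mu]_x (rho x * (f x - g x)) = \int[mu]_x (rho x * f x) - \int[mu]_x (rho x * g x).
    move=> fi gi; rewrite -RintegralB//; [|exact: rho_int'|exact: rho_int'].
    by apply: eq_Rintegral => x _; rewrite mulrBr.
  by rewrite !E.
- exact: measurable_funB.
- exact: measurable_funB.
- by apply: ae_imply (L2w_subE u v) => x ->; case: (u x) => a b; case: (v x).
Qed.

Lemma pairing_Psi (c : C) : pairing (c *: Psi) = c * psi_mass%:C.
Proof.
have [mp _] := psi_front_sqint.
rewrite (@pairing_ae (c *: Psi) (fun x => Re c * psi x) (fun x => Im c * psi x)).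
- have E (a : R) : \int[mu]_x (rho x * (a * psi x)) = a * psi_mass.
    rewrite /psi_mass -RintegralZl//; last exact/rho_int'/psi_front_sqint.
    by apply: eq_Rintegral => x _; rewrite mulrCA.
  rewrite !E; case: c => a b /=.
  by apply/eqP; rewrite eq_complex /=; apply/andP; split; apply/eqP; ring.
- exact: measurable_funM.
- exact: measurable_funM.
- apply: ae_imply2 PsiE (L2w_scaleE c Psi) => x -> ->; case: c => a b /=.
  by apply/eqP; rewrite eq_complex /=; apply/andP; split; apply/eqP; ring.
Qed.

Lemma rangeP v : op_range L v <-> pairing v = 0.
Proof.
split.
  move=> [u /lin_elim[U [U1 [U2 [V [V1 [V2 [[pU pU1 pV pV1] [iU iU1 iU2] [iV iV1 iV2] uE vE]]]]]]]].
  have H (F F1 F2 : R -> R) := @range_orthogonal R w (wlog beta) k dk psi B s A X w_gt0 w_C1 eta_bound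
    s_bound A_gt0 A_large k_C1 k_bound dk_bound psi_gt0 psi_C1 X_ge0 k_right k_left F F1 F2.
  have [ivr ivi] := L2w_sqint v; have [[mvr _] [mvi _]] := (ivr, ivi).
  by rewrite (pairing_ae (mop iU iU1 iU2) (mop iV iV1 iV2) vE) !H.
move=> /eqP; rewrite eq_complex /= => /andP[/eqP vr /eqP vi].
have [ivr ivi] := L2w_sqint v.
have S (f : R -> R) := @solve R w (wlog beta) k dk psi B s A X w_gt0 w_C1 eta_bound
    s_bound A_gt0 A_large k_C1 k_bound dk_bound psi_gt0 psi_C1 X_ge0 k_right k_left f.
have [U [U1 [U2 [pU pU1 [iU iU1 iU2 UE]]]]] := S _ ivr vr.
have [V [V1 [V2 [pV pV1 [iV iV1 iV2 VE]]]]] := S _ ivi vi.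
have [u uE] := L2w_exists iU iV.
exists u; apply: (lin_intro pU pU1 pV pV1) => //.
by apply: aeW => x; rewrite UE VE; case: (v x).
Qed.

(** A form of continuity: elements of norm at most [tau] have a pairing of
    size O(tau). *)
Lemma pairing_bound v (tau : R) : 0 < tau -> L2norm w v <= tau ->
  `|Re (pairing v)| <= tau * ((\int[mu]_x dens w psi s x + 1) / 2) /\
  `|Im (pairing v)| <= tau * ((\int[mu]_x dens w psi s x + 1) / 2).
Proof.
move=> t0 vt; have [ivr ivi] := L2w_sqint v.
have nn := L2norm_ge0 v.
have : L2norm w v ^+ 2 <= tau ^+ 2 by rewrite lerXn2r ?nnegrE ?(ltW t0).
rewrite L2norm_L2w => H.
have nr := sqn_ge0 w_gt0 (fun x => Re (v x)); have ni := sqn_ge0 w_gt0 (fun x => Im (v x)).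
have bd (f : R -> R) : sqint f -> sqn f <= tau ^+ 2 ->
    `|\int[mu]_x (rho x * f x)| <= tau * ((\int[mu]_x dens w psi s x + 1) / 2).
  move=> fi ft.
  apply: le_trans (young_dual w_gt0 w_C1 eta_bound s_bound A_gt0 A_large psi_gt0 psi_C1 X_ge0 k_right k_left
    measurableT t0 fi) _.
  have : sqn f / tau <= tau by rewrite ler_pdivrMr// -expr2.
  lra.
by split; apply: bd => //; lra.
Qed.

Lemma closed_rangeL : closed (op_range L).
Proof.
move=> v cv; apply/rangeP.
pose K := (\int[mu]_x dens w psi s x + 1) / 2.
have K0 : 0 <= K by rewrite divr_ge0// addr_ge0// Rintegral_ge0// => x _; rewrite ltW// dens_gt0.
have small (d : R) : 0 < d -> `|Re (pairing v)| <= d /\ `|Im (pairing v)| <= d.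
  move=> d0; pose tau := d / (K + 1).
  have K1 : 0 < K + 1 by rewrite ltr_wpDl.
  have t0 : 0 < tau by rewrite divr_gt0.
  have tc0 : 0 < tau%:C by rewrite ltcR.
  have [y [/rangeP py vy]] := cv _ (nbhsx_ballx v _ tc0).
  have vyt : L2norm w (L2w_fun (v - y : L2w beta)) <= tau.
    by move: vy; rewrite -ball_normE /= L2w_normE ltcR => /ltW.
  have [] := pairing_bound t0 vyt; rewrite pairingB py subr0.
  have le : tau * K <= d.
    have : tau * (K + 1) = d by rewrite /tau divfK// gt_eqF.
    have := mulr_ge0 (ltW t0) K0; lra.
  by move=> h1 h2; split; [exact: le_trans h1 le|exact: le_trans h2 le].
apply/eqP; rewrite eq_complex /= -!normr_le0.
by apply/andP; split; apply/ler_addgt0Pl => d d0; rewrite addr0; have [] := small d d0.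
Qed.

(** Kernel and cokernel are both spanned by the derivative of the wave, since
    its pairing with [rho] does not vanish. *)
Lemma fredholm0 : fredholm_of_index (op_shift L 0) 0.
Proof.
have E : op_shift L 0 = L.
  by apply/funext => u; apply/funext => v; rewrite /op_shift scale0r addr0.
rewrite E; exists 1%N, 1%N; split.
- exact: closed_rangeL.
- exists (fun=> Psi); split => // u /kernel_span[c ->].
  exists [ffun=> c]; split; first by rewrite big_ord1 ffunE.
  move=> c' /eqP; rewrite big_ord1 -subr_eq0 -scalerBl scaler_eq0 (negbTE Psi_neq0) orbF subr_eq0.
  by move=> /eqP cE; apply/ffunP => i; rewrite ffunE ord1.
- exists (fun=> Psi) => v.
  have m0 : psi_mass%:C != 0 by apply/eqP => /complexI h; have := psi_mass_gt0; rewrite h ltxx.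
  exists [ffun=> pairing v / psi_mass%:C]; split.
    by rewrite big_ord1 ffunE; apply/rangeP; rewrite pairingB pairing_Psi divfK// subrr.
  move=> c; rewrite big_ord1 => /rangeP; rewrite pairingB pairing_Psi => /eqP.
  rewrite subr_eq0 => /eqP pE; apply/ffunP => i; rewrite ffunE ord1 pE mulfK//.
- by rewrite subrr.
Qed.

End Kernel.

(** For lam <> 0 in the half-plane the estimate excludes a kernel; index 0
    then forces the cokernel to vanish, and the estimate bounds the inverse. *)
Lemma sigma0_slice (c0 : R) : 0 <= c0 <= A ^+ 2 / 16 ->
  sigma0 L `&` [set z : C | - c0 <= Re z] = [set 0].
Proof.
move=> /andP[c00 cA]; have [Psi [PsiE LPsi]] := kernel_element.
apply/seteqP; split => [lam [] [ninv fred] /= lamc|_ ->]; last first.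
  split; last by rewrite /= oppr_le0.
  split; last exact: fredholm0 PsiE LPsi.
  move=> [ex _]; have [u [_ uni]] := ex 0.
  (* Psi and 0 have the same image, and Psi is not 0. *)
  have L00 : L 0 0 by have := linB LPsi LPsi; rewrite !subrr.
  have := uni Psi; rewrite /op_shift scale0r addr0 => /(_ LPsi) uP.
  have := uni 0; rewrite /op_shift scale0r addr0 => /(_ L00) u0.
  have P0 : Psi = 0 by rewrite -uP u0.
  by move: (Psi_neq0 PsiE); rewrite P0 eqxx.
apply: contrapT => /eqP lam0; apply: ninv.
have lamA : - (A ^+ 2 / 16) <= Re lam by apply: le_trans lamc; rewrite lerN2.
have nl : 0 < normc lam.
  by rewrite -ltcR -[X in _ < X]/(`|lam|) normr_gt0.
have est u v : op_shift L lam u v ->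
    normc lam * L2norm w u <= Num.sqrt 4000 * L2norm w v.
  move=> /(resolvent_estimate lamA) H.
  rewrite -ler_sqr ?nnegrE ?mulr_ge0 ?sqrtr_ge0 ?(ltW nl)//.
  by rewrite !exprMn [Num.sqrt 4000 ^+ 2]sqr_sqrtr ?ler0n.
have ker0 u : op_shift L lam u 0 -> u = 0.
  move=> /est H; apply: L2w_norm_eq0; congr (_%:C).
  have n0 : L2norm w (0 : L2w beta) = 0.
    by apply: (@complexI R); rewrite -L2w_normE normr0.
  move: H; rewrite n0 mulr0 pmulr_rle0// => H.
  by apply/eqP; rewrite eq_le H L2norm_ge0.
have [n [m [_ [b [bk bs]] [b' codim] /eqP nm]]] := fred.
(* Over a nonempty basis of a trivial kernel 0 would have two expansions. *)
have n0 : n = 0%N.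
  case: n b bk bs nm => // n b bk bs nm; exfalso.
  have k0 : op_kernel (op_shift L lam) 0 by rewrite -(ker0 _ (bk ord0)); exact: bk.
  have [c [_ cu]] := bs 0 k0.
  have e1 := cu [ffun=> 0] _; have e2 := cu [ffun=> 1] _.
  have : [ffun=> 0] = [ffun=> 1] :> {ffun 'I_n.+1 -> C}.
    rewrite -e1; last by rewrite big1// => i _; rewrite (ker0 _ (bk i)) scaler0.
    by rewrite e2// big1// => i _; rewrite (ker0 _ (bk i)) scaler0.
  by move=> /ffunP/(_ ord0); rewrite !ffunE => /eqP; rewrite eq_sym oner_eq0.
move: nm; rewrite n0 sub0r eq_sym oppr_eq0 => /eqP[m0].
rewrite m0 in b' codim.
have surj v : exists u, op_shift L lam u v.
  by have [c [[u uv] _]] := codim v; exists u; move: uv; rewrite big_ord0 subr0.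
split.
  move=> v; have [u uv] := surj v; exists u; split => // u' uv'.
  apply/eqP; rewrite -subr_eq0; apply/eqP; apply: ker0.
  have := linB uv uv'; rewrite /op_shift.
  by rewrite opprD addrACA subrr !add0r scalerBr.
exists ((Num.sqrt 4000 / normc lam)%:C) => u v /est H.
rewrite !L2w_normE -rmorphM lecR mulrAC ler_pdivlMr// mulrC.
exact: H.
Qed.

End Spectrum.
End Lines.

Theorem theorem3p8 (R : realType) (alpha beta : R)
  (alpha_bounds : 0 < alpha < 1 / 2) (beta_gt2 : 2 < beta)
  (eps0 : R) (eps0_gt0 : 0 < eps0) (zm z0 zp : R[i] -> R[i])
  (zm_holo : holomorphic_on (punctured_disc eps0) zm)
  (z0_holo : holomorphic_on (punctured_disc eps0) z0)
  (zp_holo : holomorphic_on (punctured_disc eps0) zp)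
  (z_roots : forall e : R[i], punctured_disc eps0 e ->
     [/\ reaction alpha%:C e (zm e) = 0, reaction alpha%:C e (z0 e) = 0
       & reaction alpha%:C e (zp e) = 0])
  (z_real : forall e : R, 0 < e < eps0 ->
     [/\ complex.Im (zm e%:C) = 0, complex.Im (z0 e%:C) = 0
       & complex.Im (zp e%:C) = 0])
  (z_order : forall e : R, 0 < e < eps0 ->
     complex.Re (zm e%:C) < complex.Re (z0 e%:C) < complex.Re (zp e%:C))
  (z0_asymp : bigO_at0 (fun e => z0 e - ((1 + alpha) / 3)%:C)
                       (fun e => e ^+ 2))
  (zp_asymp : bigO_at0
     (fun e => zp e - ((Num.sqrt 3)%:C * e^-1 + ((1 + alpha) / 3)%:C))
     (fun e => e))
  (zm_asymp : bigO_at0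
     (fun e => zm e - (- (Num.sqrt 3)%:C * e^-1 + ((1 + alpha) / 3)%:C))
     (fun e => e)) :
  exists (eps1 c : R) (r : R -> R),
    [/\ 0 < eps1 <= eps0, 0 < c, bigO_right0 r (fun e => e^-1) &
      forall e : R, 0 < e < eps1 ->
        sigma0 (linearization (beta := beta) alpha e (complex.Re (zm e%:C))
                  (complex.Re (z0 e%:C)) (complex.Re (zp e%:C)))
          `&` [set z : R[i] | - c * e ^- 2 + r e <= complex.Re z]
        = [set 0]].
Proof.
have beta_gt0 : 0 < beta by lra.
have B0 : 0 < 100 * (beta + 1) by lra.
have [eps1 [/andP[eps10 eps1_le] asym]] := wave_asymptotics eps0_gt0 B0 z0_asymp zp_asymp zm_asymp.
exists eps1, (1 / 16), (fun=> 0); split => //.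
- by rewrite eps10.
- by apply/eqO_exP; exists 1 => //; near=> x; rewrite normr0 mul1r.
move=> e /andP[e0 e1]; have e2 : 0 < e < eps0 by rewrite e0 (lt_le_trans e1).
have [Ae AB s1] := asym e (introT andP (conj e0 e1)).
have [hm h0 hp] := z_real e e2.
have /andP[m_lt0 lt0p] := z_order e e2.
have pd : punctured_disc eps0 e%:C by rewrite /punctured_disc /mkset normc_real gtr0_norm.
have [r1 r2 r3] := z_roots _ pd.
have realE (z : R[i]) : complex.Im z = 0 -> z = (complex.Re z)%:C by case: z => a b /= ->.
have root z : complex.Im z = 0 -> reaction alpha%:C e%:C z = 0 -> reaction alpha e (complex.Re z) = 0.
  by move=> /realE zE h; apply: (@complexI R); rewrite -reaction_real -zE.
have sE : `|wave_speed (complex.Re (zm e%:C)) (complex.Re (z0 e%:C)) (complex.Re (zp e%:C))| <= 1.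
  by rewrite wave_speedE// (lt_trans m_lt0).
have := @sigma0_slice R alpha beta e _ _ _ beta_gt0 m_lt0 lt0p (root _ hm r1) (root _ h0 r2) (root _ hp r3) sE AB
  (1 / 16 * e ^- 2) _.
rewrite (_ : [set z : R[i] | - (1 / 16) * e ^- 2 + 0 <= complex.Re z] =
   [set z : R[i] | - (1 / 16 * e ^- 2) <= complex.Re z]); last first.
  by apply/funext => z; rewrite /= addr0 mulNr.
apply; apply/andP; split; first by rewrite mulr_ge0// invr_ge0 sqr_ge0.
rewrite mulrAC mul1r ler_pM2r// -exprVn lerXn2r ?nnegrE ?invr_ge0 ?(ltW e0)//.
by rewrite subr_ge0 ltW// (lt_trans m_lt0).
Unshelve. all: by end_near. Qed.
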